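(* Let $L>0$ and let $K=\{(t,x)\in[0,T_0]\times\mathbb R:\ x_0-L+t\le x\le x_0+L-t\}$ be a compact trapezoid with base $K_0=[x_0-L,x_0+L]$ (for some $x_0\in\mathbb R$) and height $T_0\in(0,L]$. Let $(u_0,v_0)\in L^{1,1}(K_0;M)$ satisfy the compatibility condition $v_0(x)\in T_{u_0(x)}M$ for almost every $x\in K_0$, and let $f\in L^1(K;\mathbb R^n)$. Let $u^1,u^2\in\mathscr H(K)$ be two $M$-valued mild solutions in $K$ of the forced wave map equation with the same forcing $f$ and the same initial data $(u_0,v_0)$. Then $u^1=u^2$.
   Context: For a trapezoid $K$, $K_t=\{x:(t,x)\in K\}$. $\mathscr H(K)$ (height $T_0<\infty$): all continuous $u:K\to\mathbb R^n$ whose weak derivatives $\partial_tu,\partial_xu$ exist in $L^1(\mathrm{int}\,K)$ and belong to $C([0,T_0];L^1(K_\cdot))$, meaning that their extensions by $0$ to $[0,T_0]\times K_0$ are continuous functions of $t$ with values in $L^1(K_0)$; norm $\|u\|_{\mathscr H(K)}=\sup_K|u|+\sup_t\int_{K_t}(|\partial_xu|+|\partial_tu|)\,dx$. $M\subset\mathbb R^n$ is a compact Riemannian manifold, isometrically embedded in $\mathbb R^n$; $\pi_p:\mathbb R^n\to T_pM$ is the orthogonal projection. Forced wave map equation: $\partial_t^2u-\partial_x^2u=\sum_{j,k=1}^n\Gamma_{jk}(u)(\partial_tu_j\partial_tu_k-\partial_xu_j\partial_xu_k)+P(u)f$, which is the explicit form of the condition $\partial_t^2u-\partial_x^2u-f\perp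 T_uM$ for $M$-valued $u$. Here $\Gamma_{jk}:M\to\mathbb R^n$ and $P:M\to\mathcal L(\mathbb R^n)$ are Lipschitz, $P(p)=\pi_p$, and $\sum_{j,k}\Gamma_{jk}(p)a_jb_k=A_p(a,b)$ for $a,b\in T_pM$, where $A_p$ is the second fundamental form of $M\subset\mathbb R^n$ ($A_p(a,a)$ is the normal component of $\gamma''(0)$ for any curve $\gamma$ in $M$ with $\gamma(0)=p$, $\gamma'(0)=a$). $\Gamma_{jk}$ and $P$ are extended to bounded, globally Lipschitz functions on $\mathbb R^n$. For an interval $I$: $\dot W^{1,1}(I;\mathbb R^n)$ is the set of locally absolutely continuous $v:I\to\mathbb R^n$ with $Dv=v'\in L^1(I)$; $L^{1,1}(I;M)=(C(I;M)\cap\dot W^{1,1}(I;\mathbb R^n))\times L^1(I;\mathbb R^n)$, with norm $\|(g,h)\|_{L^{1,1}(I)}=\|g\|_{L^\infty(I)}+\|g'\|_{L^1(I)}+\|h\|_{L^1(I)}$. An $M$-valued mild solution on $K$ with initial data $(u_0,v_0)$ (satisfying the compatibility condition) and forcing $f$ is a continuous $u:K\to M$ such that: the weak derivatives $\partial_tu,\partial_xu$ exist as locally integrable functions; for every time $t$ of $K$, $\partial_tu(t,x)\in T_{u(t,x)}M$ for a.e. $x\in K_t$; and for every $(t,x)\in K$ (the double integral being of an integrable function) $$u(t,x)=\tfrac12\big(u_0(x+t)+u_0(x-t)\big)+\tfrac12\int_{x-t}^{x+t}v_0(y)\,dy+\tfrac12\int_0^t\int_{x-t+\tau}^{x+t-\tau}\Big[\sum_{j,k}\Gamma_{jk}(u)(\partial_tu_j\partial_tu_k-\partial_xu_j\partial_xu_k)+P(u)f\Big](\tau,y)\,dy\,d\tau.$$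 *)

(* Defs.v *)
From HB Require Import structures.
From mathcomp Require Import all_boot all_order all_algebra.
From mathcomp Require Import all_classical all_reals all_analysis.

Set Implicit Arguments.
Unset Strict Implicit.
Unset Printing Implicit Defensive.

Import Order.TTheory GRing.Theory Num.Theory.
Import numFieldNormedType.Exports.

Local Open Scope classical_set_scope.
Local Open Scope ring_scope.

(* Vectors of R^n are row vectors.  Their library norm is the sup norm; all the
   notions below in which a norm on R^n occurs (continuity, Lipschitz
   continuity, L^1 convergence, absolute continuity) are invariant under
   passing to the equivalent Euclidean norm. *)

(* All iterated directional derivatives of order at most k exist and are
   continuous on U; for open U in a finite-dimensional space V this is f in
   C^k(U). *)
Fixpoint Ck_on (R : realType) (V W : normedModType R) (k : nat) (U : set V)
    (f : V -> W) : Prop :=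
  {in U, continuous f} /\
  if k is k'.+1 then
    forall v : V, {in U, forall x, derivable f x v} /\ Ck_on k' U ('D_v f)
  else True.

Definition smooth_on (R : realType) (V W : normedModType R) (U : set V)
    (f : V -> W) : Prop := forall k, Ck_on k U f.

Definition dotv (R : realType) (n : nat) (a b : 'rV[R]_n) : R :=
  \sum_(i < n) a 0 i * b 0 i.

(* w is the orthogonal projection of v on the linear subspace T of R^n. *)
Definition is_orth_proj (R : realType) (n : nat) (T : set 'rV[R]_n)
    (v w : 'rV[R]_n) : Prop :=
  T w /\ forall a, T a -> dotv (v - w) a = 0.

(* M is a smooth embedded d-dimensional submanifold, without boundary, of R^n:
   near each of its points a diffeomorphism phi between open sets of R^n, with
   inverse psi, maps M to the slice R^d x {0}. *)
Definition submanifold (R : realType) (n d : nat) (M : set 'rV[R]_n) : Prop :=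
  (d <= n)%N /\
  forall p, M p -> exists (U : set 'rV[R]_n) (phi psi : 'rV[R]_n -> 'rV[R]_n),
    [/\ open U /\ U p,
        open (phi @` U),
        smooth_on U phi /\ smooth_on (phi @` U) psi,
        {in U, cancel phi psi}
      & forall x, U x -> (M x <-> forall i : 'I_n, (d <= i)%N -> phi x 0 i = 0)].

(* A smooth curve in M through p at parameter 0; only its values on some
   ]-e, e[ matter. *)
Definition curve_through (R : realType) (n : nat) (M : set 'rV[R]_n)
    (p : 'rV[R]_n) (gamma : R -> 'rV[R]_n) : Prop :=
  gamma 0 = p /\
  exists2 e : R, 0 < e &
    smooth_on (V := R^o) `]- e, e[ gamma /\
    forall s : R, s \in `]- e, e[ -> M (gamma s).

Definition tangent (R : realType) (n : nat) (M : set 'rV[R]_n)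
    (p : 'rV[R]_n) : set 'rV[R]_n :=
  [set a | exists2 gamma, curve_through M p gamma & derive1 gamma 0 = a].

(* A is, on T_pM, the second fundamental form of M at p: the symmetric bilinear
   map such that A(gamma'(0), gamma'(0)) is the normal component of gamma''(0)
   for every curve gamma in M through p. *)
Definition second_fundamental_form (R : realType) (n : nat)
    (M : set 'rV[R]_n) (p : 'rV[R]_n)
    (A : 'rV[R]_n -> 'rV[R]_n -> 'rV[R]_n) : Prop :=
  [/\ forall a b, tangent M p a -> tangent M p b -> A a b = A b a,
      forall (c : R) a a' b, tangent M p a -> tangent M p a' ->
        tangent M p b -> A (c *: a + a') b = c *: A a b + A a' b
    & forall gamma, curve_through M p gamma ->
        is_orth_proj (tangent M p) (derive1n 2 gamma 0)
          (derive1n 2 gamma 0 - A (derive1 gamma 0) (derive1 gamma 0))].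

(* Gamma and P are the coefficients of the wave map equation into M, already
   extended to bounded Lipschitz functions on R^n.  The endomorphism P p acts
   on row vectors by v |-> v *m P p. *)
Definition wave_map_coefficients (R : realType) (n : nat)
    (M : set 'rV[R]_n) (Gamma : 'I_n -> 'I_n -> 'rV[R]_n -> 'rV[R]_n)
    (P : 'rV[R]_n -> 'M[R]_n) : Prop :=
  [/\ forall j k, [bounded Gamma j k p | p in [set: 'rV[R]_n]] /\
                  lipschitz (Gamma j k),
      [bounded P p | p in [set: 'rV[R]_n]] /\ lipschitz P,
      forall p, M p -> forall v, is_orth_proj (tangent M p) v (v *m P p)
    & forall p, M p -> second_fundamental_form M p
        (fun a b => \sum_(j < n) \sum_(k < n) (a 0 j * b 0 k) *: Gamma j k p)].

Notation leb1 R := (@lebesgue_measure R).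
Notation leb2 R := (@lebesgue_measure R \x @lebesgue_measure R)%E.

(* L^1(D; R^n), by components.  The library's sigma-algebras are the Borel ones,
   which is no restriction since each class in L^1 has a Borel representative. *)
Definition L1 (R : realType) (n : nat) (d : measure_display)
    (T : measurableType d) (mu : {measure set T -> \bar R}) (D : set T)
    (f : T -> 'rV[R]_n) : Prop :=
  forall i, mu.-integrable D (EFin \o (fun z => f z 0 i)).

Definition L1loc2 (R : realType) (n : nat) (O : set (R * R))
    (f : R * R -> 'rV[R]_n) : Prop :=
  forall C : set (R * R), compact C -> C `<=` O -> L1 (leb2 R) C f.

Definition vint (R : realType) (n : nat) (d : measure_display)
    (T : measurableType d) (mu : {measure set T -> \bar R}) (D : set T)
    (f : T -> 'rV[R]_n) : 'rV[R]_n :=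
  \row_i \int[mu]_(z in D) f z 0 i.

Definition test_function (R : realType) (O : set (R * R)) (phi : R * R -> R)
    : Prop :=
  smooth_on (V := (R^o * R^o)%type) (W := R^o) setT phi /\
  let supp := closure [set z | phi z != 0] in compact supp /\ supp `<=` O.

(* w is the weak derivative of u on the open set O in the direction v. *)
Definition weak_derivative (R : realType) (n : nat) (O : set (R * R))
    (v : R * R) (u w : R * R -> 'rV[R]_n) : Prop :=
  [/\ L1loc2 O u, L1loc2 O w
    & forall phi, test_function O phi -> forall i,
        \int[leb2 R]_(z in O) (u z 0 i * 'D_(v : R^o * R^o) phi z)
        = - \int[leb2 R]_(z in O) (w z 0 i * phi z)].

(* Points of space-time are pairs (t, x); dt and dx are the coordinate
   directions, and the section K_t is xsection K t. *)
Definition dt (R : realType) : R * R := (1, 0).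
Definition dx (R : realType) : R * R := (0, 1).

Definition trapezoid (R : realType) (x0 L T0 : R) : set (R * R) :=
  [set z | 0 <= z.1 <= T0 /\ x0 - L + z.1 <= z.2 <= x0 + L - z.1].

(* w belongs to C([0, T0]; L^1(K_.)). *)
Definition continuous_in_L1 (R : realType) (n : nat) (K : set (R * R)) (T0 : R)
    (w : R * R -> 'rV[R]_n) : Prop :=
  let ext (t x : R) := if (t, x) \in K then w (t, x) else 0 in
  let K0 := xsection K 0 in
  (forall t : R, 0 <= t <= T0 -> L1 (leb1 R) K0 (ext t)) /\
  (forall t : R, 0 <= t <= T0 ->
     (\int[leb1 R]_(x in K0) (`|ext s x - ext t x|%R)%:E)%E
       @[s --> within `[0, T0] (nbhs t)] --> 0%E).

(* u belongs to H(K), and ut, ux are its weak derivatives d_t u, d_x u.  These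
   are explicit arguments because an almost everywhere class on K does not
   determine the restriction to a section K_t: ut and ux are representatives
   which restrict, for every t, to the element of L^1(K_t) given by
   C([0, T0]; L^1(K_.)). *)
Definition in_H (R : realType) (n : nat) (K : set (R * R)) (T0 : R)
    (u ut ux : R * R -> 'rV[R]_n) : Prop :=
  [/\ {within K, continuous u},
      weak_derivative K° (dt R) u ut /\ weak_derivative K° (dx R) u ux,
      L1 (leb2 R) K° ut /\ L1 (leb2 R) K° ux
    & continuous_in_L1 K T0 ut /\ continuous_in_L1 K T0 ux].

Definition abs_continuous (R : realType) (n : nat) (a b : R)
    (g : R -> 'rV[R]_n) : Prop :=
  forall e : R, 0 < e -> exists2 delta : R, 0 < delta &
    forall (m : nat) (s t : 'I_m -> R),
      (forall i, [/\ a <= s i, s i <= t i & t i <= b]) ->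
      (forall i j, i != j -> t i <= s j \/ t j <= s i) ->
      \sum_(i < m) (t i - s i) < delta ->
      \sum_(i < m) `|g (t i) - g (s i)| < e.

(* g belongs to the homogeneous space W^{1,1}(I; R^n). *)
Definition dotW11 (R : realType) (n : nat) (I : set R) (g : R -> 'rV[R]_n)
    : Prop :=
  (forall a b, a <= b -> `[a, b] `<=` I -> abs_continuous a b g) /\
  exists2 dg : R -> 'rV[R]_n, L1 (leb1 R) I dg &
    {ae leb1 R, forall x, I x -> is_derive (x : R^o) 1 g (dg x)}.

(* (g, h) belongs to L^{1,1}(I; M). *)
Definition in_L11 (R : realType) (n : nat) (I : set R) (M : set 'rV[R]_n)
    (g h : R -> 'rV[R]_n) : Prop :=
  [/\ {within I, continuous g}, forall x, I x -> M (g x), dotW11 I g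
    & L1 (leb1 R) I h].

Definition wave_map_rhs (R : realType) (n : nat)
    (Gamma : 'I_n -> 'I_n -> 'rV[R]_n -> 'rV[R]_n) (P : 'rV[R]_n -> 'M[R]_n)
    (f u ut ux : R * R -> 'rV[R]_n) (z : R * R) : 'rV[R]_n :=
  \sum_(j < n) \sum_(k < n)
    (ut z 0 j * ut z 0 k - ux z 0 j * ux z 0 k) *: Gamma j k (u z)
  + f z *m P (u z).

Definition backward_triangle (R : realType) (t x : R) : set (R * R) :=
  [set z | 0 <= z.1 <= t /\ x - t + z.1 <= z.2 <= x + t - z.1].

(* M-valued mild solution on K, with ut and ux the weak derivatives of u. *)
Definition mild_solution (R : realType) (n : nat) (K : set (R * R))
    (M : set 'rV[R]_n) (Gamma : 'I_n -> 'I_n -> 'rV[R]_n -> 'rV[R]_n)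
    (P : 'rV[R]_n -> 'M[R]_n) (u0 v0 : R -> 'rV[R]_n)
    (f u ut ux : R * R -> 'rV[R]_n) : Prop :=
  [/\ {within K, continuous u} /\ (forall z, K z -> M (u z)),
      weak_derivative K° (dt R) u ut /\ weak_derivative K° (dx R) u ux,
      forall t, {ae leb1 R, forall x, K (t, x) ->
        tangent M (u (t, x)) (ut (t, x))}
    & forall t x, K (t, x) ->
        let F := wave_map_rhs Gamma P f u ut ux in
        L1 (leb2 R) (backward_triangle t x) F /\
        u (t, x) =
          2^-1 *: (u0 (x + t) + u0 (x - t))
          + 2^-1 *: vint (leb1 R) `[x - t, x + t] v0
          + 2^-1 *: vint (leb1 R) `[0, t] (fun tau =>
              vint (leb1 R) `[x - t + tau, x + t - tau]
                (fun y => F (tau, y)))].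

(* Main.v *)
From HB Require Import structures.
Require Import Defs.
From mathcomp Require Import all_boot all_order all_algebra.
From mathcomp Require Import all_classical all_reals all_analysis.
From mathcomp Require Import measurable_realfun ring lra.

Set Implicit Arguments.
Unset Strict Implicit.
Unset Printing Implicit Defensive.

Import Order.TTheory GRing.Theory Num.Theory.
Import numFieldNormedType.Exports.

Local Open Scope classical_set_scope.
Local Open Scope ring_scope.

(** In the null coordinates [xi = t + x], [eta = t - x] the wave map equation is
    a Goursat problem: the backward triangle below a point of the trapezoid
    becomes [xi <= A], [eta <= B], [0 <= xi + eta] ([backward_triangleE]), and
    the mild formula reads
      [U = phi(xi) + psi(eta) + 1/4 (integral of F over the quadrant below)].
    With [p = ut + ux] and [q = ut - ux] the quadratic terms form a null form,
      [ut_j ut_k - ux_j ux_k = (p_j q_k + q_j p_k) / 2],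
    so that every product pairs a [p] with a [q].

    Testing the weak derivatives of [U] against products of bump functions in
    [xi] and [eta] shows that [p] is, almost everywhere, half the integral of
    [F] along the segment below the point in the [eta] direction, plus a
    function of [xi] alone ([transport_with_data]); likewise for [q] after
    exchanging the coordinates ([null_wave_swap]). Hence [|p| <= a(xi)] and
    [|q| <= b(eta)] with [a] and [b] integrable in one variable
    ([null_wave_amplitudes]). This is what makes the [L^1] setting sufficient:
    [a(xi) b(eta)] is integrable in the plane.

    For two solutions with the same data, the functions of one variable cancel
    in the differences [p1 - p2] and [q1 - q2], which are thus half the
    integrals of [F1 - F2] along null segments ([transport_without_data]), while
    [U1 - U2] is a quarter of its integral over a quadrant. The Lipschitz bounds
    on the coefficients ([wave_map_rhs_lipschitz]) then give, for
    [g = sum_i |F1_i - F2_i|],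
      [g <= k (integral of g over the quadrant)
            + b(eta) (integral of g in the eta direction)
            + a(xi) (integral of g in the xi direction)]
    with integrable weights [k], [a] and [b]. On a strip
    [s < xi + eta <= s + delta] the weights have small mass, uniformly in [s];
    if [g] vanishes below the strip, integrating the inequality over it bounds
    the mass of [g] by half of itself ([mass_step]). So [g] vanishes almost
    everywhere ([goursat_uniqueness]), and [U1 = U2] in the open triangle
    ([null_waves_unique]). At the apex the two solutions agree by continuity. *)

(** * A flat function *)

Section flat.
Context {R : realType}.
Implicit Types (x y a b c : R) (k m : nat).

(** The powers [k] make the family stable under differentiation, up to linear
    combinations; the case [k = 0] is the usual flat function. *)
Definition flat k x : R := if 0 < x then x^-1 ^+ k * expR (- x^-1) else 0.

Lemma flat_le0 k x : x <= 0 -> flat k x = 0.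
Proof. by move=> x0; rewrite /flat ltNge x0. Qed.

Lemma flat_ge0 k x : 0 <= flat k x.
Proof.
rewrite /flat; case: ifPn => // x0.
by rewrite mulr_ge0 ?expR_ge0// exprn_ge0// invr_ge0 ltW.
Qed.

(** The exponential beats the power of degree [k.+1], which leaves a factor
    tending to 0 with [x]. *)
Lemma flat_le k x : flat k x <= k.+1`!%:R * `|x|.
Proof.
rewrite /flat; case: ifPn => x0; last by rewrite mulr_ge0.
rewrite gtr0_norm// expRN.
have y0 : 0 <= x^-1 by rewrite invr_ge0 ltW.
have fac : 0 < k.+1`!%:R :> R by rewrite ltr0n fact_gt0.
have h : x^-1 ^+ k.+1 / k.+1`!%:R <= expR x^-1.
  by apply: le_trans (expR_ge1Dxn k y0); rewrite lerDr.
rewrite ler_pdivrMr ?expR_gt0//.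
apply: (@le_trans _ _ (k.+1`!%:R * x * (x^-1 ^+ k.+1 / k.+1`!%:R))).
  rewrite exprS le_eqVlt; apply/orP; left; apply/eqP; field.
  by rewrite (gt_eqF x0) (gt_eqF fac).
by rewrite ler_wpM2l// mulr_ge0// ltW.
Qed.

(** At 0 the difference quotient of [flat k] is [flat k.+1] on the right and 0 on
    the left, and [flat_le] makes it tend to 0. *)
Lemma is_derive_flat k x :
  is_derive x (1 : R) (flat k) (flat k.+2 x - k%:R * flat k.+1 x).
Proof.
have [x0|x0|->] := ltgtP x 0.
- rewrite !flat_le0 ?(ltW x0)// mulr0 subr0.
  apply: (@near_eq_is_derive _ _ _ (cst 0)).
  by near=> y; rewrite /= flat_le0 ?ltW//; near: y; exact: lt_nbhsl.
- rewrite {2 3}/flat x0.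
  apply: (@near_eq_is_derive _ _ _ (fun y => y^-1 ^+ k * expR (- y^-1))).
    by near=> y; rewrite /flat ifT//; near: y; exact: lt_nbhsr.
  have xn : x != 0 by rewrite gt_eqF.
  have dv : is_derive x 1 (fun y => y^-1) (- x ^- 2).
    have := @is_deriveV R id x 1 1 xn _.
    by rewrite scaler1; apply; exact: is_derive_id.
  have de : is_derive x 1 (expR \o (fun y => - y^-1)) (expR (- x^-1) * x ^- 2).
    apply: is_derive1_comp.
    by have := is_deriveN dv; rewrite opprK.
  have -> : (fun y => y^-1 ^+ k * expR (- y^-1)) =
      ((fun y => y^-1) ^+ k) * (expR \o (fun y => - y^-1)).
    by apply/funext => y/=; rewrite fctE /= exprfctE.
  apply: is_derive_eq.
  rewrite /GRing.scale/= exprfctE.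
  case: k => [|k]; first by rewrite /= !expr0; field.
  by rewrite -!natr1 !exprS /=; field.
- rewrite !flat_le0// mulr0 subr0.
  have lim0 : h^-1 *: ((flat k \o shift 0) (h *: (1 : R)) - flat k 0) @[h --> 0^']
      --> (0 : R).
    apply/cvgr0Pnorm_le => e e0; near=> h.
    rewrite /= addr0 (flat_le0 k (lexx 0)) subr0 /GRing.scale /= mulr1.
    have [h0|h0] := leP h 0; first by rewrite flat_le0// mulr0 normr0 ltW.
    have -> : h^-1 * flat k h = flat k.+1 h.
      by rewrite /flat h0 exprS mulrA.
    rewrite ger0_norm ?flat_ge0//; apply: le_trans (flat_le _ _) _.
    rewrite -ler_pdivlMl ?ltr0n ?fact_gt0//; near: h.
    apply: dnbhs0_le.
    by rewrite mulr_gt0// invr_gt0 ltr0n fact_gt0.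
  apply: DeriveDef; last exact: cvg_lim lim0.
  by apply/cvg_ex; exists 0.
Unshelve. all: by end_near. Qed.

Lemma continuous_flat k : continuous (flat k).
Proof.
move=> x; apply: differentiable_continuous; apply/derivable1_diffP.
by have [] := is_derive_flat k x.
Qed.

End flat.

(** * Smooth functions on the plane *)

Section Ck.
Context {R : realType} {V : normedModType R}.
Implicit Types (f g : V -> R) (k : nat).

Lemma Ck_onS k f :
  @Ck_on R V R k.+1 setT f -> @Ck_on R V R k setT f.
Proof.
elim: k f => [|k IH] f [cf df]; first by split.
split=> // v; split; first by have [] := df v.
by apply: IH; have [] := df v.
Qed.

Lemma Ck_on_cst k (c : R) : @Ck_on R V R k setT (cst c).
Proof.
elim: k c => [|k IH] c; split => //; try by move=> x _; exact: cst_continuous.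
move=> v; split; first by move=> x _; exact: derivable_cst.
have -> : 'D_v (cst c : V -> R) = cst 0 by apply/funext => x; exact: derive_cst.
exact: IH.
Qed.

Lemma Ck_onD k f g : @Ck_on R V R k setT f -> @Ck_on R V R k setT g ->
  @Ck_on R V R k setT (fun x => f x + g x).
Proof.
elim: k f g => [|k IH] f g [cf df] [cg dg].
  by split=> // x xT; exact: (continuousD (cf x xT) (cg x xT)).
split; first by move=> x xT; exact: (continuousD (cf x xT) (cg x xT)).
move=> v; have [df1 df2] := df v; have [dg1 dg2] := dg v; split.
  by move=> x xT; exact: (derivableD (df1 x xT) (dg1 x xT)).
have -> : 'D_v (fun x => f x + g x) = (fun x => 'D_v f x + 'D_v g x).
  by apply/funext => x; exact: (deriveD (df1 x (in_setT x)) (dg1 x (in_setT x))).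
exact: IH.
Qed.

Lemma Ck_onM k f g : @Ck_on R V R k setT f -> @Ck_on R V R k setT g ->
  @Ck_on R V R k setT (fun x => f x * g x).
Proof.
elim: k f g => [|k IH] f g hf hg.
  move: hf hg => [cf df] [cg dg].
  by split=> // x xT; exact: (continuousM (cf x xT) (cg x xT)).
have hf' := Ck_onS hf; have hg' := Ck_onS hg.
move: hf hg => [cf df] [cg dg].
split; first by move=> x xT; exact: (continuousM (cf x xT) (cg x xT)).
move=> v; have [df1 df2] := df v; have [dg1 dg2] := dg v; split.
  by move=> x xT; exact: (derivableM (df1 x xT) (dg1 x xT)).
have -> : 'D_v (fun x => f x * g x) =
    (fun x => f x * 'D_v g x + g x * 'D_v f x).
  by apply/funext => x; exact: (deriveM (df1 x (in_setT x)) (dg1 x (in_setT x))).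
by apply: Ck_onD; apply: IH.
Qed.

End Ck.

Section flat_plane.
Context {R : realType}.
Implicit Types (a b c : R) (v z : R * R).

Definition aff a b c z : R := a * z.1 + b * z.2 + c.

Lemma continuous_aff a b c : continuous (aff a b c : R^o * R^o -> R^o).
Proof.
move=> z; apply: cvgD; last exact: cvg_cst.
by apply: cvgD; apply: cvgMr; [exact: cvg_fst|exact: cvg_snd].
Qed.

(** Along the line through [z] with direction [v] the affine form is affine in
    the parameter, so the derivative of [f] in one variable suffices. *)
Lemma is_derive_comp_aff a b c (f : R -> R) (df : R) v z :
  is_derive (aff a b c z) (1 : R) f df ->
  is_derive (z : R^o * R^o) (v : R^o * R^o) (f \o aff a b c : R^o * R^o -> R^o)
    ((a * v.1 + b * v.2) * df).
Proof.
move=> dfz; set e := a * v.1 + b * v.2.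
have fd : differentiable f (aff a b c z).
  by apply/derivable1_diffP; case: dfz.
have De : 'D_e (f : R^o -> R^o) (aff a b c z) = e * df.
  rewrite deriveE//.
  have -> : e = e *: (1 : R^o) by rewrite /GRing.scale/= mulr1.
  rewrite linearZ/= -deriveE// derive_val.
  by rewrite /GRing.scale/= mulr1.
have H : is_derive (aff a b c z) e (f : R^o -> R^o) (e * df).
  by split => //; exact: diff_derivable.
have quot h : ((f \o aff a b c : R^o * R^o -> R^o) \o shift z) (h *: v) =
   (f \o shift (aff a b c z)) (h *: e).
  rewrite /= /aff /e /GRing.scale/=; congr f.
  by case: v z {dfz fd De H e} => v1 v2 [z1 z2]; cbn; ring.
case: H => H1 H2; split.
  by rewrite /derivable; under eq_fun do rewrite quot.
by rewrite /derive; under eq_fun do rewrite quot.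
Qed.

(** Induction on [k] for all [j] at once, because the derivative of [flat j]
    involves [flat j.+1] and [flat j.+2]. *)
Lemma Ck_on_flat k j a b c :
  @Ck_on R (R^o * R^o)%type R k setT (flat j \o aff a b c).
Proof.
elim: k j => [|k IH] j; split => //; try by move=> z _;
  apply: continuous_comp; [exact: continuous_aff|exact: continuous_flat].
move=> v; split.
  by move=> z _; have [] := is_derive_comp_aff v (is_derive_flat j (aff a b c z)).
have -> : 'D_v (flat j \o aff a b c : R^o * R^o -> R) =
   (fun z => cst (a * v.1 + b * v.2) z * ((flat j.+2 \o aff a b c) z +
     cst (- j%:R) z * (flat j.+1 \o aff a b c) z)).
  apply/funext => z.
  have [_ ->] := is_derive_comp_aff v (is_derive_flat j (aff a b c z)).
  by rewrite mulNr.
apply: Ck_onM; first exact: Ck_on_cst.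
by apply: Ck_onD => //; apply: Ck_onM => //; exact: Ck_on_cst.
Qed.

End flat_plane.

(** * Bump functions *)

Section bump.
Context {R : realType}.
Implicit Types (a b x : R) (m : nat).

(** The dilation by [m.+1] makes the bumps on a fixed interval converge to its
    indicator function. *)
Definition bump a b m x : R :=
  flat 0 (m.+1%:R * (x - a)) * flat 0 (m.+1%:R * (b - x)).

(** The power 2 appears because the derivative of [flat 0] is [flat 2]. *)
Definition dbump a b m x : R :=
  m.+1%:R * (flat 2 (m.+1%:R * (x - a)) * flat 0 (m.+1%:R * (b - x))
             - flat 0 (m.+1%:R * (x - a)) * flat 2 (m.+1%:R * (b - x))).

Lemma is_derive_bump a b m x : is_derive x (1 : R) (bump a b m) (dbump a b m x).
Proof.
set c : R := m.+1%:R.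
have d1 : is_derive x (1 : R) (fun x => c * (x - a)) c.
  have -> : (fun x => c * (x - a)) = c *: (id - cst a) by apply/funext.
  by apply: is_derive_eq; rewrite subr0 /GRing.scale/= mulr1.
have d2 : is_derive x (1 : R) (fun x => c * (b - x)) (- c).
  have -> : (fun x => c * (b - x)) = c *: (cst b - id) by apply/funext.
  by apply: is_derive_eq; rewrite sub0r /GRing.scale/= mulrN1.
have := is_deriveM (is_derive1_comp (is_derive_flat 0 _) d1)
                   (is_derive1_comp (is_derive_flat 0 _) d2).
rewrite /GRing.scale/= !mul0r !subr0 => H.
have -> : dbump a b m x = flat 0 (c * (x - a)) * (flat 2 (c * (b - x)) * - c) +
    flat 0 (c * (b - x)) * (flat 2 (c * (x - a)) * c).
  by rewrite /dbump -/c; ring.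
exact: H.
Qed.

Lemma bump_out a b m x : ~~ (a < x < b) -> bump a b m x = 0.
Proof.
rewrite negb_and -!leNgt /bump => /orP[xa|bx].
  by rewrite flat_le0 ?mul0r// pmulr_rle0// subr_le0.
by rewrite (flat_le0 _ (x := _ * (b - x))) ?mulr0// pmulr_rle0// subr_le0.
Qed.

Lemma dbump_out a b m x : ~~ (a < x < b) -> dbump a b m x = 0.
Proof.
rewrite negb_and -!leNgt /dbump => /orP[xa|bx].
  by rewrite !(flat_le0 _ (x := _ * (x - a))) ?mul0r ?subr0 ?mulr0// pmulr_rle0// subr_le0.
by rewrite !(flat_le0 _ (x := _ * (b - x))) ?mulr0 ?subr0 ?mulr0// pmulr_rle0// subr_le0.
Qed.

Lemma flat0_le1 x : flat 0 x <= 1.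
Proof.
rewrite /flat; case: ifPn => // x0.
by rewrite expr0 mul1r expR_le1 oppr_le0 invr_ge0 ltW.
Qed.

Lemma bump_ge0 a b m x : 0 <= bump a b m x.
Proof. by rewrite mulr_ge0 ?flat_ge0. Qed.

Lemma bump_le1 a b m x : bump a b m x <= 1.
Proof. by rewrite mulr_ile1 ?flat_ge0 ?flat0_le1. Qed.

Lemma bump_gt0 a b m x : a < x < b -> 0 < bump a b m x.
Proof.
move=> /andP[ax xb].
by rewrite mulr_gt0 // /flat ifT ?expr0 ?mul1r ?expR_gt0// mulr_gt0// subr_gt0.
Qed.

Lemma continuous_bump a b m : continuous (bump a b m).
Proof.
move=> x; apply: differentiable_continuous; apply/derivable1_diffP.
by have [] := is_derive_bump a b m x.
Qed.

Lemma continuous_dbump a b m : continuous (dbump a b m).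
Proof.
have c1 : continuous (fun x => m.+1%:R * (x - a)).
  by move=> x; apply: cvgMr; apply: cvgB => //; exact: cvg_cst.
have c2 : continuous (fun x => m.+1%:R * (b - x)).
  by move=> x; apply: cvgMr; apply: cvgB => //; exact: cvg_cst.
have cf k (g : R -> R) : continuous g -> continuous (fun x => flat k (g x)).
  by move=> cg x; apply: continuous_comp; [exact: cg|exact: continuous_flat].
move=> x; apply: cvgMr; apply: cvgB; apply: cvgM;
  by [exact: (cf _ _ c1)|exact: (cf _ _ c2)].
Qed.

Lemma dbump_bounded a b m : exists M, forall x, `|dbump a b m x| <= M.
Proof.
set c : R := m.+1%:R.
exists (c * (6 * (c * `|b - a|) + 6 * (c * `|b - a|))) => x.
have [/andP[ax xb]|xab] := boolP (a < x < b); last first.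
  by rewrite dbump_out// normr0 !(mulr_ge0,addr_ge0).
have F (u : R) : 0 <= u -> u <= `|b - a| -> `|flat 2 (c * u)| <= 6 * (c * `|b - a|).
  move=> u0 uM; rewrite ger0_norm ?flat_ge0//; apply: le_trans (flat_le _ _) _.
  rewrite ler_wpM2l//  ger0_norm ?mulr_ge0// ler_wpM2l//.
have le1 u : `|flat 0 u| <= 1 :> R by rewrite ger0_norm ?flat_ge0// flat0_le1.
have n0 : 0 <= 6 * (c * `|b - a|) by rewrite !mulr_ge0.
have ba : `|b - a| = b - a by rewrite ger0_norm// subr_ge0 (ltW (lt_trans ax xb)).
rewrite /dbump normrM (ger0_norm (ler0n _ _)) ler_wpM2l//.
apply: le_trans (ler_normB _ _) _; rewrite !normrM.
apply: lerD.
  rewrite -[leRHS]mulr1 ler_pM// F// ?subr_ge0 ?(ltW ax)// ba lerD2r ltW//.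
rewrite -[leRHS]mul1r ler_pM// F// ?subr_ge0 ?(ltW xb)// ba lerD2l lerN2 ltW//.
Qed.

Lemma bump_cvg a b x : a < x < b -> bump a b n x @[n --> \oo] --> (1 : R).
Proof.
move=> /andP[ax xb].
have F (u : R) : 0 < u -> flat 0 (n.+1%:R * u) @[n --> \oo] --> (1 : R).
  move=> u0.
  have -> : (fun n => flat 0 (n.+1%:R * u)) = (fun n => expR (- (n.+1%:R^-1 * u^-1))).
    apply/funext => n; rewrite /flat ifT ?mulr_gt0// expr0 mul1r invfM//.
  have lim0 : - (n.+1%:R^-1 * u^-1) @[n --> \oo] --> (0 : R).
    rewrite -(oppr0 R) -(mul0r u^-1); apply: cvgN; apply: cvgMl.
    exact: cvg_harmonic.
  have := cvg_comp (fun n : nat => - (n.+1%:R^-1 * u^-1)) expR lim0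
    (@continuous_expR R 0).
  by rewrite expR0.
rewrite -(mulr1 1); apply: cvgM; apply: F; by rewrite subr_gt0.
Qed.

End bump.

(** * Null coordinates and test functions *)

Section null_coordinates.
Context {R : realType}.
Implicit Types (a b c d : R) (m : nat) (z : R * R).

Definition to_null z : R * R := (z.1 + z.2, z.1 - z.2).
Definition of_null z : R * R := ((z.1 + z.2) / 2, (z.1 - z.2) / 2).

Lemma to_nullK : cancel to_null of_null.
Proof. by case=> t x; rewrite /to_null /of_null /=; congr (_, _); field. Qed.

Lemma of_nullK : cancel of_null to_null.
Proof. by case=> t x; rewrite /to_null /of_null /=; congr (_, _); field. Qed.

Definition box a b c d : set (R * R) := `[a, b] `*` `[c, d].

Definition diamond a b c d : set (R * R) := to_null @^-1` box a b c d.

Lemma diamondE a b c d : diamond a b c d = of_null @` box a b c d.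
Proof.
apply/seteqP; split => [z hz|_ [z hz <-]]; last by rewrite /diamond /preimage/= of_nullK.
by exists (to_null z) => //; rewrite to_nullK.
Qed.

Lemma continuous_of_null : continuous of_null.
Proof.
move=> z.
have h1 : (y.1 + y.2) / 2 @[y --> z] --> (z.1 + z.2) / 2.
  by apply: cvgMl; apply: cvgD; [exact: cvg_fst|exact: cvg_snd].
have h2 : (y.1 - y.2) / 2 @[y --> z] --> (z.1 - z.2) / 2.
  by apply: cvgMl; apply: cvgB; [exact: cvg_fst|exact: cvg_snd].
exact: (cvg_pair h1 h2).
Qed.

Lemma compact_diamond a b c d : compact (diamond a b c d).
Proof.
rewrite diamondE; apply: continuous_compact.
  by apply: continuous_subspaceT; exact: continuous_of_null.
exact: (compact_setX (@segment_compact R a b) (@segment_compact R c d)).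
Qed.

Definition tensor a b m c d m' z : R :=
  bump a b m (z.1 + z.2) * bump c d m' (z.1 - z.2).

Lemma tensorE a b m c d m' : tensor a b m c d m' = fun z =>
 (flat 0 \o aff m.+1%:R m.+1%:R (- (m.+1%:R * a))) z *
 (flat 0 \o aff (- m.+1%:R) (- m.+1%:R) (m.+1%:R * b)) z *
 ((flat 0 \o aff m'.+1%:R (- m'.+1%:R) (- (m'.+1%:R * c))) z *
 (flat 0 \o aff (- m'.+1%:R) m'.+1%:R (m'.+1%:R * d)) z).
Proof.
apply/funext => z; rewrite /tensor /bump /aff /=; do ![congr (_ * _)|congr (flat 0)]; ring.
Qed.

Lemma smooth_tensor a b m c d m' :
  smooth_on (V := (R^o * R^o)%type) (W := R^o) setT (tensor a b m c d m').
Proof.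
move=> k; rewrite tensorE.
by apply: (Ck_onM (V := (R^o * R^o)%type)); apply: Ck_onM; exact: Ck_on_flat.
Qed.

Lemma derive_tensor a b m c d m' (v z : R * R) :
  'D_(v : R^o * R^o) (tensor a b m c d m' : R^o * R^o -> R^o) z =
  (v.1 + v.2) * (dbump a b m (z.1 + z.2) * bump c d m' (z.1 - z.2)) +
  (v.1 - v.2) * (bump a b m (z.1 + z.2) * dbump c d m' (z.1 - z.2)).
Proof.
have E1 : bump a b m \o aff 1 1 0 = fun z => bump a b m (z.1 + z.2).
  by apply/funext => y; rewrite /aff/= !mul1r addr0.
have E2 : bump c d m' \o aff 1 (-1) 0 = fun z => bump c d m' (z.1 - z.2).
  by apply/funext => y; rewrite /aff/= mul1r mulN1r addr0.
have [d1 e1] := is_derive_comp_aff v (is_derive_bump a b m (aff 1 1 0 z)).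
have [d2 e2] := is_derive_comp_aff v (is_derive_bump c d m' (aff 1 (-1) 0 z)).
have := deriveM d1 d2; rewrite e1 e2 => H.
have -> : tensor a b m c d m' =
  fun z => (bump a b m \o aff 1 1 0) z * (bump c d m' \o aff 1 (-1) 0) z.
  by rewrite E1 E2.
rewrite [LHS]H /GRing.scale/= /aff !mul1r !mulN1r !addr0; ring.
Qed.

Lemma tensor_out a b m c d m' z : ~ diamond a b c d z -> tensor a b m c d m' z = 0.
Proof.
rewrite /diamond /box /to_null/= !in_itv/= => h; rewrite /tensor.
have [h1|h1] := boolP (a < z.1 + z.2 < b); last by rewrite bump_out// mul0r.
have [h2|h2] := boolP (c < z.1 - z.2 < d); last by rewrite (bump_out _ h2)// mulr0.
exfalso; apply: h.
by move: h1 h2 => /andP[/ltW-> /ltW->] /andP[/ltW-> /ltW->].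
Qed.

(** These are the only test functions used below: in null coordinates their two
    variables separate. *)
Lemma test_function_tensor a b m c d m' (O : set (R * R)) :
  diamond a b c d `<=` O -> test_function O (tensor a b m c d m').
Proof.
move=> dO; split; first exact: smooth_tensor.
have cl : closure [set z | tensor a b m c d m' z != 0] `<=` diamond a b c d.
  have clD : closed (diamond a b c d).
    apply: compact_closed; first exact: (@norm_hausdorff R (R^o * R^o)%type).
    exact: compact_diamond.
  rewrite [X in _ `<=` X](closure_id _).1//; apply: closure_subset => z /=.
  by apply: contra_neqP => /tensor_out ->.
split; last exact: subset_trans dO.
by apply: subclosed_compact (@compact_diamond a b c d) cl; exact: closed_closure.
Qed.

End null_coordinates.

(** * Integrable functions with vanishing integrals *)

Section vanishing_integrals.
Local Open Scope ereal_scope.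

(** Dynkin's argument: the sets over whose preimage [f] has integral 0 form a
    Dynkin system, and [G] is a pi-system generating all measurable sets. *)
Lemma integral_preimage_eq0 d d' (T : measurableType d) (S : measurableType d')
    (R : realType) (mu : {measure set T -> \bar R}) (h : T -> S) (G : set (set S))
    (f : T -> \bar R) :
  measurable_fun setT h -> @measurable _ S = <<s G >> -> setI_closed G ->
  mu.-integrable setT f -> \int[mu]_x f x = 0 ->
  (forall E, G E -> \int[mu]_(x in h @^-1` E) f x = 0) ->
  forall E, measurable E -> \int[mu]_(x in h @^-1` E) f x = 0.
Proof.
move=> mh SG GI fi fT fG E; rewrite SG.
have mhE A : measurable A -> measurable (h @^-1` A).
  by move=> mA; rewrite -[X in measurable X]setTI; exact: mh.
have intS A : measurable A -> mu.-integrable A f.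
  by move=> mA; exact: integrableS fi.
move: E; apply: (dynkin_induction (G := G)
  (P := fun E => \int[mu]_(x in h @^-1` E) f x = 0)) => //.
- move=> A mA A0; rewrite preimage_setC.
  move: fT; rewrite -(setUv (h @^-1` A)) integral_setU//.
  + by rewrite A0 add0e.
  + exact: mhE.
  + by apply: measurableC; exact: mhE.
  + by rewrite setUv; exact: measurable_int fi.
  + by apply/disj_setPS; rewrite setICr.
- move=> F mF tF F0; rewrite preimage_bigcup integral_bigcup//.
  + by rewrite eseries0// => n _ _; exact: F0.
  + apply/trivIsetP => i j _ _ ij; rewrite -preimage_setI.
    by move/trivIsetP: tF => /(_ i j I I ij) ->; rewrite preimage_set0.
  + by move=> k; exact: mhE.
  + by apply: intS; apply: bigcup_measurable => k _; exact: mhE.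
Qed.

(** Rays generate the Borel sets of the line, so [integral_preimage_eq0] extends
    the hypotheses to rectangles, one side at a time, and then to all sets. The
    rays do not exhaust the line, whence the separate hypotheses with [setT]. *)
Lemma integral_rays_eq0 (R : realType) (f : R * R -> \bar R) :
  (leb2 R).-integrable setT f -> \int[leb2 R]_z f z = 0 ->
  (forall x, \int[leb2 R]_(z in `]x, +oo[ `*` setT) f z = 0) ->
  (forall y, \int[leb2 R]_(z in setT `*` `]y, +oo[) f z = 0) ->
  (forall x y, \int[leb2 R]_(z in `]x, +oo[ `*` `]y, +oo[) f z = 0) ->
  ae_eq (leb2 R) setT f (cst 0).
Proof.
move=> fi f0 fx fy fxy.
pose G := @RGenOInfty.G R.
have mG : @measurable _ (measurableTypeR R) = <<s G >>.
  exact: RGenOInfty.measurableE.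
have GI : setI_closed G.
  move=> _ _ [x ->] [y ->]; exists (Num.max x y).
  by apply/seteqP; split => z /=; rewrite !in_itv/= !andbT gt_max => /andP.
have rI (A : set (R * R)) : measurable A -> (leb2 R).-integrable setT (f \_ A).
  by move=> mA; apply: (proj1 (@integrable_mkcond _ _ R (leb2 R) A f mA)); exact: integrableS fi.
have mray y : measurable (`]y, +oo[%classic : set R) by [].
have E1 : forall A, measurable A -> \int[leb2 R]_(z in A `*` setT) f z = 0.
  move=> A mA.
  have -> : A `*` setT = (@fst R R) @^-1` A by apply/seteqP; split => z //= [].
  apply: (@integral_preimage_eq0 _ _ (measurableTypeR R * measurableTypeR R)%type
    (measurableTypeR R) R (leb2 R) (@fst R R) G) => //.
  by move=> _ [x ->]; rewrite -(fx x); congr (integral _ _ _);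
    apply/seteqP; split => z //= [].
have E2 y : forall A, measurable A -> \int[leb2 R]_(z in A `*` `]y, +oo[) f z = 0.
  move=> A mA.
  have m1 : measurable (setT `*` `]y, +oo[%classic : set (R * R)) by exact: measurableX.
  have -> : A `*` `]y, +oo[ = (@fst R R) @^-1` A `&` (setT `*` `]y, +oo[).
    by apply/seteqP; split => z /=; tauto.
  rewrite integral_mkcondr.
  apply: (@integral_preimage_eq0 _ _ (measurableTypeR R * measurableTypeR R)%type
    (measurableTypeR R) R (leb2 R) (@fst R R) G) => //; first exact: rI.
    by rewrite -integral_mkcond.
  move=> _ [x ->]; rewrite -integral_mkcondr -(fxy x y); congr (integral _ _ _).
  by apply/seteqP; split => z /=; tauto.
have E3 B : measurable B -> forall A, measurable A -> \int[leb2 R]_(z in B `*` A) f z = 0.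
  move=> mB A mA.
  have m1 : measurable (B `*` setT : set (R * R)) by exact: measurableX.
  have -> : B `*` A = (@snd R R) @^-1` A `&` (B `*` setT).
    by apply/seteqP; split => z /=; tauto.
  rewrite integral_mkcondr.
  apply: (@integral_preimage_eq0 _ _ (measurableTypeR R * measurableTypeR R)%type
    (measurableTypeR R) R (leb2 R) (@snd R R) G) => //; first exact: rI.
    by rewrite -integral_mkcond; exact: E1.
  move=> _ [x ->]; rewrite -integral_mkcondr -(E2 x _ mB); congr (integral _ _ _).
  by apply/seteqP; split => z /=; tauto.
apply: integral_ae_eq => // E _ mE; rewrite integral0.
apply: (@integral_preimage_eq0 _ _ (measurableTypeR R * measurableTypeR R)%type
  (measurableTypeR R * measurableTypeR R)%type R (leb2 R) id
  [set A `*` B | A in measurable & B in measurable]) => //.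
- exact: measurable_prod_measurableType.
- move=> _ _ [A mA [B mB <-]] [C mC [D mD <-]].
  exists (A `&` C); first exact: measurableI.
  exists (B `&` D); first exact: measurableI.
  by rewrite setXI.
- by move=> _ [A mA [B mB <-]]; exact: E3.
Qed.

End vanishing_integrals.

(** * Lebesgue measure in null coordinates *)

Section lebesgue_measure_affine.
Local Open Scope ereal_scope.
Context {R : realType}.
Variables (a b : R).
Hypothesis a0 : (0 < a)%R.

Let h : R -> measurableTypeR R := (fun x => a * x + b)%R.

Let mh : measurable_fun setT h.
Proof. by apply: measurable_funD => //; exact: measurable_funM. Qed.

Let image_measure := pushforward (leb1 R) h.

Let image0 : image_measure set0 = 0. Proof. exact: measure0. Qed.

Let image_ge0 A : 0 <= image_measure A. Proof. exact: measure_ge0. Qed.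

Let image_sigma_additive : semi_sigma_additive image_measure.
Proof. exact: measure_semi_sigma_additive. Qed.

HB.instance Definition _ := isMeasure.Build _ _ _ image_measure
  image0 image_ge0 image_sigma_additive.

(** Rescaled, the image measure has the right values on half-open intervals, and
    these determine Lebesgue measure. *)
Lemma lebesgue_measure_affine (A : set R) : measurable A ->
  leb1 R ((fun x => a * x + b)%R @^-1` A) = (a^-1)%:E * leb1 R A.
Proof.
move=> mA; have an0 := lt0r_neq0 a0.
suff -> : leb1 R A = mscale (NngNum (ltW a0)) image_measure A.
  by rewrite /mscale/= /image_measure /pushforward muleA -EFinM mulVf// mul1e.
apply: lebesgue_measure_unique => //= _ [[x y] _ <-].
rewrite /mscale/= /image_measure /pushforward.
have -> : h @^-1` `]x, y]%classic = [set` `](x - b) / a, (y - b) / a]%R].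
  apply/seteqP; split => z /=; rewrite /h !in_itv/= ltr_pdivrMr// ler_pdivlMr//
    [(z * a)%R]mulrC ltrBlDr lerBrDr; exact.
rewrite !lebesgue_measure_itv/= !lte_fin ltr_pM2r ?invr_gt0// ltrD2r.
case: ifPn => _; last by rewrite mule0.
by rewrite -!EFinD -EFinM; congr EFin; field.
Qed.

End lebesgue_measure_affine.

Section change_of_variables.
Local Open Scope ereal_scope.
Context {R : realType}.

Let measurable_sum : measurable_fun setT (fun z : R * R => z.1 + z.2)%R.
Proof. exact: (measurable_funD (@measurable_fst _ _ R R) (@measurable_snd _ _ R R)). Qed.

Let measurable_difference : measurable_fun setT (fun z : R * R => z.1 - z.2)%R.
Proof. exact: (measurable_funB (@measurable_fst _ _ R R) (@measurable_snd _ _ R R)). Qed.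

Lemma measurable_of_null : measurable_fun setT (@of_null R).
Proof.
apply/measurable_fun_pairP; split.
  exact: (measurable_funM measurable_sum (measurable_cst _)).
exact: (measurable_funM measurable_difference (measurable_cst _)).
Qed.

Lemma measurable_to_null : measurable_fun setT (@to_null R).
Proof.
apply/measurable_fun_pairP; split; first exact: measurable_sum.
exact: measurable_difference.
Qed.

(** The change of coordinates is the composition of two maps that each transform
    one variable affinely, the other one being a parameter; each is dealt with
    on sections. *)
Lemma lebesgue_of_null (E : set (R * R)) : measurable E ->
  leb2 R (@of_null R @^-1` E) = 2%:E * leb2 R E.
Proof.
move=> mE.
pose S (w : R * R) := (w.2, w.1 - w.2)%R.
have mS : measurable_fun setT S.
  apply/measurable_fun_pairP; split; first exact: measurable_snd.
  exact: measurable_difference.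
have mSE : measurable (S @^-1` E) by rewrite -[X in measurable X]setTI; exact: mS.
have sec x : leb1 R (xsection (@of_null R @^-1` E) x) =
    2%:E * leb1 R (xsection (S @^-1` E) x).
  have -> : xsection (@of_null R @^-1` E) x =
      (fun y => 2^-1 * y + x / 2)%R @^-1` (xsection (S @^-1` E) x).
    apply/seteqP; split => y; rewrite /xsection/= !inE /of_null /S/=.
      by congr (E (_, _)); field.
    by congr (E (_, _)); field.
  rewrite lebesgue_measure_affine ?invrK//.
  exact: measurable_xsection.
rewrite {1}/product_measure1.
under eq_integral do rewrite /= sec.
rewrite ge0_integralZl//; last first.
  exact: measurable_fun_xsection.
congr (_ * _).
have := indic_fubini_tonelli (leb1 R) (leb1 R) mSE.
rewrite indic_fubini_tonelli_FE// indic_fubini_tonelli_GE// => ->.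
rewrite /product_measure1; apply: eq_integral => t _ /=.
have -> : ysection (S @^-1` E) t = (fun y => 1 * y + - t)%R @^-1` xsection E t.
  by apply/seteqP; split => y; rewrite /xsection /ysection/= !inE /S/= mul1r.
rewrite lebesgue_measure_affine//; last exact: measurable_xsection.
by rewrite invr1 mul1e.
Qed.

Lemma leb2_swap (E : set (R * R)) : measurable E ->
  leb2 R ((fun z => (z.2, z.1)) @^-1` E) = leb2 R E.
Proof.
move=> mE; have := indic_fubini_tonelli (leb1 R) (leb1 R) mE.
by rewrite indic_fubini_tonelli_FE// indic_fubini_tonelli_GE//.
Qed.

End change_of_variables.

(** * Changes of variables in integrals *)

(** The scaling constant is 2 for the null coordinates and 1 for the exchange of
    the coordinates. *)
Section scaled_image.
Local Open Scope ereal_scope.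
Context d d' (T : measurableType d) (S : measurableType d') (R : realType).
Variables (mu : {measure set T -> \bar R}) (nu : {measure set S -> \bar R}).
Variables (phi : T -> S) (mphi : measurable_fun setT phi) (c : {nonneg R}).
Hypothesis muphi : forall E, measurable E -> mu (phi @^-1` E) = c%:num%:E * nu E.

Lemma ge0_integral_scaled_image (f : S -> \bar R) : measurable_fun setT f ->
  (forall x, 0 <= f x) -> \int[mu]_x f (phi x) = c%:num%:E * \int[nu]_y f y.
Proof.
move=> mf f0; rewrite -ge0_integral_mscale//.
have := @ge0_integral_pushforward _ _ _ _ _ phi mphi mu setT f measurableT mf.
rewrite preimage_setT => <-; last by move=> y _; exact: f0.
apply: eq_measure_integral => A mA _; exact: muphi.
Qed.

Lemma integrable_scaled_image (f : S -> \bar R) : nu.-integrable setT f ->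
  mu.-integrable setT (f \o phi).
Proof.
move=> /integrableP[mf fi]; apply/integrableP; split.
  exact: measurableT_comp mf mphi.
have := @ge0_integral_scaled_image (abse \o f); rewrite /= => ->//.
  by rewrite lte_mul_pinfty// lee_fin.
exact: measurableT_comp.
Qed.

Lemma integral_scaled_image (f : S -> \bar R) : nu.-integrable setT f ->
  \int[mu]_x f (phi x) = c%:num%:E * \int[nu]_y f y.
Proof.
move=> fi; have mf := measurable_int _ fi.
have Ep := ge0_integral_scaled_image (measurable_funepos mf) (funepos_ge0 f).
have En := ge0_integral_scaled_image (measurable_funeneg mf) (funeneg_ge0 f).
transitivity (\int[mu]_x f^\+ (phi x) - \int[mu]_x f^\- (phi x)).
  by rewrite integralE; congr (_ - _); apply: eq_integral => x _; rewrite ?(funepos_comp f phi) ?(funeneg_comp f phi).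
rewrite Ep En -muleBr//; first by rewrite [in RHS]integralE.
exact: integrable_add_def.
Qed.

End scaled_image.

Lemma integrable_EFin_restrict d (T : measurableType d) (R : realType)
    (mu : {measure set T -> \bar R}) (D : set T) (f : T -> R) : measurable D ->
  mu.-integrable D (EFin \o f) <-> mu.-integrable setT (EFin \o (f \_ D)).
Proof. by move=> mD; rewrite -restrict_EFin; exact: integrable_mkcond. Qed.

Section null_coordinate_integrals.
Context {R : realType}.
Implicit Types (D : set (measurableTypeR R * measurableTypeR R)) (f : R * R -> R).

Lemma restrict_comp D f : (f \_ D) \o @of_null R = (f \o @of_null R) \_ (@of_null R @^-1` D).
Proof. by apply/funext => z; rewrite /patch/=; congr (if _ then _ else _); apply/idP/idP; rewrite !inE. Qed.

Lemma measurable_of_null_preimage D : measurable D -> measurable (@of_null R @^-1` D).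
Proof. by move=> mD; rewrite -[X in measurable X]setTI; exact: measurable_of_null. Qed.

Lemma integrable_of_null D f : measurable D ->
  (leb2 R).-integrable D (EFin \o f) ->
  (leb2 R).-integrable (@of_null R @^-1` D) (EFin \o (f \o @of_null R)).
Proof.
move=> mD fi0; have fi := proj1 (integrable_EFin_restrict _ _ mD) fi0.
apply/integrable_EFin_restrict; first exact: measurable_of_null_preimage.
rewrite -restrict_comp.
exact: (@integrable_scaled_image _ _ _ _ R (leb2 R) (leb2 R) _ measurable_of_null 2%:nng
  lebesgue_of_null _ fi).
Qed.

Lemma Rintegral_of_null D f : measurable D ->
  (leb2 R).-integrable D (EFin \o f) ->
  \int[leb2 R]_(z in D) f z =
  2^-1 * \int[leb2 R]_(z in @of_null R @^-1` D) f (of_null z).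
Proof.
move=> mD fi0; have fi := proj1 (integrable_EFin_restrict _ _ mD) fi0.
rewrite Rintegral_mkcond [in RHS]Rintegral_mkcond.
have E := @integral_scaled_image _ _ _ _ R (leb2 R) (leb2 R) _ measurable_of_null 2%:nng
  lebesgue_of_null _ fi.
rewrite -[X in _ = _ * Rintegral _ _ X]restrict_comp /Rintegral/= E fineM//.
  by rewrite mulrA mulVf// mul1r.
exact: integrable_fin_num.
Qed.

End null_coordinate_integrals.

(** * Fubini's theorem and products of bumps *)

Section real_fubini.
Context d1 d2 (T1 : measurableType d1) (T2 : measurableType d2) (R : realType).
Variables (m1 : {sigma_finite_measure set T1 -> \bar R})
  (m2 : {sigma_finite_measure set T2 -> \bar R}).
Implicit Types (f : T1 * T2 -> R).

(** Where the extended integral of a section is infinite the real one is 0, so the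
    latter is dominated by the former everywhere. *)
Lemma integrable_Rfubini1 f : (m1 \x m2)%E.-integrable setT (EFin \o f) ->
  m1.-integrable setT (EFin \o (fun x => \int[m2]_y f (x, y))).
Proof.
move=> fi; have Fi := integrable_fubini_F fi.
apply: (le_integrable _ _ _ Fi) => //.
  apply/measurable_EFinP; apply: measurableT_comp => //.
  exact: measurable_fubini_F fi.
move=> x _; rewrite /Rintegral /fubini_F /=.
by case: (integral _ _ _) => //= *; rewrite ?normr0 ?lexx ?leey.
Qed.

Lemma integrable_Rfubini2 f : (m1 \x m2)%E.-integrable setT (EFin \o f) ->
  m2.-integrable setT (EFin \o (fun y => \int[m1]_x f (x, y))).
Proof.
move=> fi; have mf := measurable_int _ fi.
have mn : measurable_fun setT (fun y => \int[m1]_x `|(f (x, y))%:E|)%E.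
  apply: (measurable_fun_fubini_tonelli_G (fun z => `|(f z)%:E|%E)) => //.
  exact: measurableT_comp.
apply: (@le_integrable _ _ _ _ _ _ _ (fun y => \int[m1]_x `|(f (x, y))%:E|)%E) => //.
- apply/measurable_EFinP; apply: measurableT_comp => //.
  exact: measurable_fubini_G fi.
- move=> y _; rewrite [leRHS]gee0_abs; last exact: integral_ge0.
  apply: (@le_trans _ _ `|\int[m1]_x (f (x, y))%:E|%E).
    by rewrite /= /Rintegral; case: (integral _ _ _) => //= *; rewrite ?normr0 ?lexx ?leey.
  by apply: le_abse_integral => //; apply: measurableT_comp mf _.
- apply/integrableP; split=> //; move/(integrable21ltyP _ _ mf): fi.
  by under [in X in _ -> X]eq_integral do rewrite gee0_abs ?integral_ge0//.
Qed.

Lemma Rfubini1 f : (m1 \x m2)%E.-integrable setT (EFin \o f) ->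
  \int[(m1 \x m2)%E]_z f z = \int[m1]_x \int[m2]_y f (x, y).
Proof.
move=> fi; rewrite {1}/Rintegral -integral12_prod_meas1//; congr fine.
apply: ae_eq_integral => //; first exact: (measurable_fubini_F fi).
  exact: measurable_int (integrable_Rfubini1 fi).
have := ae_integrable1 fi; apply: filterS => x fx _.
by rewrite /fubini_F /Rintegral fineK//; exact: integrable_fin_num.
Qed.

Lemma Rfubini2 f : (m1 \x m2)%E.-integrable setT (EFin \o f) ->
  \int[(m1 \x m2)%E]_z f z = \int[m2]_y \int[m1]_x f (x, y).
Proof.
move=> fi; rewrite {1}/Rintegral -integral21_prod_meas1//; congr fine.
apply: ae_eq_integral => //; first exact: (measurable_fubini_G fi).
  exact: measurable_int (integrable_Rfubini2 fi).
have := ae_integrable2 fi; apply: filterS => x fx _.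
by rewrite /fubini_G /Rintegral fineK//; exact: integrable_fin_num.
Qed.

Lemma integrable_tensor (f : T1 -> R) (g : T2 -> R) :
  m1.-integrable setT (EFin \o f) -> m2.-integrable setT (EFin \o g) ->
  (m1 \x m2)%E.-integrable setT (EFin \o (fun z => f z.1 * g z.2)).
Proof.
move=> fi gi.
have mf : measurable_fun setT f by apply/measurable_EFinP; exact: measurable_int fi.
have mg : measurable_fun setT g by apply/measurable_EFinP; exact: measurable_int gi.
apply/integrable12ltyP.
  apply/measurable_EFinP; apply: measurable_funM.
    exact: measurableT_comp mf measurable_fst.
  exact: measurableT_comp mg measurable_snd.
have [_ fi'] := integrableP _ _ _ fi; have [_ gi'] := integrableP _ _ _ gi.
have E x : (\int[m2]_y `|(EFin \o (fun z : T1 * T2 => f z.1 * g z.2)%R) (x, y)| =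
    `|(f x)%:E| * \int[m2]_y `|(g y)%:E|)%E.
  rewrite -ge0_integralZl//; last first.
    by apply: measurableT_comp => //; exact/measurable_EFinP.
  by apply: eq_integral => y _; rewrite /= normrM.
under eq_integral do rewrite E.
rewrite ge0_integralZr//; last 2 first.
- by apply: measurableT_comp => //; exact/measurable_EFinP.
- exact: integral_ge0.
rewrite -ge0_fin_numE ?mule_ge0//; try exact: integral_ge0.
by rewrite fin_numM// ge0_fin_numE//; exact: integral_ge0.
Qed.

End real_fubini.

Section bumps_determine.
Context {R : realType}.
Local Notation mR := (measurableTypeR R).
Variables (a0 b0 c0 d0 : R) (h : R * R -> R).
Let Q : set (mR * mR) := `]a0, b0[ `*` `]c0, d0[.
Hypothesis hi : (leb2 R).-integrable Q (EFin \o h).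
Hypothesis h0 : forall a b c d n, a0 <= a -> b <= b0 -> c0 <= c -> d <= d0 ->
  \int[leb2 R]_(z in Q) (h z * (bump a b n z.1 * bump c d n z.2)) = 0.

Let mQ : measurable Q. Proof. exact: measurableX. Qed.

Let mh : measurable_fun Q h.
Proof. by apply/measurable_EFinP; exact: measurable_int hi. Qed.

Let measurable_bump a b n : measurable_fun setT (bump a b n : mR -> mR).
Proof. by apply: continuous_measurable_fun; exact: continuous_bump. Qed.

Let indic_itv0 a c : a0 <= a -> c0 <= c ->
  (\int[leb2 R]_(z in Q) (h z * (\1_(`]a, b0[) z.1 * \1_(`]c, d0[) z.2))%:E = 0)%E.
Proof.
move=> aa cc.
have mb n : measurable_fun Q (fun z : mR * mR => h z * (bump a b0 n z.1 * bump c d0 n z.2)).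
  apply: measurable_funM => //; apply: measurable_funTS; apply: measurable_funM.
    exact: measurableT_comp (measurable_bump _ _ _) measurable_fst.
  exact: measurableT_comp (measurable_bump _ _ _) measurable_snd.
have mi : measurable_fun Q (fun z : mR * mR => h z * (\1_(`]a, b0[) z.1 * \1_(`]c, d0[) z.2)).
  apply: measurable_funM => //; apply: measurable_funTS; apply: measurable_funM.
    by apply: (measurableT_comp (measurable_indic _) measurable_fst).
  by apply: (measurableT_comp (measurable_indic _) measurable_snd).
have bump_lim p q x : bump p q n x @[n --> \oo] --> (\1_(`]p, q[) x : R).
  rewrite indicE; have [xab|xab] := boolP (x \in _).
    by apply: bump_cvg; move: xab; rewrite inE/= in_itv.
  apply: cvg_near_cst; apply: nearW => n; apply: bump_out.
  by move: xab; rewrite notin_setE/= in_itv/= => /negP.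
have lim : {ae leb2 R, forall z, Q z ->
    (h z * (bump a b0 n z.1 * bump c d0 n z.2))%:E @[n --> \oo] -->
    (h z * (\1_(`]a, b0[) z.1 * \1_(`]c, d0[) z.2))%:E}.
  apply: aeW => z _; apply/fine_cvgP; split; first exact: nearW.
  by apply: cvgMr; apply: cvgM; exact: bump_lim.
have bnd n z : (`|(h z * (bump a b0 n z.1 * bump c d0 n z.2))%:E| <= `|h z|%:E)%E.
  have b1 : bump a b0 n z.1 * bump c d0 n z.2 <= 1.
    by rewrite mulr_ile1 ?bump_ge0 ?bump_le1.
  have b2 : 0 <= bump a b0 n z.1 * bump c d0 n z.2 by rewrite mulr_ge0 ?bump_ge0.
  by rewrite lee_fin normrM [X in _ * X <= _]ger0_norm// ler_piMr.
have dom : {ae leb2 R, forall z n, Q z ->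
    (`|(h z * (bump a b0 n z.1 * bump c d0 n z.2))%:E| <= `|h z|%:E)%E}.
  by apply: aeW => w k _; exact: bnd.
have [_ _] := dominated_convergence mQ (fun n => proj2 (measurable_EFinP _ _) (mb n))
  (proj2 (measurable_EFinP _ _) mi) lim (integrable_norm hi) dom.
rewrite (_ : [sequence _]_n = cst 0%E); last first.
  apply/funext => n /=; rewrite -[LHS]fineK.
    by congr EFin; exact: h0.
  apply: integrable_fin_num => //.
  apply: (le_integrable mQ _ _ (integrable_norm hi)); first exact/measurable_EFinP.
  by move=> z Qz; apply: (le_trans (bnd n z)); rewrite /= lee_fin normr_id.
by move/cvg_unique => /(_ _ _ (cvg_cst _)) <-.
Qed.

(** By dominated convergence the bumps become indicators of open rectangles, that
    is, of intersections of rays with [Q]. *)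
Lemma bumps_eq0 : {ae leb2 R, forall z, Q z -> h z = 0}.
Proof.
have hQ : (leb2 R).-integrable setT (EFin \o (h \_ Q)).
  exact/(integrable_EFin_restrict _ _ mQ).1.
have key a c A B : a0 <= a -> c0 <= c ->
  (forall x, x \in `]a0, b0[ -> (A x <-> x \in `]a, b0[)) ->
  (forall y, y \in `]c0, d0[ -> (B y <-> y \in `]c, d0[)) ->
  (\int[leb2 R]_(z in A `*` B) (h \_ Q z)%:E = 0)%E.
  move=> aa cc Aa Bc; rewrite -(indic_itv0 aa cc).
  rewrite integral_mkcond [in RHS]integral_mkcond; apply: eq_integral => z _.
  rewrite !patchE; have [zQ|] := boolP (z \in Q); last by case: ifPn.
  move: (zQ); rewrite inE => -[/= z1 z2].
  rewrite !indicE; have [zAB|zAB] := boolP (z \in A `*` B).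
    move: zAB; rewrite inE => -[/(Aa _ z1) k1 /(Bc _ z2) k2].
    by rewrite !mem_set//= !mulr1.
  have [k1|k1] := boolP (z.1 \in `]a, b0[%classic); last by rewrite mul0r mulr0.
  have [k2|k2] := boolP (z.2 \in `]c, d0[%classic); last by rewrite !mulr0.
  move: zAB k1 k2; rewrite notin_setE !inE/= => h1 k1 k2; exfalso; apply: h1.
  by split; [exact/(Aa _ z1)|exact/(Bc _ z2)].
have ray (p q x r : R) : x \in `]p, q[ -> (`]r, +oo[%classic x <-> x \in `](Num.max p r), q[).
  rewrite in_itv/= => /andP[px xq].
  have -> : (x \in `](Num.max p r), q[) = (r < x).
    by rewrite in_itv/= gt_max px xq andbT.
  by rewrite /= in_itv/= andbT.
have all (p q x : R) : x \in `]p, q[ -> ([set: R] x <-> x \in `]p, q[) by [].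
have := @integral_rays_eq0 R (EFin \o (h \_ Q)) hQ.
have maxl (p q : R) : p <= Num.max p q by rewrite le_max lexx.
have E0 : (\int[leb2 R]_z (h \_ Q z)%:E = 0)%E.
  by rewrite -setXTT; apply: (key a0 c0) => //; exact: all.
move=> /(_ E0) [].
- by move=> x; apply: (key (Num.max a0 x) c0) => // y yp; exact: ray.
- by move=> y; apply: (key a0 (Num.max c0 y)) => // x yp; exact: ray.
- by move=> x y; apply: (key (Num.max a0 x) (Num.max c0 y)) => // u up; exact: ray.
move=> N [mN N0 sN]; exists N; split => //; apply: subset_trans sN.
apply: subsetC => z /= /(_ I) + Qz; rewrite patchE mem_set//.
by move=> -[].
Qed.

End bumps_determine.

(** * Integration against bumps *)

Lemma measurable_set_le d (T : measurableType d) (R : realType) (f g : T -> R) :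
  measurable_fun setT f -> measurable_fun setT g ->
  measurable [set x | f x <= g x].
Proof.
move=> mf mg; have := measurable_fun_ler mf mg.
move=> /(_ measurableT [set true] I); rewrite setTI.
by congr measurable; apply/seteqP; split => x /=; case: (f x <= g x).
Qed.

Lemma integrable_mul_bounded d (T : measurableType d) (R : realType)
    (mu : {measure set T -> \bar R}) (D : set T) (f h : T -> R) (M : R) :
  measurable D -> measurable_fun D h -> (forall x, D x -> `|h x| <= M) ->
  mu.-integrable D (EFin \o f) -> mu.-integrable D (EFin \o (fun x => h x * f x)).
Proof.
move=> mD mh hM fi.
apply: (le_integrable mD _ _ (integrableZl mD M fi)).
  apply/measurable_EFinP/measurable_funM => //.
  by apply/measurable_EFinP; exact: measurable_int fi.
move=> x Dx; rewrite lee_fin !normrM ler_wpM2r//.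
by apply: le_trans (hM x Dx) _; exact: ler_norm.
Qed.

Section one_dimensional.
Context {R : realType}.
Local Notation mR := (measurableTypeR R).
Implicit Types (a b x y : R) (g : R -> R).

Lemma measurable_bump a b n : measurable_fun setT (bump a b n : mR -> mR).
Proof. by apply: continuous_measurable_fun; exact: continuous_bump. Qed.

Lemma measurable_dbump a b n : measurable_fun setT (dbump a b n : mR -> mR).
Proof. by apply: continuous_measurable_fun; exact: continuous_dbump. Qed.

Lemma integral_dbump_ray a b n y :
  \int[leb1 R]_(x in `[y, +oo[) dbump a b n x = - bump a b n y.
Proof.
pose c := Num.max b y + 1.
have yc : y < c by rewrite ltr_pwDr// le_max lexx orbT.
have bc : b <= c by rewrite ler_wpDr// le_max lexx.
have -> : \int[leb1 R]_(x in `[y, +oo[) dbump a b n x =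
    \int[leb1 R]_(x in `[y, c]) dbump a b n x.
  rewrite Rintegral_mkcond [in RHS]Rintegral_mkcond; congr Rintegral.
  apply/funext => x; rewrite !patchE !mem_setE !in_itv/= andbT.
  case: (leP y x) => //= yx; case: (leP x c) => //= cx.
  by rewrite dbump_out// negb_and -!leNgt (ltW (le_lt_trans bc cx)) orbT.
rewrite /Rintegral (@continuous_FTC2 R _ (bump a b n) _ _ yc).
- by rewrite -EFinB/= [X in X - _]bump_out ?sub0r// negb_and -!leNgt bc orbT.
- by apply: continuous_subspaceT; exact: continuous_dbump.
- split.
  + by move=> x _; have [] := is_derive_bump a b n x.
  + by apply: cvg_at_right_filter; exact: continuous_bump.
  + by apply: cvg_at_left_filter; exact: continuous_bump.
- by move=> x _; rewrite derive1E; have [] := is_derive_bump a b n x.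
Qed.

Lemma integrable_bounded_itv (f : R -> R) a b M : measurable_fun setT (f : mR -> mR) ->
  (forall x, `|f x| <= M) -> (forall x, ~~ (a < x < b) -> f x = 0) ->
  (leb1 R).-integrable setT (EFin \o f).
Proof.
move=> mf fM f0.
have -> : f = f \_ `[a, b].
  apply/funext => x; rewrite patchE mem_setE in_itv/=.
  case: ifPn => // xab; apply: f0; apply: contra xab.
  by move=> /andP[/ltW -> /ltW ->].
have mab : measurable (`[a, b]%classic : set mR) by [].
apply: (proj1 (integrable_EFin_restrict _ _ mab)).
apply: measurable_bounded_integrable => //.
- have E : (leb1 R `[a, b]%classic < +oo)%E.
    by rewrite lebesgue_measure_itv/=; case: ifP => _; rewrite -?EFinB ltry.
  exact: E.
- exact: measurable_funTS.
- exists M; split; first exact: num_real.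
  by move=> r Mr x _ /=; apply: le_trans (fM x) (ltW Mr).
Qed.

Lemma integrable_bump a b n : (leb1 R).-integrable setT (EFin \o bump a b n).
Proof.
apply: (@integrable_bounded_itv _ a b 1); first exact: measurable_bump.
  by move=> x; rewrite ger0_norm ?bump_ge0// bump_le1.
by move=> x; exact: bump_out.
Qed.

Lemma integrable_dbump a b n : (leb1 R).-integrable setT (EFin \o dbump a b n).
Proof.
have [M hM] := @dbump_bounded R a b n.
apply: (@integrable_bounded_itv _ a b M); first exact: measurable_dbump.
  exact: hM.
by move=> x; exact: dbump_out.
Qed.

Lemma integral_dbump a b n : \int[leb1 R]_x dbump a b n x = 0.
Proof.
have -> : \int[leb1 R]_x dbump a b n x = \int[leb1 R]_(x in `[a, +oo[) dbump a b n x.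
  rewrite [in RHS]Rintegral_mkcond; congr Rintegral.
  apply/funext => x; rewrite !patchE !mem_setE !in_itv/= andbT.
  case: (leP a x) => //= ax; rewrite dbump_out// negb_and -!leNgt (ltW ax)//.
by rewrite integral_dbump_ray bump_out ?oppr0// ltxx.
Qed.

Let primitive_pair a b n g : R * R -> R :=
  (fun z => dbump a b n z.1 * g z.2) \_ [set z | z.2 <= z.1].

Let integrable_primitive_pair a b n g : (leb1 R).-integrable setT (EFin \o g) ->
  (leb2 R).-integrable setT (EFin \o primitive_pair a b n g).
Proof.
move=> gi; have mS : measurable ([set z | z.2 <= z.1] : set (mR * mR)).
  by apply: measurable_set_le; [exact: measurable_snd|exact: measurable_fst].
apply/(integrable_EFin_restrict _ _ mS).
apply: (@integrableS _ _ _ _ setT) => //.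
exact: (integrable_tensor (integrable_dbump a b n) gi).
Qed.

Let inner1 a b n g x : (leb1 R).-integrable setT (EFin \o g) ->
  \int[leb1 R]_y primitive_pair a b n g (x, y) =
  dbump a b n x * \int[leb1 R]_(y in `]-oo, x]) g y.
Proof.
move=> gi; rewrite -RintegralZl//; last exact: integrableS gi.
by rewrite [RHS]Rintegral_mkcond; congr Rintegral.
Qed.

Lemma integrable_dbump_primitive a b n g : (leb1 R).-integrable setT (EFin \o g) ->
  (leb1 R).-integrable setT
    (EFin \o (fun x => dbump a b n x * \int[leb1 R]_(y in `]-oo, x]) g y)).
Proof.
move=> gi; have := integrable_Rfubini1 (integrable_primitive_pair a b n gi).
by congr (_.-integrable _ _); apply/funext => x /=; rewrite inner1.
Qed.

(** Integration by parts against a primitive that need not be differentiable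
    everywhere: the order of integration is exchanged over the half-plane where
    [y <= x], and the inner integral is that of [dbump] over a ray. *)
Lemma integral_dbump_primitive a b n g : (leb1 R).-integrable setT (EFin \o g) ->
  \int[leb1 R]_x (dbump a b n x * \int[leb1 R]_(y in `]-oo, x]) g y) =
  - \int[leb1 R]_x (bump a b n x * g x).
Proof.
move=> gi; have Pi := integrable_primitive_pair a b n gi.
transitivity (\int[leb2 R]_z primitive_pair a b n g z).
  by rewrite Rfubini1//; apply: eq_Rintegral => x _; rewrite inner1.
rewrite Rfubini2// -mulN1r -RintegralZl//; last first.
  apply: (integrable_mul_bounded (M := 1)) => //; first exact: measurable_bump.
  by move=> x _; rewrite ger0_norm ?bump_ge0// bump_le1.
apply: eq_Rintegral => y _; rewrite mulrA mulN1r -(integral_dbump_ray a b n y).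
rewrite -RintegralZr//; last exact: integrableS (integrable_dbump a b n).
rewrite [RHS]Rintegral_mkcond; congr Rintegral; apply/funext => x.
by rewrite /primitive_pair !patchE !mem_setE in_itv/= andbT.
Qed.

End one_dimensional.

Section product_sigma_finite.
Local Open Scope ereal_scope.
Context {R : realType}.

Let sigma_finite_leb2 : sigma_finite setT (leb2 R).
Proof.
pose J (n : nat) : set (measurableTypeR R) := [set` `[(- n%:R)%R, n%:R%R]].
have JT x : (\bigcup_n J n) x.
  exists (Num.trunc `|x|).+1 => //; rewrite /J/= in_itv/= -ler_norml.
  exact/ltW/truncnS_gt.
have Joo n : leb1 R (J n) < +oo.
  by rewrite /J lebesgue_measure_itv/=; case: ifP => // _; rewrite -EFinB ltry.
have Jnd x i j : (i <= j)%N -> J i x -> J j x.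
  rewrite /J/= !in_itv/= -!ler_norml => ij xi; apply: le_trans xi _.
  by rewrite ler_nat.
exists (fun n => J n `*` J n).
  apply/seteqP; split => // -[x y] _.
  have [[i _ ix] [j _ jy]] := (JT x, JT y).
  exists (maxn i j) => //; split.
    exact: (Jnd _ _ _ (leq_maxl i j) ix).
  exact: (Jnd _ _ _ (leq_maxr i j) jy).
have mJ n : measurable (J n) by rewrite /J.
move=> k; split; first by apply: measurableX; exact: mJ.
by rewrite (product_measure1E _ _ (mJ k) (mJ k)) lte_mul_pinfty// ?Joo// ge0_fin_numE ?Joo.
Qed.

(** An alias to which sigma-finiteness is attached, so that it can be a factor of
    a product measure in three variables. *)
Definition plane_measure : set (measurableTypeR R * measurableTypeR R) -> \bar R :=
  leb2 R.

HB.instance Definition _ := Measure.on plane_measure.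

HB.instance Definition _ :=
  Measure_isSigmaFinite.Build _ _ _ plane_measure sigma_finite_leb2.

End product_sigma_finite.

(** * Integrals along null lines *)

Lemma Rintegral0_eq d (T : measurableType d) (R : realType)
    (mu : {measure set T -> \bar R}) (D : set T) (f : T -> R) :
  (forall x, D x -> f x = 0) -> \int[mu]_(x in D) f x = 0.
Proof. by move=> f0; rewrite /Rintegral integral0_eq// => x /f0 ->. Qed.

Section cumulative_integrals.
Context {R : realType}.
Local Notation mR := (measurableTypeR R).
Variable F : R * R -> R.
Hypothesis Fi : (leb2 R).-integrable setT (EFin \o F).

Definition quadrant (z : R * R) : set (mR * mR) := `]-oo, z.1] `*` `]-oo, z.2].

Definition column_integral (z : R * R) : R :=
  \int[leb1 R]_(y in `]-oo, z.2]) F (z.1, y).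

Definition quadrant_integral (z : R * R) : R := \int[leb2 R]_(w in quadrant z) F w.

Let half (y : R) : set (mR * mR) := setT `*` `]-oo, y].

Let mhalf y : measurable (half y). Proof. exact: measurableX. Qed.

Let half_i y : (leb2 R).-integrable setT (EFin \o (F \_ (half y))).
Proof.
apply: (proj1 (integrable_EFin_restrict _ _ (mhalf y))).
exact: integrableS Fi.
Qed.

Let halfE y x : \int[leb1 R]_v (F \_ (half y)) (x, v) = column_integral (x, y).
Proof.
rewrite /column_integral [RHS]Rintegral_mkcond; congr Rintegral; apply/funext => v.
by rewrite !patchE in_setX/= in_setT.
Qed.

Lemma integrable_column_integral y :
  (leb1 R).-integrable setT (EFin \o (fun x => column_integral (x, y))).
Proof.
have := integrable_Rfubini1 (half_i y); congr (_.-integrable _ _).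
by apply/funext => x /=; rewrite halfE.
Qed.

Lemma quadrant_integralE x y :
  quadrant_integral (x, y) = \int[leb1 R]_(v in `]-oo, x]) column_integral (v, y).
Proof.
have mq : measurable (quadrant (x, y)) by exact: measurableX.
rewrite /quadrant_integral Rintegral_mkcond Rfubini1; last first.
  apply: (proj1 (integrable_EFin_restrict _ _ mq)).
  exact: integrableS Fi.
rewrite [RHS]Rintegral_mkcond; apply: eq_Rintegral => v _.
rewrite [RHS]patchE; case: ifPn => vx.
  rewrite /column_integral [RHS]Rintegral_mkcond; congr Rintegral; apply/funext => w.
  by rewrite !patchE in_setX/= vx.
by apply: Rintegral0_eq => w _; rewrite patchE in_setX/= (negbTE vx).
Qed.

(** Joint measurability comes from integrating [F (x, v)] over [v <= y] in the
    space of triples [((x, y), v)]; [y] ranges over a bounded interval to keep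
    the triple integral finite. *)
Lemma integrable_column_integral_strip c d :
  (leb2 R).-integrable (setT `*` `[c, d]) (EFin \o column_integral).
Proof.
pose S0 : set ((mR * mR) * mR) := [set w | c <= w.1.2 /\ w.1.2 <= d].
pose S : set ((mR * mR) * mR) := [set w | w.2 <= w.1.2] `&` S0.
have m12 : measurable_fun setT (fun w : (mR * mR) * mR => w.1.2).
  exact: measurableT_comp measurable_snd measurable_fst.
have mS0 : measurable S0.
  have -> : S0 = [set w | c <= w.1.2] `&` [set w | w.1.2 <= d] by [].
  by apply: measurableI; apply: measurable_set_le => //; exact: measurable_cst.
have mS : measurable S.
  by apply: measurableI => //; apply: measurable_set_le => //; exact: measurable_snd.
pose G (w : (mR * mR) * mR) := F (w.1.1, w.2).
have mF : measurable_fun setT F by apply/measurable_EFinP; exact: measurable_int Fi.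
have mG : measurable_fun setT G.
  apply: (measurableT_comp mF); apply/measurable_fun_pairP; split.
    exact: measurableT_comp measurable_fst measurable_fst.
  exact: measurable_snd.
have G0 : (@plane_measure R \x leb1 R)%E.-integrable S0 (EFin \o G).
  apply: (proj2 (integrable_EFin_restrict _ _ mS0)).
  have mGS : measurable_fun setT (EFin \o G \_ S0).
    by apply/measurable_EFinP; apply/(measurable_restrictT _ mS0); exact: measurable_funTS.
  apply: (proj2 (@integrable12ltyP _ _ (mR * mR)%type mR R (@plane_measure R) (leb1 R) _ mGS)).
  pose N x := (\int[leb1 R]_y `|(F (x, y))%:E|)%E.
  have mN : measurable_fun setT N.
    apply: (measurable_fun_fubini_tonelli_F (m2 := leb1 R) (fun z => `|(F z)%:E|%E)) => //.
    by apply: measurableT_comp => //; exact/measurable_EFinP.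
  have N0 x : (0 <= N x)%E by exact: integral_ge0.
  have Noo : (\int[leb1 R]_x N x < +oo)%E.
    exact: (proj1 (@integrable12ltyP _ _ mR mR R (leb1 R) (leb1 R) _ (measurable_int _ Fi)) Fi).
  have E : (\int[leb2 R]_z \int[leb1 R]_y `|(EFin \o G \_ S0) (z, y)| =
      \int[leb2 R]_z (N z.1 * (\1_(`[c, d]) z.2)%:E))%E.
    apply: eq_integral => z _; rewrite indicE mem_setE in_itv/=.
    case: (boolP (c <= z.2 <= d)) => zcd.
      rewrite mule1; apply: eq_integral => y _.
      by rewrite /= patchE mem_set//=; move/andP: zcd.
    rewrite mule0 integral0_eq// => y _ /=.
    by rewrite patchE memNset ?normr0//= => -[cz zd]; rewrite cz zd in zcd.
  rewrite E fubini_tonelli1; last 2 first.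
    - apply: emeasurable_funM; first exact: measurableT_comp mN measurable_fst.
      apply/measurable_EFinP.
      by apply: (measurableT_comp (measurable_indic _) (@measurable_snd _ _ mR mR)).
    - by move=> z; rewrite mule_ge0// lee_fin.
  pose k := (\int[leb1 R]_y (\1_(`[c, d]) y)%:E)%E.
  have k0 : (0 <= k)%E by apply: integral_ge0 => y _; rewrite lee_fin.
  have koo : (k < +oo)%E.
    rewrite /k integral_indic// setIT.
    have L : (leb1 R `[c, d]%classic < +oo)%E.
      by rewrite lebesgue_measure_itv/=; case: ifP => _; rewrite -?EFinB ltry.
    exact: L.
  rewrite (eq_integral (fun x : mR => (N x * k)%E)); last first.
    move=> x _; rewrite /fubini_F /k /= ge0_integralZl//.
    by apply/measurable_EFinP; exact: measurable_indic.
  rewrite ge0_integralZr// lte_mul_pinfty ?integral_ge0//.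
  by rewrite ge0_fin_numE// integral_ge0.
have Gi : (@plane_measure R \x leb1 R)%E.-integrable S (EFin \o G).
  by apply: integrableS G0 => //; exact: subIsetr.
have := integrable_Rfubini1 (proj1 (integrable_EFin_restrict _ _ mS) Gi).
have mstrip : measurable (setT `*` `[c, d] : set (mR * mR)) by exact: measurableX.
move=> H; apply: (proj2 (integrable_EFin_restrict _ _ mstrip)).
move: H; congr (_.-integrable _ _); apply/funext => z /=; congr EFin.
rewrite patchE in_setX in_setT/= mem_setE in_itv/=; case: ifPn => zcd.
  rewrite /column_integral [RHS]Rintegral_mkcond; congr Rintegral; apply/funext => w.
  rewrite !patchE.
  move/andP: zcd => [cz zd].
  by congr (if _ then _ else _); apply/idP/idP; rewrite !inE /S/= ?in_itv/= => -[].
by apply: Rintegral0_eq => w _; rewrite patchE memNset// => -[_ [/= cz zd]];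
  rewrite cz zd in zcd.
Qed.

End cumulative_integrals.

(** * Transport along null lines *)

Lemma ae_eq_Rintegral d (T : measurableType d) (R : realType)
    (mu : {measure set T -> \bar R}) (f g : T -> R) :
  mu.-integrable setT (EFin \o f) -> mu.-integrable setT (EFin \o g) ->
  {ae mu, forall x, f x = g x} -> \int[mu]_x f x = \int[mu]_x g x.
Proof.
move=> fi gi fg; congr fine; apply: ae_eq_integral => //.
- exact: measurable_int fi.
- exact: measurable_int gi.
- by move: fg; apply: filterS => x + _ => ->.
Qed.

Lemma eq_integrable_EFin d (T : measurableType d) (R : realType)
    (mu : {measure set T -> \bar R}) (D : set T) (f g : T -> R) :
  f = g -> mu.-integrable D (EFin \o f) -> mu.-integrable D (EFin \o g).
Proof. by move=> ->. Qed.

Lemma integrable_EFinZl d (T : measurableType d) (R : realType)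
    (mu : {measure set T -> \bar R}) (D : set T) (f : T -> R) (k : R) : measurable D ->
  mu.-integrable D (EFin \o f) -> mu.-integrable D (EFin \o (fun x => k * f x)).
Proof. by move=> mD fi; exact: (integrableZl mD k fi). Qed.

(** What determines [p], which is twice the derivative of [U] in the first null
    variable; this accounts for the factor 2 in the weak identity. The inequalities
    on [a], [b], [c], [d] say that the box lies in the open triangle
    [x < A], [y < B], [0 < x + y]. *)
Record weak_transport (R : realType) (A B : R) (F U p : R * R -> R)
    (phi psi : R -> R) : Prop := WeakTransport {
  transport_source : (leb2 R).-integrable setT (EFin \o F);
  transport_solution : forall x y, x < A -> y < B -> 0 < x + y ->
    U (x, y) = phi x + psi y + 4^-1 * quadrant_integral F (x, y);
  transport_integrable : forall a b c d, b < A -> d < B -> 0 < a + c ->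
    (leb2 R).-integrable (box a b c d) (EFin \o U) /\
    (leb2 R).-integrable (box a b c d) (EFin \o p);
  transport_weak : forall a b c d n m, b < A -> d < B -> 0 < a + c ->
    \int[leb2 R]_(z in box a b c d)
      (U z * (2 * (dbump a b n z.1 * bump c d m z.2))) =
    - \int[leb2 R]_(z in box a b c d) (p z * (bump a b n z.1 * bump c d m z.2))
}.

(** For smooth data this is [2 phi' (z.1)]. *)
Definition transport_defect (R : realType) (F p : R * R -> R) (z : R * R) :=
  p z - 2^-1 * column_integral F z.

Section transport_defect.
Context {R : realType}.
Local Notation mR := (measurableTypeR R).
Variables (A B : R) (F U p : R * R -> R) (phi psi : R -> R).
Hypothesis sol : weak_transport A B F U p phi psi.

Let Fi := transport_source sol.
Let UE := transport_solution sol.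

Section on_a_box.
Variables (a b c d : R) (n m : nat).
Hypotheses (bA : b < A) (dB : d < B) (ac : 0 < a + c).

Let Q : set (mR * mR) := box a b c d.

Let mQ : measurable Q. Proof. exact: measurableX. Qed.

Let test (z : R * R) := bump a b n z.1 * bump c d m z.2.

Let test_measurable : measurable_fun setT (test : mR * mR -> mR).
Proof.
apply: measurable_funM.
  exact: measurableT_comp (measurable_bump _ _ _) measurable_fst.
exact: measurableT_comp (measurable_bump _ _ _) measurable_snd.
Qed.

Let test_le1 z : `|test z| <= 1.
Proof.
have t0 : 0 <= test z by apply: mulr_ge0; exact: bump_ge0.
by rewrite ger0_norm// /test mulr_ile1 ?bump_ge0 ?bump_le1.
Qed.

Let test_out z : ~ Q z -> test z = 0.
Proof.
rewrite /test => nQ.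
have [h1|h1] := boolP (a < z.1 < b); last by rewrite bump_out// mul0r.
have [h2|h2] := boolP (c < z.2 < d); last by rewrite (bump_out _ h2)// mulr0.
exfalso; apply: nQ; rewrite /Q /box/= !in_itv/=.
by move: h1 h2 => /andP[/ltW-> /ltW->] /andP[/ltW-> /ltW->].
Qed.

Lemma integrable_column_integral_box :
  (leb2 R).-integrable Q (EFin \o column_integral F).
Proof.
apply: integrableS (integrable_column_integral_strip Fi c d) => //.
- exact: measurableX.
- by move=> z [_ z2]; split.
Qed.

Let column_test_i : (leb2 R).-integrable setT
  (EFin \o (fun z => test z * column_integral F z)).
Proof.
have -> : (fun z => test z * column_integral F z) =
    (fun z => test z * column_integral F z) \_ Q.
  apply/funext => z; rewrite patchE; case: ifPn => // /negP zQ.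
  by rewrite test_out ?mul0r// => ?; apply: zQ; rewrite inE.
apply: (proj1 (integrable_EFin_restrict _ _ mQ)).
apply: (integrable_mul_bounded (M := 1)) => //; first exact: measurable_funTS.
exact: integrable_column_integral_box.
Qed.

Let V (z : R * R) := U z * (2 * (dbump a b n z.1 * bump c d m z.2)).

Let V_i : (leb2 R).-integrable setT (EFin \o (V \_ Q)).
Proof.
apply: (proj1 (integrable_EFin_restrict _ _ mQ)).
have [M hM] := @dbump_bounded R a b n.
have -> : V = fun z => (2 * (dbump a b n z.1 * bump c d m z.2)) * U z.
  by apply/funext => z; rewrite /V mulrC.
apply: (integrable_mul_bounded (M := 2 * M)) => //; last exact: (transport_integrable sol bA dB ac).1.
  apply: measurable_funTS; apply: measurable_funM; first exact: measurable_cst.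
  apply: measurable_funM.
    exact: measurableT_comp (measurable_dbump _ _ _) measurable_fst.
  exact: measurableT_comp (measurable_bump _ _ _) measurable_snd.
move=> z _; rewrite normrM ger0_norm// ler_wpM2l// normrM -[leRHS]mulr1.
by apply: ler_pM => //; rewrite ger0_norm ?bump_ge0 ?bump_le1.
Qed.

(* For fixed [y] the formula for [U] is integrated by parts in [x]. The term with
   [psi] disappears because [dbump] has integral 0, and the one with [F] turns
   into a column integral. That [dbump * phi] is integrable is deduced from the
   integrability of the other terms of the formula. *)
Let slice y : (leb1 R).-integrable setT (EFin \o (fun x => (V \_ Q) (x, y))) ->
  \int[leb1 R]_x (V \_ Q) (x, y) =
  2 * (\int[leb1 R]_x (dbump a b n x * phi x)) * bump c d m y -
  2^-1 * \int[leb1 R]_x (test (x, y) * column_integral F (x, y)).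
Proof.
move=> Vi; have [b0|bn0] := eqVneq (bump c d m y) 0.
  rewrite b0 mulr0 sub0r !Rintegral0_eq ?mulr0 ?oppr0//= => x _.
    by rewrite /test b0 mulr0 mul0r.
  by rewrite patchE; case: ifP => // _; rewrite /V/= b0 !mulr0.
have /andP[cy yd] : c < y < d.
  by apply: contra_neqT bn0 => /bump_out ->.
set beta := bump c d m y.
pose f x := U (x, y) * dbump a b n x.
have fE : f = fun x => (2 * beta)^-1 * (V \_ Q) (x, y).
  apply/funext => x; rewrite patchE /f; case: ifPn => [_|xQ].
    by rewrite /V/= -/beta; field.
  rewrite mulr0; have [/andP[ax xb]|xab] := boolP (a < x < b).
    exfalso; move/negP: xQ; apply; rewrite inE /Q /box/= !in_itv/=.
    by rewrite !ltW.
  by rewrite dbump_out// mulr0.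
have fi : (leb1 R).-integrable setT (EFin \o f).
  by rewrite fE; exact: integrable_EFinZl.
have intf : \int[leb1 R]_x (V \_ Q) (x, y) = 2 * beta * \int[leb1 R]_x f x.
  by rewrite fE RintegralZl// mulrA mulfV ?mul1r// mulf_neq0.
have Hi := integrable_column_integral Fi y.
pose g x := dbump a b n x * quadrant_integral F (x, y).
have gE : g = fun x => dbump a b n x *
    \int[leb1 R]_(v in `]-oo, x]) column_integral F (v, y).
  by apply/funext => x; rewrite /g quadrant_integralE.
have gi : (leb1 R).-integrable setT (EFin \o g).
  by rewrite gE; exact: integrable_dbump_primitive.
have intg : \int[leb1 R]_x g x =
    - \int[leb1 R]_x (bump a b n x * column_integral F (x, y)).
  by rewrite gE integral_dbump_primitive.
have phiE : (fun x => dbump a b n x * phi x) =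
    fun x => f x - (psi y * dbump a b n x + 4^-1 * g x).
  apply/funext => x; rewrite /f /g.
  have [/andP[ax xb]|xab] := boolP (a < x < b).
    rewrite UE//; last 3 first.
    - exact: lt_trans bA.
    - exact: lt_trans dB.
    - by apply: lt_trans ac _; exact: ltrD.
    by ring.
  by rewrite dbump_out// !(mul0r, mulr0) addr0 subr0.
have di := integrable_dbump a b n.
have di' : (leb1 R).-integrable setT (EFin \o (fun x => psi y * dbump a b n x)).
  exact: integrable_EFinZl.
have gi' : (leb1 R).-integrable setT (EFin \o (fun x => 4^-1 * g x)).
  exact: integrable_EFinZl.
rewrite intf phiE RintegralB//; last exact: (integrableD _ di' gi').
rewrite RintegralD//.
have -> : \int[leb1 R]_x (psi y * dbump a b n x) = 0.
  by rewrite (RintegralZl _ measurableT di) integral_dbump mulr0.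
have -> : \int[leb1 R]_x (4^-1 * g x) =
    - (4^-1 * \int[leb1 R]_x (bump a b n x * column_integral F (x, y))).
  by rewrite (RintegralZl _ measurableT gi) intg mulrN.
have -> : \int[leb1 R]_x (test (x, y) * column_integral F (x, y)) =
    beta * \int[leb1 R]_x (bump a b n x * column_integral F (x, y)).
  rewrite -RintegralZl//.
    by apply: eq_Rintegral => x _; rewrite /test/= -/beta; ring.
  apply: (integrable_mul_bounded (M := 1)) => //; first exact: measurable_bump.
  by move=> x _; rewrite ger0_norm ?bump_ge0 ?bump_le1.
by rewrite -/beta; field.
Qed.

Lemma integrable_transport_defect : (leb2 R).-integrable Q (EFin \o transport_defect F p).
Proof.
have H1 : (leb2 R).-integrable Q (EFin \o (fun z => 2^-1 * column_integral F z)).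
  by apply: integrable_EFinZl => //; exact: integrable_column_integral_box.
exact: (integrableB mQ (transport_integrable sol bA dB ac).2 H1).
Qed.

(** The column integral subtracted in the defect cancels the contribution of [F]
    to the weak derivative of [U]; what remains does not see the second variable
    except through the mass of its bump. *)
Lemma transport_defect_test :
  \int[leb2 R]_(z in Q) (transport_defect F p z * (bump a b n z.1 * bump c d m z.2)) =
  - 2 * (\int[leb1 R]_x (dbump a b n x * phi x)) * \int[leb1 R]_y bump c d m y.
Proof.
have H1 : (leb2 R).-integrable Q (EFin \o (fun z => test z * p z)).
  apply: (integrable_mul_bounded (M := 1)) => //; last exact: (transport_integrable sol bA dB ac).2.
  exact: measurable_funTS.
have H2 : (leb2 R).-integrable Q (EFin \o (fun z => 2^-1 * (test z * column_integral F z))).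
  apply: integrable_EFinZl => //; exact: integrableS column_test_i.
have -> : \int[leb2 R]_(z in Q) (transport_defect F p z * (bump a b n z.1 * bump c d m z.2)) =
    \int[leb2 R]_(z in Q) (test z * p z) -
    2^-1 * \int[leb2 R]_z (test z * column_integral F z).
  transitivity (\int[leb2 R]_(z in Q) (test z * p z - 2^-1 * (test z * column_integral F z))).
    by apply: eq_Rintegral => z _; rewrite /transport_defect -/(test z); ring.
  rewrite RintegralB// RintegralZl//; last exact: integrableS column_test_i.
  congr (_ - _ * _); rewrite Rintegral_mkcond; congr Rintegral; apply/funext => z.
  rewrite patchE; case: ifPn => // /negP zQ.
  by rewrite test_out ?mul0r// => ?; apply: zQ; rewrite inE.
have -> : \int[leb2 R]_(z in Q) (test z * p z) = - \int[leb2 R]_(z in Q) V z.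
  by rewrite (transport_weak sol)// opprK; apply: eq_Rintegral => z _; rewrite mulrC.
rewrite [X in - X]Rintegral_mkcond Rfubini2//.
have i1 := integrable_bump c d m.
have i2 := integrable_Rfubini2 column_test_i.
pose K := 2 * (\int[leb1 R]_x (dbump a b n x * phi x)).
have i1' : (leb1 R).-integrable setT (EFin \o (fun y => K * bump c d m y)).
  exact: integrable_EFinZl.
have i2' : (leb1 R).-integrable setT
    (EFin \o (fun y => 2^-1 * \int[leb1 R]_x (test (x, y) * column_integral F (x, y)))).
  exact: integrable_EFinZl.
have -> : \int[leb1 R]_y \int[leb1 R]_x (V \_ Q) (x, y) =
    \int[leb1 R]_y (K * bump c d m y -
      2^-1 * \int[leb1 R]_x (test (x, y) * column_integral F (x, y))).
  apply: ae_eq_Rintegral.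
  - exact: integrable_Rfubini2 V_i.
  - exact: (integrableB _ i1' i2').
  - by have := ae_integrable2 V_i; apply: filterS => y Vy; rewrite slice.
rewrite RintegralB// (RintegralZl _ measurableT i1) (RintegralZl _ measurableT i2).
by rewrite [X in _ - _ * X = _]Rfubini2// /K; ring.
Qed.

End on_a_box.
End transport_defect.

(** * Null derivatives up to a function of one variable *)

Section ae_logic.
Context d (T : measurableType d) (R : realType) (mu : {measure set T -> \bar R}).

Lemma ae_imply (P Q : T -> Prop) : (forall x, P x -> Q x) ->
  {ae mu, forall x, P x} -> {ae mu, forall x, Q x}.
Proof. by move=> PQ; apply: filterS. Qed.

Lemma ae_and (P Q : T -> Prop) : {ae mu, forall x, P x} ->
  {ae mu, forall x, Q x} -> {ae mu, forall x, P x /\ Q x}.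
Proof. exact: filterI. Qed.

End ae_logic.

(** The open triangle is covered by the countably many boxes with rational
    corners that it contains. *)
Lemma ae_triangle_cover (R : realType) (A B : R) (P : R * R -> Prop) :
  (forall a b c d : R, b < A -> d < B -> 0 < a + c ->
    {ae leb2 R, forall z, (`]a, b[ `*` `]c, d[) z -> P z}) ->
  {ae leb2 R, forall z, z.1 < A -> z.2 < B -> 0 < z.1 + z.2 -> P z}.
Proof.
move=> H.
pose Q (n : nat) (z : R * R) := forall q : (rat * rat) * (rat * rat),
  unpickle n = Some q -> let a := ratr q.1.1 : R in let b := ratr q.1.2 : R in
  let c := ratr q.2.1 : R in let d := ratr q.2.2 : R in
  b < A -> d < B -> 0 < a + c -> (`]a, b[ `*` `]c, d[) z -> P z.
have QA n : {ae leb2 R, forall z, Q n z}.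
  rewrite /Q; case: (unpickle n) => [q|]; last by apply: aeW => z q.
  have [h|h] := pselect ((ratr q.1.2 : R) < A /\ (ratr q.2.2 : R) < B /\
      0 < (ratr q.1.1 : R) + ratr q.2.1).
    have [h1 [h2 h3]] := h.
    by have := H _ _ _ _ h1 h2 h3; apply: ae_imply => z Pz _ [<-] /= _ _ _; exact: Pz.
  by apply: aeW => z _ [<-] /= h1 h2 h3; exfalso; apply: h.
have := ae_foralln QA.
apply: ae_imply => z Qz z1 z2 z12.
pose e := (z.1 + z.2) / 2.
have e0 : 0 < e by rewrite divr_gt0.
have pick u v : u < v -> exists2 q : rat, u < (ratr q : R) & (ratr q : R) < v.
  by move=> /rat_in_itvoo[q]; rewrite in_itv/= => /andP[uq qv]; exists q.
have [a az za] : exists2 q : rat, z.1 - e < (ratr q : R) & (ratr q : R) < z.1.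
  by apply: pick; rewrite ltrBlDr ltrDl.
have [c cz zc] : exists2 q : rat, z.2 - e < (ratr q : R) & (ratr q : R) < z.2.
  by apply: pick; rewrite ltrBlDr ltrDl.
have [b zb bA] := pick _ _ z1; have [d zd dB] := pick _ _ z2.
apply: (Qz (pickle ((a, b), (c, d))) ((a, b), (c, d))) => //=.
- by rewrite pickleK.
- have -> : 0 = (z.1 - e) + (z.2 - e) by rewrite /e; field.
  exact: ltrD.
- by split; rewrite /= in_itv/= ?za ?zc ?zb ?zd.
Qed.

Lemma Rintegral_support d (T : measurableType d) (R : realType)
    (mu : {measure set T -> \bar R}) (D D' : set T) (f : T -> R) :
  (forall x, D x -> ~ D' x -> f x = 0) -> (forall x, D' x -> ~ D x -> f x = 0) ->
  \int[mu]_(x in D) f x = \int[mu]_(x in D') f x.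
Proof.
move=> h1 h2; rewrite Rintegral_mkcond [RHS]Rintegral_mkcond; congr Rintegral.
apply/funext => x; rewrite !patchE.
case: ifPn => [xD|/negP xD]; case: ifPn => [xD'|/negP xD'] //.
  by apply: h1; [exact: set_mem|move=> ?; apply: xD'; exact: mem_set].
by apply/esym/h2; [exact: set_mem|move=> ?; apply: xD; exact: mem_set].
Qed.

Lemma Rintegral_tensor d1 d2 (T1 : measurableType d1) (T2 : measurableType d2)
    (R : realType) (m1 : {sigma_finite_measure set T1 -> \bar R})
    (m2 : {sigma_finite_measure set T2 -> \bar R}) (f : T1 -> R) (g : T2 -> R) :
  m1.-integrable setT (EFin \o f) -> m2.-integrable setT (EFin \o g) ->
  \int[(m1 \x m2)%E]_z (f z.1 * g z.2) = (\int[m1]_x f x) * \int[m2]_y g y.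
Proof.
move=> fi gi; rewrite (Rfubini1 (integrable_tensor fi gi))/=.
rewrite -(RintegralZr _ measurableT fi); apply: eq_Rintegral => x _.
exact: (RintegralZl _ measurableT gi).
Qed.

Lemma Rintegral_bump_gt0 (R : realType) (a b : R) n : a < b ->
  0 < \int[leb1 R]_x bump a b n x.
Proof.
move=> ab; rewrite lt_neqAle Rintegral_ge0 ?andbT; last by move=> x _; exact: bump_ge0.
apply/negP => /eqP b0.
have : (\int[leb1 R]_x `|(bump a b n x)%:E| = 0)%E.
  rewrite -[LHS]fineK.
    congr EFin; rewrite [RHS]b0; congr fine; apply: eq_integral => x _.
    by rewrite gee0_abs// lee_fin bump_ge0.
  by have := integrable_norm (integrable_bump a b n); exact: integrable_fin_num.
have mb : measurable_fun setT (EFin \o (bump a b n : measurableTypeR R -> R)).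
  by apply/measurable_EFinP; exact: measurable_bump.
move/(ae_eq_integral_abs (leb1 R) measurableT mb) => [N [mN N0 sN]].
have sab : (`]a, b[%classic : set (measurableTypeR R)) `<=` N.
  move=> x; rewrite /= in_itv/= => xab; apply: sN => /= /(_ I) [] /eqP.
  by rewrite gt_eqF// bump_gt0.
have mab : measurable (`]a, b[%classic : set (measurableTypeR R)) by [].
have L : leb1 R `]a, b[%classic = (b - a)%:E.
  by rewrite lebesgue_measure_itv/= lte_fin ab EFinB.
have [] := etrans (esym L) (subset_measure0 mab mN sab N0).
by move/eqP; rewrite subr_eq0 gt_eqF.
Qed.

Section defect_depends_on_one_variable.
Context {R : realType}.
Local Notation mR := (measurableTypeR R).
Variables (A B : R) (F U p : R * R -> R) (phi psi : R -> R).
Hypothesis sol : weak_transport A B F U p phi psi.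

Let defect := transport_defect F p.

Let measurable_box a b c d : measurable (box a b c d : set (mR * mR)).
Proof. exact: measurableX. Qed.

Let test_out a b c d n (z : R * R) : ~ (`]a, b[ `*` `]c, d[) z ->
  bump a b n z.1 * bump c d n z.2 = 0.
Proof.
rewrite /= !in_itv/= => nQ.
have [h1|h1] := boolP (a < z.1 < b); last by rewrite bump_out// mul0r.
have [h2|h2] := boolP (c < z.2 < d); last by rewrite (bump_out _ h2)// mulr0.
by exfalso; apply: nQ.
Qed.

Let integrable_test a b c d n (f : R * R -> R) (D : set (mR * mR)) : measurable D ->
  (leb2 R).-integrable D (EFin \o f) ->
  (leb2 R).-integrable D (EFin \o (fun z => f z * (bump a b n z.1 * bump c d n z.2))).
Proof.
move=> mD fi.
have -> : (fun z => f z * (bump a b n z.1 * bump c d n z.2)) =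
    (fun z => (bump a b n z.1 * bump c d n z.2) * f z).
  by apply/funext => z; rewrite mulrC.
apply: (integrable_mul_bounded (M := 1)) => //.
  apply: measurable_funTS; apply: measurable_funM.
    exact: measurableT_comp (measurable_bump _ _ _) measurable_fst.
  exact: measurableT_comp (measurable_bump _ _ _) measurable_snd.
move=> z _; have t0 : 0 <= bump a b n z.1 * bump c d n z.2.
  by apply: mulr_ge0; exact: bump_ge0.
by rewrite ger0_norm// mulr_ile1 ?bump_ge0 ?bump_le1.
Qed.

Let integrable_fst_box (rho : R -> R) a b c d :
  (leb1 R).-integrable setT (EFin \o rho) ->
  (leb2 R).-integrable (box a b c d) (EFin \o (fun z => rho z.1)).
Proof.
move=> rhoi.
have ind : (leb1 R).-integrable setT (EFin \o (\1_(`[c, d]) : mR -> R)).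
  exact: integrable_indic_itv.
have := integrable_tensor rhoi ind.
move/(integrableS measurableT (measurable_box a b c d) (@subsetT _ _)).
apply: eq_integrable => // z; rewrite inE => -[_ z2] /=.
by rewrite indicE mem_set// mulr1.
Qed.

(** The defect and the function [rho] of [z.1] have the same integrals against
    all products of bumps, so [bumps_eq0] identifies them on each box. *)
Lemma transport_defect_ae (A' B' : R) (rho : R -> R) : A' <= A -> B' <= B ->
  (leb1 R).-integrable setT (EFin \o rho) ->
  (forall a b c d n, b < A' -> d < B' -> 0 < a + c ->
     \int[leb2 R]_(z in box a b c d) (defect z * (bump a b n z.1 * bump c d n z.2)) =
     (\int[leb1 R]_x (bump a b n x * rho x)) * \int[leb1 R]_y bump c d n y) ->
  {ae leb2 R, forall z, z.1 < A' -> z.2 < B' -> 0 < z.1 + z.2 -> defect z = rho z.1}.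
Proof.
move=> AA BB rhoi H; apply: ae_triangle_cover => a0 b0 c0 d0 b0A d0B ac0.
have hi a b c d : b < A' -> d < B' -> 0 < a + c ->
    (leb2 R).-integrable (box a b c d) (EFin \o (fun z => defect z - rho z.1)).
  move=> bA dB ac.
  exact: (integrableB (measurable_box a b c d)
    (integrable_transport_defect sol (lt_le_trans bA AA) (lt_le_trans dB BB) ac)
    (integrable_fst_box a b c d rhoi)).
have mQ : measurable (`]a0, b0[ `*` `]c0, d0[ : set (mR * mR)) by exact: measurableX.
have hQ : (leb2 R).-integrable (`]a0, b0[ `*` `]c0, d0[)
    (EFin \o (fun z => defect z - rho z.1)).
  apply: integrableS (hi _ _ _ _ b0A d0B ac0) => //.
  by move=> z [/= z1 z2]; split; exact: subset_itv_oo_cc.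
have := bumps_eq0 hQ.
suff h0 : forall a b c d n, a0 <= a -> b <= b0 -> c0 <= c -> d <= d0 ->
    \int[leb2 R]_(z in `]a0, b0[ `*` `]c0, d0[)
      ((defect z - rho z.1) * (bump a b n z.1 * bump c d n z.2)) = 0.
  by move=> /(_ h0); apply: ae_imply => z Hz zQ; apply/eqP; rewrite -subr_eq0 Hz.
move=> a b c d n aa bb cc dd.
have bA : b < A' := le_lt_trans bb b0A.
have dB : d < B' := le_lt_trans dd d0B.
have ac : 0 < a + c by apply: lt_le_trans ac0 _; exact: lerD.
rewrite (@Rintegral_support _ _ R (leb2 R) _ (box a b c d)); first last.
- move=> z _ nQ; rewrite test_out ?mulr0// => zab; apply: nQ; move: zab.
  rewrite /= !in_itv/= => -[/andP[h1 h2] /andP[h3 h4]]; split; apply/andP; split.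
  + exact: le_lt_trans h1.
  + exact: lt_le_trans bb.
  + exact: le_lt_trans h3.
  + exact: lt_le_trans dd.
- move=> z _ nQ; rewrite test_out ?mulr0// => zab; apply: nQ; move: zab.
  by move=> [/= z1 z2]; split; exact: subset_itv_oo_cc.
have i1 := integrable_test a b c d n (measurable_box a b c d)
  (integrable_transport_defect sol (lt_le_trans bA AA) (lt_le_trans dB BB) ac).
have i2 := integrable_test a b c d n (measurable_box a b c d)
  (integrable_fst_box a b c d rhoi).
transitivity (\int[leb2 R]_(z in box a b c d)
    (defect z * (bump a b n z.1 * bump c d n z.2) -
     rho z.1 * (bump a b n z.1 * bump c d n z.2))).
  by apply: eq_Rintegral => z _; rewrite mulrBl.
rewrite (RintegralB (measurable_box a b c d) i1 i2) H//.
apply/eqP; rewrite subr_eq0; apply/eqP.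
have i3 : (leb1 R).-integrable setT (EFin \o (fun x => bump a b n x * rho x)).
  apply: (integrable_mul_bounded (M := 1)) => //; first exact: measurable_bump.
  by move=> x _; rewrite ger0_norm ?bump_ge0 ?bump_le1.
rewrite -(Rintegral_tensor i3 (integrable_bump c d n)).
rewrite [in RHS]Rintegral_mkcond; congr Rintegral; apply/funext => z.
rewrite patchE; case: ifPn => [_|/negP zQ]; first by ring.
have -> : bump a b n z.1 * rho z.1 * bump c d n z.2 =
  rho z.1 * (bump a b n z.1 * bump c d n z.2) by ring.
rewrite test_out ?mulr0// => -[/= z1 z2]; apply: zQ; rewrite inE.
by split; exact: subset_itv_oo_cc.
Qed.

Lemma transport_without_data : (forall x, phi x = 0) ->
  {ae leb2 R, forall z, z.1 < A -> z.2 < B -> 0 < z.1 + z.2 ->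
     p z = 2^-1 * column_integral F z}.
Proof.
move=> phi0.
have i0 : (leb1 R).-integrable setT (EFin \o (cst 0 : R -> R)) by exact: integrable0.
apply: (ae_imply _ (transport_defect_ae (lexx A) (lexx B) i0 _)).
  move=> z Hz z1 z2 z12.
  by apply/eqP; rewrite -subr_eq0; apply/eqP; exact: Hz.
move=> a b c d n bA dB ac; rewrite (transport_defect_test sol)//.
have -> : \int[leb1 R]_x (dbump a b n x * phi x) = 0.
  by apply: Rintegral0_eq => x _; rewrite phi0 mulr0.
have -> : \int[leb1 R]_x (bump a b n x * cst 0 x) = 0.
  by apply: Rintegral0_eq => x _; rewrite mulr0.
by rewrite mulr0.
Qed.

(** No derivative of [phi] is at hand: [rho] is found by averaging the defect in the
    second variable against one bump, supported near the top of the triangle.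
    Keeping the distance [e] from the upper sides lets this one bump serve for
    all the abscissas involved. *)
Lemma transport_with_data (e : R) : 0 < e ->
  exists2 rho : R -> R, (leb1 R).-integrable setT (EFin \o rho) &
    {ae leb2 R, forall z, z.1 < A - e -> z.2 < B - e -> 0 < z.1 + z.2 ->
       p z = 2^-1 * column_integral F z + rho z.1}.
Proof.
move=> e0.
(* [z.2 < B - e] and [0 < z.1 + z.2] force [a0 < z.1]; the strip between the
   ordinates [c0] and [d0] lies above all these points and below [B]. *)
pose a0 := e - B; pose b0 := A - e; pose c0 := B - e / 2; pose d0 := B - e / 4.
have b0A : b0 < A by rewrite ltrBlDr ltrDl.
have d0B : d0 < B by rewrite ltrBlDr ltrDl divr_gt0.
have ac0 : 0 < a0 + c0 by rewrite /a0 /c0; lra.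
have cd0 : c0 < d0 by rewrite /c0 /d0; lra.
pose kappa := \int[leb1 R]_y bump c0 d0 0 y.
have kappa0 : 0 < kappa := Rintegral_bump_gt0 0 cd0.
pose f := (fun z => bump c0 d0 0 z.2 * defect z) \_ (box a0 b0 c0 d0).
have fi : (leb2 R).-integrable setT (EFin \o f).
  apply: (proj1 (integrable_EFin_restrict _ _ (measurable_box a0 b0 c0 d0))).
  apply: (integrable_mul_bounded (M := 1)) => //.
  - apply: measurable_funTS.
    exact: measurableT_comp (measurable_bump _ _ _) measurable_snd.
  - by move=> z _; rewrite ger0_norm ?bump_ge0 ?bump_le1.
  - exact: (integrable_transport_defect sol).
pose rho x := kappa^-1 * \int[leb1 R]_y f (x, y).
have rhoi : (leb1 R).-integrable setT (EFin \o rho).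
  by apply: integrable_EFinZl => //; exact: integrable_Rfubini1.
exists rho => //.
have AA : A - e <= A by rewrite lerBlDr lerDl ltW.
have BB : B - e <= B by rewrite lerBlDr lerDl ltW.
apply: (ae_imply _ (transport_defect_ae AA BB rhoi _)).
  move=> z Hz z1 z2 z12.
  by have := Hz z1 z2 z12; rewrite /defect /transport_defect => <-; ring.
{ move=> a b c d n bA dB ac; rewrite (transport_defect_test sol); last 3 first.
  - exact: lt_le_trans AA.
  - exact: lt_le_trans BB.
  - exact: ac.
  have [cd|dc] := ltP c d; last first.
    have -> : \int[leb1 R]_y bump c d n y = 0.
      apply: Rintegral0_eq => y _; apply: bump_out; apply/negP => /andP[cy yd].
      by have := lt_trans cy yd; rewrite ltNge dc.
    by rewrite !mulr0.
  congr (_ * _); apply: (mulfI (lt0r_neq0 kappa0)).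
  have bA' : b < A := lt_le_trans bA AA.
  have ac' : 0 < a + c0 by rewrite /c0; lra.
  rewrite [LHS]mulrC -(transport_defect_test sol n 0 bA' d0B ac').
  have i3 : (leb2 R).-integrable setT (EFin \o (fun z => bump a b n z.1 * f z)).
    apply: (integrable_mul_bounded (M := 1)) => //.
      exact: measurableT_comp (measurable_bump _ _ _) measurable_fst.
    by move=> x _; rewrite ger0_norm ?bump_ge0 ?bump_le1.
  transitivity (\int[leb2 R]_z (bump a b n z.1 * f z)).
    rewrite Rintegral_mkcond; congr Rintegral; apply/funext => z.
    rewrite /f !patchE; case: ifPn => [/set_mem[z1 z2]|/negP zQ].
      have [xab|xab] := boolP (a < z.1 < b); last by rewrite bump_out// !mul0r mulr0.
      rewrite mem_set; first by rewrite /defect; ring.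
      split => //=; move: z1 xab; rewrite /= !in_itv/= => /andP[az zb] _.
      by apply/andP; split; rewrite /a0 /b0; lra.
    case: ifPn => [/set_mem[z1 z2]|_]; last by rewrite mulr0.
    rewrite bump_out ?mul0r//; apply/negP => xab; apply: zQ; rewrite inE; split => //=.
    by rewrite in_itv/=; move/andP: xab => [/ltW -> /ltW ->].
  rewrite (Rfubini1 i3) -RintegralZl//; last first.
    apply: (integrable_mul_bounded (M := 1)) => //; first exact: measurable_bump.
    by move=> x _; rewrite ger0_norm ?bump_ge0 ?bump_le1.
  apply: ae_eq_Rintegral.
  - exact: (integrable_Rfubini1 i3).
  - apply: integrable_EFinZl => //.
    apply: (integrable_mul_bounded (M := 1)) => //; first exact: measurable_bump.
    by move=> x _; rewrite ger0_norm ?bump_ge0 ?bump_le1.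
  have := ae_integrable1 fi; apply: filterS => x fx.
  have -> : \int[leb1 R]_y (bump a b n (x, y).1 * f (x, y)) =
      bump a b n x * \int[leb1 R]_y f (x, y).
    by rewrite -RintegralZl.
  by rewrite /rho; field; exact: lt0r_neq0. }
Qed.

End defect_depends_on_one_variable.

(** * A Goursat inequality *)

Section ae_coordinates.
Context {R : realType}.
Local Notation mR := (measurableTypeR R).

Lemma ae_fst (P : R -> Prop) : {ae leb1 R, forall x, P x} ->
  {ae leb2 R, forall z, P z.1}.
Proof.
move=> [N [mN N0 sN]]; exists (N `*` setT); split.
- exact: measurableX.
- by rewrite [LHS]product_measure1E// [X in (X * _)%E]N0 mul0e.
- by move=> z /= nP; split => //; exact: sN.
Qed.

Lemma ae_snd (P : R -> Prop) : {ae leb1 R, forall x, P x} ->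
  {ae leb2 R, forall z, P z.2}.
Proof.
move=> [N [mN N0 sN]]; exists (setT `*` N); split.
- exact: measurableX.
- by rewrite [LHS]product_measure1E// [X in (_ * X)%E]N0 mule0.
- by move=> z /= nP; split => //; exact: sN.
Qed.

(** Integrating first along the sections of [D] exposes the smallness of [c]
    on them. *)
Lemma tensor_section_le1 (N c : R -> R) (D : set (mR * mR)) (theta : R) :
  measurable D -> (forall x, 0 <= N x) -> (forall x, 0 <= c x) ->
  (leb1 R).-integrable setT (EFin \o N) -> (leb1 R).-integrable setT (EFin \o c) ->
  (forall x, \int[leb1 R]_(y in xsection D x) c y <= theta) ->
  \int[leb2 R]_(z in D) (N z.1 * c z.2) <= theta * \int[leb1 R]_x N x.
Proof.
move=> mD N0 c0 Ni ci ctheta.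
have ti := integrable_tensor Ni ci.
rewrite Rintegral_mkcond Rfubini1; last first.
  apply: (proj1 (integrable_EFin_restrict _ _ mD)); exact: integrableS ti.
rewrite -RintegralZl//; apply: le_Rintegral => //.
- apply: integrable_Rfubini1.
  apply: (proj1 (integrable_EFin_restrict _ _ mD)); exact: integrableS ti.
- exact: integrable_EFinZl.
move=> x _; rewrite [leRHS]mulrC.
have -> : \int[leb1 R]_y ((fun z => N z.1 * c z.2) \_ D) (x, y) =
    N x * \int[leb1 R]_(y in xsection D x) c y.
  rewrite -RintegralZl//; last 2 first.
  - exact: measurable_xsection.
  - by apply: integrableS ci => //; exact: measurable_xsection.
  rewrite [RHS]Rintegral_mkcond; congr Rintegral; apply/funext => y.
  by rewrite !patchE mem_xsection.
by rewrite ler_wpM2l.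
Qed.

Lemma tensor_section_le2 (N c : R -> R) (D : set (mR * mR)) (theta : R) :
  measurable D -> (forall x, 0 <= N x) -> (forall x, 0 <= c x) ->
  (leb1 R).-integrable setT (EFin \o N) -> (leb1 R).-integrable setT (EFin \o c) ->
  (forall y, \int[leb1 R]_(x in ysection D y) c x <= theta) ->
  \int[leb2 R]_(z in D) (c z.1 * N z.2) <= theta * \int[leb1 R]_x N x.
Proof.
move=> mD N0 c0 Ni ci ctheta.
have ti := integrable_tensor ci Ni.
rewrite Rintegral_mkcond Rfubini2; last first.
  apply: (proj1 (integrable_EFin_restrict _ _ mD)); exact: integrableS ti.
rewrite -RintegralZl//; apply: le_Rintegral => //.
- apply: integrable_Rfubini2.
  apply: (proj1 (integrable_EFin_restrict _ _ mD)); exact: integrableS ti.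
- exact: integrable_EFinZl.
move=> y _.
have -> : \int[leb1 R]_x ((fun z => c z.1 * N z.2) \_ D) (x, y) =
    (\int[leb1 R]_(x in ysection D y) c x) * N y.
  rewrite -RintegralZr//; last 2 first.
  - exact: measurable_ysection.
  - by apply: integrableS ci => //; exact: measurable_ysection.
  rewrite [RHS]Rintegral_mkcond; congr Rintegral; apply/funext => x.
  by rewrite !patchE mem_ysection.
by rewrite ler_wpM2r.
Qed.

End ae_coordinates.

Lemma integral_small (R : realType) d (T : measurableType d)
    (mu : {measure set T -> \bar R}) (c : T -> R) (theta : R) : 0 < theta ->
  (forall x, 0 <= c x) -> mu.-integrable setT (EFin \o c) ->
  exists2 delta : R, 0 < delta & forall D, measurable D -> (mu D < delta%:E)%E ->
    \int[mu]_(x in D) c x < theta.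
Proof.
move=> t0 c0 ci; have [delta [d0 H]] := integral_normr_continuous ci t0.
exists delta => // D mD muD; have := H D mD muD.
by congr (_ < _); apply: eq_Rintegral => x _; rewrite ger0_norm.
Qed.

Lemma ae_le_Rintegral d (T : measurableType d) (R : realType)
    (mu : {measure set T -> \bar R}) (D : set T) (f1 f2 : T -> R) : measurable D ->
  (forall x, D x -> 0 <= f1 x) -> (forall x, D x -> 0 <= f2 x) ->
  mu.-integrable D (EFin \o f1) -> mu.-integrable D (EFin \o f2) ->
  {ae mu, forall x, D x -> f1 x <= f2 x} ->
  \int[mu]_(x in D) f1 x <= \int[mu]_(x in D) f2 x.
Proof.
move=> mD f10 f20 f1i f2i f12.
apply: fine_le; [exact: integrable_fin_num|exact: integrable_fin_num|].
apply: ae_ge0_le_integral => //.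
- exact: measurable_int f1i.
- exact: measurable_int f2i.
Qed.

Definition row_integral (R : realType) (F : R * R -> R) (z : R * R) : R :=
  \int[leb1 R]_(x in `]-oo, z.1]) F (x, z.2).

Section goursat.
Context {R : realType}.
Local Notation mR := (measurableTypeR R).
Variables (g k : R * R -> R) (a b : R -> R) (r : R).
Hypotheses (g0 : forall z, 0 <= g z) (k0 : forall z, 0 <= k z).
Hypotheses (a0 : forall x, 0 <= a x) (b0 : forall y, 0 <= b y).
Hypotheses (gi : (leb2 R).-integrable setT (EFin \o g))
  (ki : (leb2 R).-integrable setT (EFin \o k))
  (ai : (leb1 R).-integrable setT (EFin \o a))
  (bi : (leb1 R).-integrable setT (EFin \o b)).
Hypothesis r0 : 0 < r.
Hypothesis g_box : forall z : R * R, ~~ (- r <= z.1 <= r) -> g z = 0.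
Hypothesis g_past : forall z : R * R, z.1 + z.2 < 0 -> g z = 0.
Hypothesis g_le : {ae leb2 R, forall z, g z <= k z * quadrant_integral g z +
  b z.2 * column_integral g z + a z.1 * row_integral g z}.

Let past (s : R) : set (mR * mR) := [set z | z.1 + z.2 <= s].

Let msum : measurable_fun setT (fun z : mR * mR => z.1 + z.2 : mR).
Proof. exact: (measurable_funD (@measurable_fst _ _ mR mR) (@measurable_snd _ _ mR mR)). Qed.

Let mpast s : measurable (past s).
Proof. by apply: measurable_set_le => //; exact: measurable_cst. Qed.

Let strip (s delta : R) : set (mR * mR) :=
  (past (s + delta) `\` past s) `&` (`[- r, r] `*` setT).

Let mstrip s delta : measurable (strip s delta).
Proof.
apply: measurableI; first by apply: measurableD; exact: mpast.
exact: measurableX.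
Qed.

Let xsection_strip s delta x :
  xsection (strip s delta) x `<=` (`]s - x, s + delta - x] : set mR).
Proof.
move=> y; rewrite /xsection/= inE /strip /past/= => -[[h1 h2] _].
by rewrite in_itv/=; move/negP: h2; rewrite -ltNge => h2; apply/andP; split; lra.
Qed.

Let ysection_strip s delta y :
  ysection (strip s delta) y `<=` (`]s - y, s + delta - y] : set mR).
Proof.
move=> x; rewrite /ysection/= inE /strip /past/= => -[[h1 h2] _].
by rewrite in_itv/=; move/negP: h2; rewrite -ltNge => h2; apply/andP; split; lra.
Qed.

Let measure_itv s delta x : 0 < delta ->
  leb1 R (`]s - x, s + delta - x] : set mR) = delta%:E.
Proof.
move=> d0; have L : leb1 R (`]s - x, s + delta - x]%classic) = delta%:E.
  rewrite lebesgue_measure_itv/= lte_fin ifT; last by lra.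
  by rewrite -EFinB; congr EFin; ring.
exact: L.
Qed.

Let measure_strip s delta : 0 < delta -> (leb2 R (strip s delta) <= (delta * (2 * r))%:E)%E.
Proof.
move=> d0.
have E : (\int[leb1 R]_x (delta%:E * (\1_(`[(- r)%R, r]) x)%:E) = (delta * (2 * r))%:E)%E.
  rewrite ge0_integralZl ?lee_fin ?ltW//; last by apply/measurable_EFinP.
  rewrite integral_indic// setIT.
  have L : leb1 R (`[- r, r]%classic) = (2 * r)%:E.
    rewrite lebesgue_measure_itv/= lte_fin gtrN//.
    by rewrite -EFinB; congr EFin; ring.
  by rewrite [X in (_ * X)%E]L.
rewrite -E /product_measure1; apply: ge0_le_integral => //=.
- exact: measurable_fun_xsection.
- by apply: measurable_funeM; exact/measurable_EFinP.
move=> x _; have [xr|xr] := boolP (- r <= x <= r).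
  rewrite indicE mem_set ?mule1//= -(measure_itv s x d0).
  by apply: le_measure; rewrite ?inE//; exact: measurable_xsection.
have -> : xsection (strip s delta) x = set0.
  apply/seteqP; split => // y; rewrite /xsection/= inE /strip/= in_itv/= => -[_ [h _]].
  by rewrite h in xr.
by rewrite measure0 mule_ge0// lee_fin ?ltW.
Qed.

Let mass s := \int[leb2 R]_(z in past s) g z.

Let mass_eq0 s : mass s = 0 -> {ae leb2 R, forall z, past s z -> g z = 0}.
Proof.
move=> m0.
have gs : (leb2 R).-integrable (past s) (EFin \o g) by exact: integrableS gi.
have mg := measurable_int _ gs.
have : (\int[leb2 R]_(z in past s) `|(g z)%:E| = 0)%E.
  rewrite -[LHS]fineK.
    congr EFin; rewrite -[RHS]m0; congr fine; apply: eq_integral => x _.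
    by rewrite gee0_abs// lee_fin.
  by have := integrable_norm gs; exact: integrable_fin_num.
move/(ae_eq_integral_abs (leb2 R) (mpast s) mg); apply: ae_imply => z H zs.
by have [] := H zs.
Qed.

(** Let [m] be the mass of [g] up to level [s + delta]. As [g] vanishes below the
    strip, [m] is its mass on the strip, where the three integrals in [g_le] are at
    most [m] or a marginal of [g] of mass [m]. Each weight has mass at most 1/6 on
    the strip, or on its sections, which have length [delta]; so [m <= m / 2].
    The width depends on the weights only. *)
Lemma mass_step : exists2 delta : R, 0 < delta &
  forall s, mass s = 0 -> mass (s + delta) = 0.
Proof.
(* three terms, each to be at most [m / 6] *)
have t0 : 0 < 6^-1 :> R by rewrite invr_gt0.
have [da da0 Ha] := @integral_small R _ mR (leb1 R) a _ t0 a0 ai.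
have [db db0 Hb] := @integral_small R _ mR (leb1 R) b _ t0 b0 bi.
have [dk dk0 Hk] := @integral_small R _ (mR * mR)%type (leb2 R) k _ t0 k0 ki.
pose delta := Num.min (da / 2) (Num.min (db / 2) (dk / (4 * r))).
have d0 : 0 < delta by rewrite !lt_min !divr_gt0// mulr_gt0.
have dda : delta < da.
  have : delta <= da / 2 by rewrite /delta !ge_min lexx.
  by lra.
have ddb : delta < db.
  have : delta <= db / 2 by rewrite /delta !ge_min lexx orbT.
  by lra.
have ddk : delta * (2 * r) < dk.
  apply: (@le_lt_trans _ _ (dk / (4 * r) * (2 * r))).
    have dk4 : delta <= dk / (4 * r) by rewrite /delta !ge_min lexx !orbT.
    by apply: ler_wpM2r => //; rewrite mulr_ge0// ltW.
  have -> : dk / (4 * r) * (2 * r) = dk / 2 by field; rewrite gt_eqF.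
  lra.
exists delta => // s ms0.
set S := past (s + delta); set D := strip s delta.
have mD : measurable D by exact: mstrip.
pose G := g \_ S.
have G0 z : 0 <= G z by rewrite /G patchE; case: ifP.
have Gi : (leb2 R).-integrable setT (EFin \o G).
  apply: (proj1 (integrable_EFin_restrict _ _ (mpast _))); exact: integrableS gi.
set m := mass (s + delta).
have mE : m = \int[leb2 R]_z G z by rewrite /m /mass Rintegral_mkcond.
pose N1 x := \int[leb1 R]_y G (x, y).
pose N2 y := \int[leb1 R]_x G (x, y).
have N10 x : 0 <= N1 x by apply: Rintegral_ge0.
have N20 y : 0 <= N2 y by apply: Rintegral_ge0.
have N1i : (leb1 R).-integrable setT (EFin \o N1) by exact: integrable_Rfubini1.
have N2i : (leb1 R).-integrable setT (EFin \o N2) by exact: integrable_Rfubini2.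
have mN1 : m = \int[leb1 R]_x N1 x by rewrite mE Rfubini1.
have mN2 : m = \int[leb1 R]_y N2 y by rewrite mE Rfubini2.
have m0 : 0 <= m by exact: Rintegral_ge0.
have sec1 : {ae leb2 R, forall z, (leb1 R).-integrable setT (fun y => (g (z.1, y))%:E)}.
  exact: ae_fst (ae_integrable1 gi).
have sec2 : {ae leb2 R, forall z, (leb1 R).-integrable setT (fun x => (g (x, z.2))%:E)}.
  exact: ae_snd (ae_integrable2 gi).
have sec1' : {ae leb2 R, forall z, (leb1 R).-integrable setT (fun y => (G (z.1, y))%:E)}.
  exact: ae_fst (ae_integrable1 Gi).
have sec2' : {ae leb2 R, forall z, (leb1 R).-integrable setT (fun x => (G (x, z.2))%:E)}.
  exact: ae_snd (ae_integrable2 Gi).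
pose h z := k z * m + b z.2 * N1 z.1 + a z.1 * N2 z.2.
have bound : {ae leb2 R, forall z, D z -> g z <= h z}.
  have := ae_and g_le (ae_and (ae_and sec1 sec2) (ae_and sec1' sec2')).
  apply: ae_imply => z [gz [[s1 s2] [s1' s2']]] [[zS _] _].
  apply: le_trans gz _; apply: lerD; first apply: lerD; rewrite ler_wpM2l//.
  - rewrite mE /quadrant_integral [leLHS]Rintegral_mkcond.
    have mq : measurable (quadrant z) by exact: measurableX.
    apply: le_Rintegral => //.
      by apply: (proj1 (integrable_EFin_restrict _ _ mq)); exact: integrableS gi.
    move=> w _; rewrite /G !patchE; case: ifPn => [/set_mem[w1 w2]|_]; last by case: ifP.
    rewrite mem_set//; move: w1 w2; rewrite /= !in_itv/= /S /past/=.
    by move: zS; rewrite /past/=; lra.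
  - rewrite /N1 /column_integral [leLHS]Rintegral_mkcond.
    apply: le_Rintegral => //.
      by apply: (proj1 (integrable_EFin_restrict _ _ _)) => //; exact: integrableS s1.
    move=> y _; rewrite /G !patchE; case: ifPn => [/set_mem/=yz|_]; last by case: ifP.
    rewrite mem_set//; move: yz; rewrite /= !in_itv/= /S /past/=.
    by move: zS; rewrite /past/=; lra.
  - rewrite /N2 /row_integral [leLHS]Rintegral_mkcond.
    apply: le_Rintegral => //.
      by apply: (proj1 (integrable_EFin_restrict _ _ _)) => //; exact: integrableS s2.
    move=> x _; rewrite /G !patchE; case: ifPn => [/set_mem/=xz|_]; last by case: ifP.
    rewrite mem_set//; move: xz; rewrite /= !in_itv/= /S /past/=.
    by move: zS; rewrite /past/=; lra.
have hi1 : (leb2 R).-integrable setT (EFin \o (fun z => m * k z)).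
  exact: integrable_EFinZl.
have hi2 : (leb2 R).-integrable setT (EFin \o (fun z => N1 z.1 * b z.2)).
  exact: integrable_tensor.
have hi3 : (leb2 R).-integrable setT (EFin \o (fun z => a z.1 * N2 z.2)).
  exact: integrable_tensor.
have hE : h = fun z => m * k z + (N1 z.1 * b z.2 + a z.1 * N2 z.2).
  by apply/funext => z; rewrite /h; ring.
have hi23 : (leb2 R).-integrable setT (EFin \o (fun z => N1 z.1 * b z.2 + a z.1 * N2 z.2)).
  exact: (integrableD _ hi2 hi3).
have hi : (leb2 R).-integrable setT (EFin \o h).
  by rewrite hE; exact: (integrableD _ hi1 hi23).
have le1 : m <= \int[leb2 R]_(z in D) h z.
  have -> : m = \int[leb2 R]_(z in D) g z.
    rewrite mE [RHS]Rintegral_mkcond; apply: ae_eq_Rintegral => //.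
      by apply: (proj1 (integrable_EFin_restrict _ _ mD)); exact: integrableS gi.
    have := mass_eq0 ms0; apply: ae_imply => z gz.
    rewrite /G !patchE; case: ifPn => [/set_mem zS|/negP zS]; last first.
      by case: ifPn => // /set_mem[[zS' _] _]; exfalso; apply: zS; rewrite inE.
    case: ifPn => // /negP zD; have [zp|zp] := pselect (past s z); first exact: gz.
    by apply: g_box; apply/negP => zr; apply: zD; rewrite inE; split => //; split => //=;
      rewrite in_itv.
  apply: ae_le_Rintegral => //.
  - by move=> z _; rewrite /h !addr_ge0// mulr_ge0.
  - exact: integrableS gi.
  - exact: integrableS hi.
have le2 : \int[leb2 R]_(z in D) h z <= m / 2.
  have kD : \int[leb2 R]_(z in D) k z <= 6^-1.
    apply: ltW; apply: Hk => //; apply: le_lt_trans (measure_strip s d0) _.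
    by rewrite lte_fin.
  have bD x : \int[leb1 R]_(y in xsection D x) b y <= 6^-1.
    apply: ltW; apply: Hb; first exact: measurable_xsection.
    apply: (@le_lt_trans _ _ delta%:E); last by rewrite lte_fin.
    rewrite -(measure_itv s x d0); apply: le_measure; last exact: xsection_strip.
    - by rewrite inE; exact: measurable_xsection.
    - by rewrite inE.
  have aD y : \int[leb1 R]_(x in ysection D y) a x <= 6^-1.
    apply: ltW; apply: Ha; first exact: measurable_ysection.
    apply: (@le_lt_trans _ _ delta%:E); last by rewrite lte_fin.
    rewrite -(measure_itv s y d0); apply: le_measure; last exact: ysection_strip.
    - by rewrite inE; exact: measurable_ysection.
    - by rewrite inE.
  have iS f : (leb2 R).-integrable setT (EFin \o f) -> (leb2 R).-integrable D (EFin \o f).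
    by move=> fi; exact: integrableS fi.
  rewrite hE (RintegralD mD (iS _ hi1) (iS _ hi23)) (RintegralD mD (iS _ hi2) (iS _ hi3)).
  rewrite (RintegralZl _ mD (iS _ ki)).
  have l1 : m * \int[leb2 R]_(z in D) k z <= m * 6^-1 by rewrite ler_wpM2l.
  have l2 := tensor_section_le1 mD N10 b0 N1i bi bD.
  have l3 := tensor_section_le2 mD N20 a0 N2i ai aD.
  by move: l2 l3; rewrite -mN1 -mN2; lra.
by apply/eqP; rewrite eq_le m0 andbT; have := le_trans le1 le2; lra.
Qed.

(** The hypothesis [g_past] starts the induction over strips, and a width that does
    not depend on the level exhausts the plane. *)
Lemma goursat_uniqueness : {ae leb2 R, forall z, g z = 0}.
Proof.
have [delta d0 step] := mass_step.
have mass_n n : mass (n%:R * delta - 1) = 0.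
  elim: n => [|n IH].
    apply: Rintegral0_eq => z; rewrite /past/= mul0r sub0r => zs; apply: g_past.
    by apply: le_lt_trans zs _; rewrite oppr_lt0.
  by rewrite -natr1 mulrDl mul1r addrAC; exact: step.
have := ae_foralln (fun n => mass_eq0 (mass_n n)); apply: ae_imply => z gz.
apply: (gz (Num.trunc (`|z.1 + z.2 + 1| / delta)).+1); rewrite /past/= lerBrDr.
apply: le_trans (ler_norm _) _; rewrite -ler_pdivrMr//.
exact/ltW/truncnS_gt.
Qed.

End goursat.

(** * Waves in null coordinates *)

Section swap.
Context {R : realType}.
Local Notation mR := (measurableTypeR R).

Definition swap (z : R * R) : R * R := (z.2, z.1).

Let measurable_swap : measurable_fun setT (swap : mR * mR -> mR * mR).
Proof.
apply/measurable_fun_pairP; split.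
  exact: (@measurable_snd _ _ mR mR).
exact: (@measurable_fst _ _ mR mR).
Qed.

Let leb2_swap1 (E : set (mR * mR)) : measurable E ->
  leb2 R (swap @^-1` E) = ((1%:nng : {nonneg R})%:num%:E * leb2 R E)%E.
Proof. by move=> mE; rewrite mul1e; exact: leb2_swap. Qed.

Lemma integrable_swap (f : R * R -> R) : (leb2 R).-integrable setT (EFin \o f) ->
  (leb2 R).-integrable setT (EFin \o (f \o swap)).
Proof.
move=> fi.
exact: (@integrable_scaled_image _ _ (mR * mR)%type (mR * mR)%type R (leb2 R) (leb2 R) _
  measurable_swap 1%:nng leb2_swap1 _ fi).
Qed.

Lemma restrict_swap (D : set (mR * mR)) (f : R * R -> R) :
  (f \_ D) \o swap = (f \o swap) \_ (swap @^-1` D).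
Proof.
by apply/funext => z; rewrite /patch/=; congr (if _ then _ else _); apply/idP/idP; rewrite !inE.
Qed.

Let measurable_swap_preimage (D : set (mR * mR)) : measurable D -> measurable (swap @^-1` D).
Proof. by move=> mD; rewrite -[X in measurable X]setTI; exact: measurable_swap. Qed.

Lemma integrable_swap_in (D : set (mR * mR)) (f : R * R -> R) : measurable D ->
  (leb2 R).-integrable D (EFin \o f) ->
  (leb2 R).-integrable (swap @^-1` D) (EFin \o (f \o swap)).
Proof.
move=> mD fi.
apply: (proj2 (integrable_EFin_restrict (leb2 R) (f \o swap)
  (measurable_swap_preimage mD))).
rewrite -restrict_swap; apply: integrable_swap.
exact: (proj1 (integrable_EFin_restrict _ _ mD) fi).
Qed.

Lemma Rintegral_swap (D : set (mR * mR)) (f : R * R -> R) : measurable D ->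
  (leb2 R).-integrable D (EFin \o f) ->
  \int[leb2 R]_(z in swap @^-1` D) f (swap z) = \int[leb2 R]_(z in D) f z.
Proof.
move=> mD fi; have fi' := proj1 (integrable_EFin_restrict _ _ mD) fi.
rewrite Rintegral_mkcond [in RHS]Rintegral_mkcond -restrict_swap; congr fine.
have := @integral_scaled_image _ _ (mR * mR)%type (mR * mR)%type R (leb2 R) (leb2 R) _
  measurable_swap 1%:nng leb2_swap1 _ fi'.
by rewrite mul1e.
Qed.

Lemma ae_swap (P : R * R -> Prop) : {ae leb2 R, forall z, P z} ->
  {ae leb2 R, forall z, P (swap z)}.
Proof.
move=> [N [mN N0 sN]]; exists (swap @^-1` N); split.
- exact: measurable_swap_preimage.
- by rewrite leb2_swap1// [X in (_ * X)%E]N0 mule0.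
- by move=> z nP; apply: sN.
Qed.

Lemma box_swap (a b c d : R) : swap @^-1` box a b c d = box c d a b.
Proof. by apply/seteqP; split => z [z1 z2]; split. Qed.

End swap.

(** One component of a mild solution: [U] is given by the mild formula in null
    coordinates, and [p], [q] are twice its null derivatives. *)
Record null_wave (R : realType) (A B : R) (F U p q : R * R -> R)
    (phi psi : R -> R) : Prop := NullWave {
  null_source : (leb2 R).-integrable setT (EFin \o F);
  null_solution : forall x y, x < A -> y < B -> 0 < x + y ->
    U (x, y) = phi x + psi y + 4^-1 * quadrant_integral F (x, y);
  null_integrable : forall a b c d, b < A -> d < B -> 0 < a + c ->
    [/\ (leb2 R).-integrable (box a b c d) (EFin \o U),
        (leb2 R).-integrable (box a b c d) (EFin \o p) &
        (leb2 R).-integrable (box a b c d) (EFin \o q)];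
  null_weak1 : forall a b c d n m, b < A -> d < B -> 0 < a + c ->
    \int[leb2 R]_(z in box a b c d)
      (U z * (2 * (dbump a b n z.1 * bump c d m z.2))) =
    - \int[leb2 R]_(z in box a b c d) (p z * (bump a b n z.1 * bump c d m z.2));
  null_weak2 : forall a b c d n m, b < A -> d < B -> 0 < a + c ->
    \int[leb2 R]_(z in box a b c d)
      (U z * (2 * (bump a b n z.1 * dbump c d m z.2))) =
    - \int[leb2 R]_(z in box a b c d) (q z * (bump a b n z.1 * bump c d m z.2))
}.

Section null_wave.
Context {R : realType}.
Local Notation mR := (measurableTypeR R).
Implicit Types (A B : R) (F U p q : R * R -> R) (phi psi : R -> R).

Lemma null_wave_transport A B F U p q phi psi :
  null_wave A B F U p q phi psi -> weak_transport A B F U p phi psi.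
Proof.
move=> [h1 h2 h3 h4 h5]; split => // a b c d bA dB ac.
by have [] := h3 a b c d bA dB ac.
Qed.

Lemma integrable_mul_tensor (f : R * R -> R) (D : set (mR * mR)) (g h : R -> R)
    (M1 M2 : R) : measurable D ->
  measurable_fun setT (g : mR -> mR) -> measurable_fun setT (h : mR -> mR) ->
  (forall x, `|g x| <= M1) -> (forall x, `|h x| <= M2) ->
  (leb2 R).-integrable D (EFin \o f) ->
  (leb2 R).-integrable D (EFin \o (fun z => f z * (g z.1 * h z.2))).
Proof.
move=> mD mg mh gM hM fi.
have -> : (fun z => f z * (g z.1 * h z.2)) = (fun z => (g z.1 * h z.2) * f z).
  by apply/funext => z; rewrite mulrC.
apply: (integrable_mul_bounded (M := M1 * M2)) => //.
  apply: measurable_funTS; apply: measurable_funM.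
    exact: measurableT_comp mg measurable_fst.
  exact: measurableT_comp mh measurable_snd.
by move=> z _; rewrite normrM ler_pM.
Qed.

Let bump_norm (a b : R) n x : `|bump a b n x| <= 1.
Proof. by rewrite ger0_norm ?bump_ge0 ?bump_le1. Qed.

(** This reflection of space carries the statements on [p] over to [q]. *)
Lemma null_wave_swap A B F U p q phi psi :
  null_wave A B F U p q phi psi ->
  null_wave B A (F \o swap) (U \o swap) (q \o swap) (p \o swap) psi phi.
Proof.
move=> [h1 h2 h3 h4 h5].
have mb a b c d : measurable (box a b c d : set (mR * mR)) by exact: measurableX.
split.
- exact: integrable_swap.
- move=> x y xB yA xy; rewrite /= h2//; last by rewrite addrC.
  rewrite (addrC (phi y)); congr (_ + _ * _).
  have mq : measurable (quadrant (y, x)) by exact: measurableX.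
  rewrite /quadrant_integral -(Rintegral_swap mq); last exact: integrableS h1.
  by congr Rintegral; apply/seteqP; split => z [z1 z2]; split.
- move=> a b c d bB dA ac.
  have [i1 i2 i3] := h3 c d a b dA bB (eq_ind _ (fun t => 0 < t) ac _ (addrC _ _)).
  by split; rewrite -box_swap; apply: integrable_swap_in.
- move=> a b c d n m bB dA ac.
  have ca : 0 < c + a by rewrite addrC.
  have [i1 i2 i3] := h3 c d a b dA bB ca.
  have [M hM] := @dbump_bounded R a b n.
  have j1 := integrable_mul_tensor (mb c d a b) (measurable_bump c d m)
    (measurable_dbump a b n) (bump_norm c d m) hM i1.
  have j1' : (leb2 R).-integrable (box c d a b)
      (EFin \o (fun z => U z * (2 * (bump c d m z.1 * dbump a b n z.2)))).
    apply: (@eq_integrable_EFin _ _ R (leb2 R) _ _ _ _ (@integrable_EFinZl _ _ R (leb2 R) _ _ 2 (mb c d a b) j1)).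
    by apply/funext => z; ring.
  have j2 := integrable_mul_tensor (mb c d a b) (measurable_bump c d m)
    (measurable_bump a b n) (bump_norm c d m) (bump_norm a b n) i3.
  have := h5 c d a b m n dA bB ca.
  rewrite -(Rintegral_swap (mb c d a b) j1') -(Rintegral_swap (mb c d a b) j2) box_swap => E.
  rewrite (@eq_Rintegral _ _ R (leb2 R) _ (fun z => U (swap z) *
    (2 * (bump c d m (swap z).1 * dbump a b n (swap z).2)))); last first.
    by move=> z _ /=; ring.
  rewrite E; congr (- _); apply: eq_Rintegral => z _ /=; ring.
- move=> a b c d n m bB dA ac.
  have ca : 0 < c + a by rewrite addrC.
  have [i1 i2 i3] := h3 c d a b dA bB ca.
  have [M hM] := @dbump_bounded R c d m.
  have j1 := integrable_mul_tensor (mb c d a b) (measurable_dbump c d m)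
    (measurable_bump a b n) hM (bump_norm a b n) i1.
  have j1' : (leb2 R).-integrable (box c d a b)
      (EFin \o (fun z => U z * (2 * (dbump c d m z.1 * bump a b n z.2)))).
    apply: (@eq_integrable_EFin _ _ R (leb2 R) _ _ _ _ (@integrable_EFinZl _ _ R (leb2 R) _ _ 2 (mb c d a b) j1)).
    by apply/funext => z; ring.
  have j2 := integrable_mul_tensor (mb c d a b) (measurable_bump c d m)
    (measurable_bump a b n) (bump_norm c d m) (bump_norm a b n) i2.
  have := h4 c d a b m n dA bB ca.
  rewrite -(Rintegral_swap (mb c d a b) j1') -(Rintegral_swap (mb c d a b) j2) box_swap => E.
  rewrite (@eq_Rintegral _ _ R (leb2 R) _ (fun z => U (swap z) *
    (2 * (dbump c d m (swap z).1 * bump a b n (swap z).2)))); last first.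
    by move=> z _ /=; ring.
  rewrite E; congr (- _); apply: eq_Rintegral => z _ /=; ring.
Qed.

(** Since the data cancel, [transport_without_data] applies to the differences:
    their null derivatives are null integrals of the difference of the sources. *)
Lemma null_wave_sub A B F1 U1 p1 q1 F2 U2 p2 q2 phi psi :
  null_wave A B F1 U1 p1 q1 phi psi -> null_wave A B F2 U2 p2 q2 phi psi ->
  null_wave A B (fun z => F1 z - F2 z) (fun z => U1 z - U2 z)
    (fun z => p1 z - p2 z) (fun z => q1 z - q2 z) (cst 0) (cst 0).
Proof.
move=> [h1 h2 h3 h4 h5] [k1 k2 k3 k4 k5].
have mb a b c d : measurable (box a b c d : set (mR * mR)) by exact: measurableX.
split.
- exact: (integrableB _ h1 k1).
- move=> x y xA yB xy; rewrite h2// k2//.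
  have mq : measurable (quadrant (x, y)) by exact: measurableX.
  rewrite /quadrant_integral (RintegralB mq).
  + by rewrite /=; ring.
  + exact: integrableS h1.
  + exact: integrableS k1.
- move=> a b c d bA dB ac.
  have [i1 i2 i3] := h3 a b c d bA dB ac; have [j1 j2 j3] := k3 a b c d bA dB ac.
  by split; [exact: (integrableB (mb a b c d) i1 j1)|
    exact: (integrableB (mb a b c d) i2 j2)|exact: (integrableB (mb a b c d) i3 j3)].
- move=> a b c d n m bA dB ac.
  have [i1 i2 i3] := h3 a b c d bA dB ac; have [j1 j2 j3] := k3 a b c d bA dB ac.
  have [M hM] := @dbump_bounded R a b n.
  have t f := @integrable_mul_tensor f _ _ _ _ _ (mb a b c d) (measurable_bump a b n)
    (measurable_bump c d m) (bump_norm a b n) (bump_norm c d m).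
  have t' f : (leb2 R).-integrable (box a b c d) (EFin \o f) ->
      (leb2 R).-integrable (box a b c d)
        (EFin \o (fun z => f z * (2 * (dbump a b n z.1 * bump c d m z.2)))).
    move=> fi; have := integrable_mul_tensor (mb a b c d) (measurable_dbump a b n)
      (measurable_bump c d m) hM (bump_norm c d m) fi.
    move=> H; apply: (@eq_integrable_EFin _ _ R (leb2 R) _ _ _ _ (@integrable_EFinZl _ _ R (leb2 R) _ _ 2 (mb a b c d) H)).
    by apply/funext => z; ring.
  rewrite (@eq_Rintegral _ _ R (leb2 R) _ (fun z => U1 z * (2 * (dbump a b n z.1 * bump c d m z.2)) -
    U2 z * (2 * (dbump a b n z.1 * bump c d m z.2)))); last by move=> z _; rewrite mulrBl.
  rewrite [in RHS](@eq_Rintegral _ _ R (leb2 R) _ (fun z => p1 z * (bump a b n z.1 * bump c d m z.2) -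
    p2 z * (bump a b n z.1 * bump c d m z.2))); last by move=> z _; rewrite mulrBl.
  rewrite (RintegralB (mb a b c d) (t' _ i1) (t' _ j1)).
  rewrite (RintegralB (mb a b c d) (t _ i2) (t _ j2)).
  by rewrite h4// k4// opprB opprK addrC.
- move=> a b c d n m bA dB ac.
  have [i1 i2 i3] := h3 a b c d bA dB ac; have [j1 j2 j3] := k3 a b c d bA dB ac.
  have [M hM] := @dbump_bounded R c d m.
  have t f := @integrable_mul_tensor f _ _ _ _ _ (mb a b c d) (measurable_bump a b n)
    (measurable_bump c d m) (bump_norm a b n) (bump_norm c d m).
  have t' f : (leb2 R).-integrable (box a b c d) (EFin \o f) ->
      (leb2 R).-integrable (box a b c d)
        (EFin \o (fun z => f z * (2 * (bump a b n z.1 * dbump c d m z.2)))).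
    move=> fi; have := integrable_mul_tensor (mb a b c d) (measurable_bump a b n)
      (measurable_dbump c d m) (bump_norm a b n) hM fi.
    move=> H; apply: (@eq_integrable_EFin _ _ R (leb2 R) _ _ _ _ (@integrable_EFinZl _ _ R (leb2 R) _ _ 2 (mb a b c d) H)).
    by apply/funext => z; ring.
  rewrite (@eq_Rintegral _ _ R (leb2 R) _ (fun z => U1 z * (2 * (bump a b n z.1 * dbump c d m z.2)) -
    U2 z * (2 * (bump a b n z.1 * dbump c d m z.2)))); last by move=> z _; rewrite mulrBl.
  rewrite [in RHS](@eq_Rintegral _ _ R (leb2 R) _ (fun z => q1 z * (bump a b n z.1 * bump c d m z.2) -
    q2 z * (bump a b n z.1 * bump c d m z.2))); last by move=> z _; rewrite mulrBl.
  rewrite (RintegralB (mb a b c d) (t' _ i1) (t' _ j1)).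
  rewrite (RintegralB (mb a b c d) (t _ i3) (t _ j3)).
  by rewrite h5// k5// opprB opprK addrC.
Qed.

End null_wave.

(** * Backward triangles *)

Definition null_triangle (R : realType) (A B : R) :
    set (measurableTypeR R * measurableTypeR R) :=
  [set z | [/\ z.1 <= A, z.2 <= B & 0 <= z.1 + z.2]].

Section mild_to_null.
Context {R : realType}.
Local Notation mR := (measurableTypeR R).
Variables (x0 L T0 t x : R).
Let K := trapezoid x0 L T0.
Hypothesis Ktx : K (t, x).

Let A := t + x.
Let B := t - x.

Lemma trapezoid_past (z : R * R) : 0 <= z.1 -> z.1 + z.2 <= A -> z.1 - z.2 <= B -> K z.
Proof.
move: Ktx; rewrite /K /trapezoid/= /A /B => -[/andP[h1 h2] /andP[h3 h4]] h5 h6 h7.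
by split; apply/andP; split; lra.
Qed.

(** The box lies in the open triangle, which is an open subset of [K]. *)
Lemma diamond_trapezoid a b c d : b < A -> d < B -> 0 < a + c ->
  diamond a b c d `<=` K°.
Proof.
move=> bA dB ac.
pose O : set (R * R) := [set z | 0 < z.1] `&` [set z | z.1 + z.2 < A] `&` [set z | z.1 - z.2 < B].
have c1 : continuous (fun z : R * R => z.1) by move=> z; exact: cvg_fst.
have c2 : continuous (fun z : R * R => z.1 + z.2).
  by move=> z; apply: cvgD; [exact: cvg_fst|exact: cvg_snd].
have c3 : continuous (fun z : R * R => z.1 - z.2).
  by move=> z; apply: cvgB; [exact: cvg_fst|exact: cvg_snd].
have oO : open O.
  apply: openI; first apply: openI.
  - exact: (open_comp (fun z _ => c1 z) (@open_gt R 0)).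
  - exact: (open_comp (fun z _ => c2 z) (@open_lt R A)).
  - exact: (open_comp (fun z _ => c3 z) (@open_lt R B)).
have OK : O `<=` K.
  by move=> z [[/= h1 h2] h3]; apply: trapezoid_past; exact: ltW.
move=> z; rewrite /diamond /box/= !in_itv/= => -[/andP[h1 h2] /andP[h3 h4]].
have OKi : O `<=` K° by rewrite -open_subsetE.
by apply: OKi; split; [split|]; rewrite /=; lra.
Qed.

Lemma backward_triangleE (t' x' : R) : @of_null R @^-1` backward_triangle t' x' =
  null_triangle (t' + x') (t' - x').
Proof.
apply/seteqP; split => z; rewrite /null_triangle /backward_triangle/=.
  by move=> [/andP[h1 h2] /andP[h3 h4]]; split; lra.
by move=> [h1 h2 h3]; split; apply/andP; split; lra.
Qed.

Lemma measurable_backward_triangle t' x' :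
  measurable (backward_triangle t' x' : set (mR * mR)).
Proof.
have m1 := @measurable_fst _ _ mR mR; have m2 := @measurable_snd _ _ mR mR.
have mc (c : R) : measurable_fun setT (cst c : mR * mR -> mR) by exact: measurable_cst.
have -> : backward_triangle t' x' =
    [set z : mR * mR | 0 <= z.1] `&` [set z | z.1 <= t'] `&`
    [set z | x' - t' + z.1 <= z.2] `&` [set z | z.2 <= x' + t' - z.1].
  apply/seteqP; split => z; rewrite /backward_triangle/=.
    by move=> [/andP[h1 h2] /andP[h3 h4]].
  by move=> [[[h1 h2] h3] h4]; split; apply/andP.
repeat apply: measurableI; apply: measurable_set_le => //.
  exact: measurable_funD.
exact: measurable_funB.
Qed.

Lemma Rintegral_backward_triangle t' x' (h : R * R -> R) :
  (leb2 R).-integrable (backward_triangle t' x') (EFin \o h) ->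
  \int[leb2 R]_(z in backward_triangle t' x') h z =
  \int[leb1 R]_(s in `[0, t'])
    \int[leb1 R]_(y in `[x' - t' + s, x' + t' - s]) h (s, y).
Proof.
move=> hi; have mb := measurable_backward_triangle t' x'.
rewrite Rintegral_mkcond Rfubini1; last exact: (proj1 (integrable_EFin_restrict _ _ mb)).
rewrite [RHS]Rintegral_mkcond; apply: eq_Rintegral => s _.
rewrite [RHS]patchE; case: ifPn => [/set_mem/=|/negP sn].
  rewrite in_itv/= => /andP[s0 st]; rewrite [RHS]Rintegral_mkcond; congr Rintegral.
  apply/funext => y; rewrite !patchE; congr (if _ then _ else _); apply/idP/idP.
    by move/set_mem => [_ /= h1]; rewrite inE/= in_itv.
  by move/set_mem; rewrite /= in_itv/= => h1; rewrite inE; split => //=; rewrite s0.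
apply: Rintegral0_eq => y _; rewrite patchE memNset// => -[/= h1 _].
by apply: sn; rewrite inE/= in_itv.
Qed.

End mild_to_null.

(** * Mild solutions in null coordinates *)

Section mild_component.
Context {R : realType}.
Local Notation mR := (measurableTypeR R).
Variables (x0 L T0 t x : R).
Let K := trapezoid x0 L T0.
Hypothesis T0_ge0 : 0 <= T0.
Hypothesis Ktx : K (t, x).
Let A := t + x.
Let B := t - x.
Variables (n : nat) (u0 v0 : R -> 'rV[R]_n) (u ut ux F : R * R -> 'rV[R]_n) (i : 'I_n).
Hypothesis v0_L1 : L1 (leb1 R) (xsection K 0) v0.
Hypothesis ut_weak : weak_derivative K° (dt R) u ut.
Hypothesis ux_weak : weak_derivative K° (dx R) u ux.
Hypothesis mild : forall t x, K (t, x) ->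
  L1 (leb2 R) (backward_triangle t x) F /\
  u (t, x) =
    2^-1 *: (u0 (x + t) + u0 (x - t))
    + 2^-1 *: vint (leb1 R) `[x - t, x + t] v0
    + 2^-1 *: vint (leb1 R) `[0, t] (fun tau =>
        vint (leb1 R) `[x - t + tau, x + t - tau] (fun y => F (tau, y))).

Definition null_component (w : R * R -> 'rV[R]_n) (z : R * R) : R := w (of_null z) 0 i.

Definition null_forcing : R * R -> R := null_component F \_ (null_triangle A B).

(** In the mild formula [v0] is integrated over an interval depending on both null
    variables; subtracting the integrals from the left end [- B] of the base
    separates them. *)
Definition right_data (y : R) : R :=
  2^-1 * u0 y 0 i + 2^-1 * \int[leb1 R]_(s in `[- B, y]) v0 s 0 i.

Definition left_data (y : R) : R :=
  2^-1 * u0 (- y) 0 i - 2^-1 * \int[leb1 R]_(s in `[- B, - y]) v0 s 0 i.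

Let integrable_null_forcing :
  (leb2 R).-integrable setT (EFin \o null_forcing).
Proof.
have [FL _] := mild Ktx.
have := integrable_of_null (measurable_backward_triangle t x) (FL i).
rewrite backward_triangleE => H.
apply: (proj1 (integrable_EFin_restrict _ _ _)); last exact: H.
rewrite -backward_triangleE; apply: measurable_of_null_preimage.
exact: measurable_backward_triangle.
Qed.

Let initial_interval : (`[- B, A] : set mR) `<=` xsection K 0.
Proof.
move=> y; rewrite /xsection/= in_itv/= inE /K /trapezoid/= lexx T0_ge0.
move: Ktx; rewrite /K /trapezoid /A /B/= => -[/andP[h1 h2] /andP[h3 h4]] /andP[h5 h6].
by split => //; apply/andP; split; lra.
Qed.

Let integrable_v0 (c d : R) : - B <= c -> d <= A ->
  (leb1 R).-integrable `[c, d] (EFin \o (fun s => v0 s 0 i)).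
Proof.
move=> Bc dA; have := v0_L1 i.
have K0E : xsection K 0 = (`[x0 - L, x0 + L]%classic : set mR).
  apply/seteqP; split => y; rewrite /xsection/= in_itv/= inE /K /trapezoid/=.
    by rewrite addr0 subr0 => -[].
  by rewrite addr0 subr0 lexx T0_ge0.
rewrite K0E; apply: integrableS => //; rewrite -K0E.
apply: subset_trans initial_interval => y; rewrite /= !in_itv/= => /andP[cy yd].
by apply/andP; split; [exact: le_trans cy|exact: le_trans dA].
Qed.

Let solution_formula (y z : R) : y < A -> z < B -> 0 < y + z ->
  null_component u (y, z) =
  right_data y + left_data z + 4^-1 * quadrant_integral null_forcing (y, z).
Proof.
move=> yA zB yz.
pose t' := (y + z) / 2; pose x' := (y - z) / 2.
have Kt'x' : K (t', x').
  by apply: (trapezoid_past Ktx) => /=; rewrite /t' /x' -/A -/B; lra.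
have [FL E] := mild Kt'x'.
rewrite /null_component /of_null/= -/t' -/x' E !mxE.
have e1 : x' + t' = y by rewrite /x' /t'; field.
have e2 : x' - t' = - z by rewrite /x' /t'; field.
have e3 : t' + x' = y by rewrite addrC.
have e4 : t' - x' = z by rewrite /x' /t'; field.
rewrite e1 e2.
have dbl : \int[leb1 R]_(s in `[0, t'])
    (vint (leb1 R) `[- z + s, y - s] (fun v => F (s, v))) 0 i =
    2^-1 * quadrant_integral null_forcing (y, z).
  transitivity (\int[leb2 R]_(w in backward_triangle t' x') F w 0 i).
    rewrite Rintegral_backward_triangle; last exact: FL.
    by apply: eq_Rintegral => s _; rewrite mxE e1 e2.
  rewrite Rintegral_of_null; last 2 first.
  - exact: measurable_backward_triangle.
  - exact: FL.
  congr (_ * _); rewrite backward_triangleE e3 e4 /quadrant_integral.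
  rewrite Rintegral_mkcond [RHS]Rintegral_mkcond; congr Rintegral; apply/funext => w.
  rewrite /null_forcing !patchE; case: ifPn => [/set_mem[h1 h2 h3]|/negP wN].
    have q1 : w \in quadrant (y, z) by rewrite inE; split; rewrite /= in_itv.
    have q2 : w \in null_triangle A B by rewrite inE; split => //; lra.
    by rewrite q1 q2.
  case: ifPn => // /set_mem[/= w1 w2]; rewrite memNset// => -[h1 h2 h3]; apply: wN.
  by rewrite inE; split => //; move: w1 w2; rewrite !in_itv.
rewrite dbl.
have zBy : - B <= - z by lra.
have v0_split : \int[leb1 R]_(s in `[- z, y]) v0 s 0 i =
    \int[leb1 R]_(s in `[- B, y]) v0 s 0 i - \int[leb1 R]_(s in `[- B, - z]) v0 s 0 i.
  rewrite Rintegral_itvB ?bnd_simp//; last 2 first.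
  - by apply: integrable_v0 => //; exact: ltW.
  - lra.
  rewrite Rintegral_itv_obnd_cbnd//.
  have := integrable_v0 zBy (ltW yA); apply: integrableS => //.
  exact: subset_itv_oc_cc.
by rewrite v0_split /right_data /left_data; field.
Qed.

Section on_a_diamond.
Variables (a b c d : R) (m1 m2 : nat).
Hypotheses (bA : b < A) (dB : d < B) (ac : 0 < a + c).

Let D : set (mR * mR) := diamond a b c d.

Let DK : D `<=` K°. Proof. exact: (diamond_trapezoid Ktx). Qed.

Let mbox : measurable (box a b c d : set (mR * mR)). Proof. exact: measurableX. Qed.

Let mD : measurable D.
Proof. by rewrite -[D]setTI; exact: measurable_to_null. Qed.

Let DE : @of_null R @^-1` D = box a b c d.
Proof. by apply/seteqP; split => z; rewrite /D /diamond/= of_nullK. Qed.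

Let DL (w : R * R -> 'rV[R]_n) : L1loc2 K° w ->
  (leb2 R).-integrable D (EFin \o (fun z => w z 0 i)).
Proof. by move=> H; exact: (H _ (@compact_diamond R a b c d) DK i). Qed.

Let uL : L1loc2 K° u. Proof. by case: ut_weak. Qed.
Let utL : L1loc2 K° ut. Proof. by case: ut_weak. Qed.
Let uxL : L1loc2 K° ux. Proof. by case: ux_weak. Qed.

Lemma integrable_null_component_box w : L1loc2 K° w ->
  (leb2 R).-integrable (box a b c d) (EFin \o null_component w).
Proof. by move=> /DL/(integrable_of_null mD); rewrite DE. Qed.

Let mul_i (w : R * R -> R) (g h : R -> R) (M1 M2 : R) :
  measurable_fun setT (g : mR -> mR) -> measurable_fun setT (h : mR -> mR) ->
  (forall y, `|g y| <= M1) -> (forall y, `|h y| <= M2) ->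
  (leb2 R).-integrable D (EFin \o w) ->
  (leb2 R).-integrable D (EFin \o (fun z => w z * (g (z.1 + z.2) * h (z.1 - z.2)))).
Proof.
move=> mg mh gM hM wi.
have -> : (fun z => w z * (g (z.1 + z.2) * h (z.1 - z.2))) =
    (fun z => (g (z.1 + z.2) * h (z.1 - z.2)) * w z).
  by apply/funext => z; rewrite mulrC.
apply: (integrable_mul_bounded (M := M1 * M2)) => //.
  apply: measurable_funTS; apply: measurable_funM.
    apply: (measurableT_comp mg).
    exact: (measurable_funD (@measurable_fst _ _ mR mR) (@measurable_snd _ _ mR mR)).
  apply: (measurableT_comp mh).
  exact: (measurable_funB (@measurable_fst _ _ mR mR) (@measurable_snd _ _ mR mR)).
by move=> z _; rewrite normrM ler_pM.
Qed.

Let to_box (w : R * R -> R) (g h : R -> R) (M1 M2 : R) :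
  measurable_fun setT (g : mR -> mR) -> measurable_fun setT (h : mR -> mR) ->
  (forall y, `|g y| <= M1) -> (forall y, `|h y| <= M2) ->
  (leb2 R).-integrable D (EFin \o w) ->
  \int[leb2 R]_(z in D) (w z * (g (z.1 + z.2) * h (z.1 - z.2))) =
  2^-1 * \int[leb2 R]_(z in box a b c d) (w (of_null z) * (g z.1 * h z.2)).
Proof.
move=> mg mh gM hM wi; rewrite (Rintegral_of_null mD (mul_i mg mh gM hM wi)) DE.
congr (_ * _); apply: eq_Rintegral => z _.
by have := of_nullK z; case: z => z1 z2 /= [-> ->].
Qed.

Let bump_norm (p q : R) k y : `|bump p q k y| <= 1.
Proof. by rewrite ger0_norm ?bump_ge0 ?bump_le1. Qed.

Let alpha := bump a b m1.
Let alpha' := dbump a b m1.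
Let beta := bump c d m2.
Let beta' := dbump c d m2.
Let E1 := \int[leb2 R]_(z in D) (u z 0 i * (alpha' (z.1 + z.2) * beta (z.1 - z.2))).
Let E2 := \int[leb2 R]_(z in D) (u z 0 i * (alpha (z.1 + z.2) * beta' (z.1 - z.2))).

(* The derivative of a tensor in the direction [v] is a combination of the tensors
   integrated in [E1] and [E2]; the directions of [t] and [x] give their sum and
   their difference. *)
Let weak_tensor (v : R * R) (w : R * R -> 'rV[R]_n) : weak_derivative K° v u w ->
  (v.1 + v.2) * E1 + (v.1 - v.2) * E2 =
  - \int[leb2 R]_(z in D) (w z 0 i * (alpha (z.1 + z.2) * beta (z.1 - z.2))).
Proof.
move=> [_ wL H].
have [Ma hMa] := @dbump_bounded R a b m1; have [Mb hMb] := @dbump_bounded R c d m2.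
have i1 := mul_i (measurable_dbump a b m1) (measurable_bump c d m2) hMa (bump_norm c d m2) (DL uL).
have i2 := mul_i (measurable_bump a b m1) (measurable_dbump c d m2) (bump_norm a b m1) hMb (DL uL).
have := H _ (test_function_tensor m1 m2 DK) i.
have out z : ~ D z -> alpha (z.1 + z.2) * beta (z.1 - z.2) = 0 /\
    (alpha' (z.1 + z.2) * beta (z.1 - z.2) = 0 /\
     alpha (z.1 + z.2) * beta' (z.1 - z.2) = 0).
  rewrite /D /diamond /box /to_null/= !in_itv/= /alpha /alpha' /beta /beta' => zD.
  have [h1|h1] := boolP (a < z.1 + z.2 < b); last by rewrite bump_out// dbump_out// !mul0r.
  have [h2|h2] := boolP (c < z.1 - z.2 < d).
    exfalso; apply: zD; move: h1 h2 => /andP[p1 p2] /andP[p3 p4].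
    by rewrite !ltW.
  by rewrite (bump_out _ h2) (dbump_out _ h2) !mulr0.
have sup (f : R * R -> R) : (forall z, ~ D z -> f z = 0) ->
    \int[leb2 R]_(z in K°) f z = \int[leb2 R]_(z in D) f z.
  move=> DF; apply: Rintegral_support => z; first by move=> _; exact: DF.
  by move=> /DK zK /(_ zK).
rewrite [X in _ = - X -> _]sup; last by move=> z /out[zE _]; rewrite /tensor -/alpha -/beta zE mulr0.
move=> <-; rewrite [RHS](_ : _ = \int[leb2 R]_(z in K°)
  ((v.1 + v.2) * (u z 0 i * (alpha' (z.1 + z.2) * beta (z.1 - z.2))) +
   (v.1 - v.2) * (u z 0 i * (alpha (z.1 + z.2) * beta' (z.1 - z.2))))); last first.
  by apply: eq_Rintegral => z _; rewrite derive_tensor -/alpha -/alpha' -/beta -/beta'; ring.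
rewrite sup; last by move=> z /out[_ [-> ->]]; rewrite !mulr0 addr0.
rewrite (RintegralD mD); last 2 first.
- exact: integrable_EFinZl.
- exact: integrable_EFinZl.
by rewrite (RintegralZl _ mD i1) (RintegralZl _ mD i2).
Qed.

Lemma null_weak_tensor :
  (\int[leb2 R]_(z in box a b c d)
      (null_component u z * (2 * (dbump a b m1 z.1 * bump c d m2 z.2))) =
    - \int[leb2 R]_(z in box a b c d)
      (null_component (ut + ux) z * (bump a b m1 z.1 * bump c d m2 z.2))) /\
  (\int[leb2 R]_(z in box a b c d)
      (null_component u z * (2 * (bump a b m1 z.1 * dbump c d m2 z.2))) =
    - \int[leb2 R]_(z in box a b c d)
      (null_component (ut - ux) z * (bump a b m1 z.1 * bump c d m2 z.2))).
Proof.
have [Ma hMa] := @dbump_bounded R a b m1; have [Mb hMb] := @dbump_bounded R c d m2.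
have ma := measurable_bump a b m1; have mb := measurable_bump c d m2.
have ma' := measurable_dbump a b m1; have mb' := measurable_dbump c d m2.
have na := bump_norm a b m1; have nb := bump_norm c d m2.
have w1 := weak_tensor ut_weak; have w2 := weak_tensor ux_weak.
rewrite /= (to_box ma mb na nb (DL utL)) in w1.
rewrite /= (to_box ma mb na nb (DL uxL)) in w2.
have e1 : E1 = 2^-1 * \int[leb2 R]_(z in box a b c d)
    (null_component u z * (alpha' z.1 * beta z.2)) := to_box ma' mb hMa nb (DL uL).
have e2 : E2 = 2^-1 * \int[leb2 R]_(z in box a b c d)
    (null_component u z * (alpha z.1 * beta' z.2)) := to_box ma mb' na hMb (DL uL).
have jt := integrable_mul_tensor mbox ma mb na nb (integrable_null_component_box utL).
have jx := integrable_mul_tensor mbox ma mb na nb (integrable_null_component_box uxL).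
have j1 := integrable_mul_tensor mbox ma' mb hMa nb (integrable_null_component_box uL).
have j2 := integrable_mul_tensor mbox ma mb' na hMb (integrable_null_component_box uL).
split.
- rewrite (@eq_Rintegral _ _ R (leb2 R) _ (fun z =>
    2 * (null_component u z * (alpha' z.1 * beta z.2)))); last by move=> z _; rewrite mulrCA.
  rewrite (RintegralZl _ mbox j1).
  rewrite [in RHS](@eq_Rintegral _ _ R (leb2 R) _ (fun z =>
    null_component ut z * (alpha z.1 * beta z.2) +
    null_component ux z * (alpha z.1 * beta z.2))); last first.
    by move=> z _; rewrite /null_component !mxE mulrDl.
  rewrite (RintegralD mbox jt jx); move: w1 w2; rewrite /null_component; lra.
- rewrite (@eq_Rintegral _ _ R (leb2 R) _ (fun z =>
    2 * (null_component u z * (alpha z.1 * beta' z.2)))); last by move=> z _; rewrite mulrCA.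
  rewrite (RintegralZl _ mbox j2).
  rewrite [in RHS](@eq_Rintegral _ _ R (leb2 R) _ (fun z =>
    null_component ut z * (alpha z.1 * beta z.2) -
    null_component ux z * (alpha z.1 * beta z.2))); last first.
    by move=> z _; rewrite /null_component !mxE mulrBl.
  rewrite (RintegralB mbox jt jx); move: w1 w2; rewrite /null_component; lra.
Qed.

End on_a_diamond.

Lemma mild_null_wave : null_wave A B null_forcing (null_component u)
  (null_component (ut + ux)) (null_component (ut - ux)) right_data left_data.
Proof.
have uL : L1loc2 K° u by case: ut_weak.
have utL : L1loc2 K° ut by case: ut_weak.
have uxL : L1loc2 K° ux by case: ux_weak.
split => //.
- move=> a b c d bA dB ac.
  have mb : measurable (box a b c d : set (mR * mR)) by exact: measurableX.
  have i1 := integrable_null_component_box bA dB ac utL.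
  have i2 := integrable_null_component_box bA dB ac uxL.
  split; first exact: integrable_null_component_box.
    apply: (@eq_integrable_EFin _ _ R (leb2 R) _ _ _ _ (integrableD mb i1 i2)).
    by apply/funext => z; rewrite /null_component !mxE.
  apply: (@eq_integrable_EFin _ _ R (leb2 R) _ _ _ _ (integrableB mb i1 i2)).
  by apply/funext => z; rewrite /null_component !mxE.
- by move=> a b c d n1 n2 bA dB ac; have [] := null_weak_tensor n1 n2 bA dB ac.
- by move=> a b c d n1 n2 bA dB ac; have [] := null_weak_tensor n1 n2 bA dB ac.
Qed.

End mild_component.

(** * The nonlinearity *)

Section coefficients.
Context {R : realType} {n : nat}.
Implicit Types (v w : 'rV[R]_n).

(** Unlike the sup norm, the sum over the components commutes with integrals and
    splits products of components. *)
Definition ell1 v : R := \sum_(i < n) `|v 0 i|.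

Lemma ell1_ge0 v : 0 <= ell1 v. Proof. exact: sumr_ge0. Qed.

Lemma norm_le_ell1 v : `|v| <= ell1 v.
Proof.
rewrite [leLHS](_ : _ = mx_norm v)// mx_normE.
have l0 : 0 <= ell1 v := ell1_ge0 v.
rewrite -[leRHS]/((NngNum l0)%:num) num_le; apply/bigmax_leP; split => //.
move=> [i0 i] _; rewrite -num_le/= ord1 /ell1 (bigD1 i)//= lerDl.
by apply: sumr_ge0.
Qed.

Lemma entry_le_norm (m k : nat) (A : 'M[R]_(m, k)) i j : `|A i j| <= `|A|.
Proof.
rewrite [leRHS](_ : _ = mx_norm A)// mx_normE.
rewrite -[leLHS]nngE num_le.
exact: (@le_bigmax _ _ _ _ (fun ij : 'I_m * 'I_k => `|A ij.1 ij.2|%:nng) (i, j)).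
Qed.

Lemma coefficient_bound (M : set 'rV[R]_n)
    (Gamma : 'I_n -> 'I_n -> 'rV[R]_n -> 'rV[R]_n) (P : 'rV[R]_n -> 'M[R]_n) :
  wave_map_coefficients M Gamma P ->
  exists2 C : R, 0 <= C & [/\ forall j k p i, `|Gamma j k p 0 i| <= C,
    forall j k p p' i, `|Gamma j k p 0 i - Gamma j k p' 0 i| <= C * ell1 (p - p') &
    forall p p' j i, `|P p j i - P p' j i| <= C * ell1 (p - p')].
Proof.
move=> [HG [_ HP] _ _].
have H1 : \forall C \near +oo, forall jk : 'I_n * 'I_n,
    (forall p, `|Gamma jk.1 jk.2 p| <= C) /\
    (forall p p', `|Gamma jk.1 jk.2 p - Gamma jk.1 jk.2 p'| <= C * `|p - p'|).
  apply: filter_forall => -[j k] /=.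
  have [h1 h2] := HG j k.
  by apply: (@filterS2 _ (pinfty_nbhs R) _ _ _ _ _ h1 h2) => C /= {}h1 {}h2; split => [p|p p']; [exact: h1|exact: (h2 (p, p'))].
have H2 : \forall C \near +oo, forall p p', `|P p - P p'| <= C * `|p - p'|.
  by apply: (@filterS _ (pinfty_nbhs R) _ _ _ _ HP) => C /= {}HP p p'; exact: (HP (p, p')).
have [C [C0 [CG CP]]] : exists C : R, 0 <= C /\ ((forall jk : 'I_n * 'I_n,
    (forall p, `|Gamma jk.1 jk.2 p| <= C) /\
    (forall p p', `|Gamma jk.1 jk.2 p - Gamma jk.1 jk.2 p'| <= C * `|p - p'|)) /\
    forall p p', `|P p - P p'| <= C * `|p - p'|).
  near (pinfty_nbhs R) => C; exists C; split; last split; last by near: C.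
    by near: C; exact: nbhs_pinfty_ge.
  by near: C.
have lip (m k : nat) (X Y : 'M[R]_(m, k)) p p' i j :
    `|X - Y| <= C * `|p - p'| -> `|X i j - Y i j| <= C * ell1 (p - p').
  move=> XY; have -> : X i j - Y i j = (X - Y) i j by rewrite !mxE.
  apply: le_trans (entry_le_norm _ _ _) (le_trans XY _).
  by rewrite ler_wpM2l// norm_le_ell1.
exists C => //; split.
- by move=> j k p i; apply: le_trans (entry_le_norm _ _ _) _; exact: (CG (j, k)).1.
- by move=> j k p p' i; apply: lip; exact: (CG (j, k)).2.
- by move=> p p' j i; apply: lip.
Unshelve. all: by end_near. Qed.

Lemma sum_tensor (a b : 'I_n -> R) :
  \sum_j \sum_k a j * b k = (\sum_j a j) * (\sum_k b k).
Proof. by rewrite big_distrlr. Qed.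

(** By the null form structure the quadratic term is half the sum of
    [p_j q_k + q_j p_k], with [p] the sum and [q] the difference of the
    derivatives; its increment is expanded so that each term keeps one factor of
    each kind. *)
Lemma wave_map_rhs_lipschitz (Gamma : 'I_n -> 'I_n -> 'rV[R]_n -> 'rV[R]_n)
    (P : 'rV[R]_n -> 'M[R]_n) (C : R) (f u ut ux v vt vx : R * R -> 'rV[R]_n) z i :
  (forall j k p i, `|Gamma j k p 0 i| <= C) ->
  (forall j k p p' i, `|Gamma j k p 0 i - Gamma j k p' 0 i| <= C * ell1 (p - p')) ->
  (forall p p' j i, `|P p j i - P p' j i| <= C * ell1 (p - p')) ->
  `|wave_map_rhs Gamma P f u ut ux z 0 i - wave_map_rhs Gamma P f v vt vx z 0 i| <=
  C * (ell1 (u z - v z) * (ell1 ((ut + ux) z) * ell1 ((ut - ux) z) + ell1 (f z)) +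
       ell1 ((ut + ux) z - (vt + vx) z) * ell1 ((ut - ux) z) +
       ell1 ((vt + vx) z) * ell1 ((ut - ux) z - (vt - vx) z)).
Proof.
move=> CG LG LP.
have C0 : 0 <= C * ell1 (u z - v z).
  by apply: le_trans (normr_ge0 _) (LP (u z) (v z) i i).
pose p1 j := `|(ut + ux) z 0 j|; pose q1 j := `|(ut - ux) z 0 j|.
pose p2 j := `|(vt + vx) z 0 j|.
pose dp j := `|((ut + ux) z - (vt + vx) z) 0 j|.
pose dq j := `|((ut - ux) z - (vt - vx) z) 0 j|.
pose w := ell1 (u z - v z).
have step j k : `|(ut z 0 j * ut z 0 k - ux z 0 j * ux z 0 k) * Gamma j k (u z) 0 i -
    (vt z 0 j * vt z 0 k - vx z 0 j * vx z 0 k) * Gamma j k (v z) 0 i| <=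
    2^-1 * (C * w) * (p1 j * q1 k + q1 j * p1 k) +
    2^-1 * C * ((dp j * q1 k + p2 j * dq k) + (q1 j * dp k + dq j * p2 k)).
  pose D := 2^-1 * (((ut + ux) z - (vt + vx) z) 0 j * (ut - ux) z 0 k +
     (vt + vx) z 0 j * ((ut - ux) z - (vt - vx) z) 0 k +
     ((ut - ux) z 0 j * ((ut + ux) z - (vt + vx) z) 0 k +
      ((ut - ux) z - (vt - vx) z) 0 j * (vt + vx) z 0 k)).
  pose E := 2^-1 * ((ut + ux) z 0 j * (ut - ux) z 0 k + (ut - ux) z 0 j * (ut + ux) z 0 k).
  have -> : (ut z 0 j * ut z 0 k - ux z 0 j * ux z 0 k) * Gamma j k (u z) 0 i -
    (vt z 0 j * vt z 0 k - vx z 0 j * vx z 0 k) * Gamma j k (v z) 0 i =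
    E * (Gamma j k (u z) 0 i - Gamma j k (v z) 0 i) + D * Gamma j k (v z) 0 i.
    by rewrite /D /E !mxE; field.
  apply: le_trans (ler_normD _ _) _; apply: lerD.
    rewrite normrM [leRHS](_ : _ = 2^-1 * (p1 j * q1 k + q1 j * p1 k) * (C * w)); last by ring.
    apply: ler_pM => //.
    rewrite /E normrM ger0_norm ?invr_ge0// ler_pM2l ?invr_gt0//.
    by apply: le_trans (ler_normD _ _) _; rewrite !normrM.
  rewrite normrM [leRHS](_ : _ =
    2^-1 * ((dp j * q1 k + p2 j * dq k) + (q1 j * dp k + dq j * p2 k)) * C); last by ring.
  apply: ler_pM => //.
  rewrite /D normrM ger0_norm ?invr_ge0// ler_pM2l ?invr_gt0//.
  apply: le_trans (ler_normD _ _) (lerD _ _);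
    by apply: le_trans (ler_normD _ _) _; rewrite !normrM.
have stepP j : `|f z 0 j * P (u z) j i - f z 0 j * P (v z) j i| <= C * w * `|f z 0 j|.
  by rewrite -mulrBr normrM mulrC ler_wpM2r.
have coordE (u' ut' ux' : R * R -> 'rV[R]_n) : wave_map_rhs Gamma P f u' ut' ux' z 0 i =
    (\sum_j \sum_k (ut' z 0 j * ut' z 0 k - ux' z 0 j * ux' z 0 k) * Gamma j k (u' z) 0 i)
    + \sum_j f z 0 j * P (u' z) j i.
  rewrite /wave_map_rhs !mxE; congr (_ + _).
  rewrite summxE; apply: eq_bigr => j _; rewrite summxE; apply: eq_bigr => k _.
  by rewrite mxE.
rewrite !coordE opprD addrACA -!sumrB; apply: le_trans (ler_normD _ _) _.
have S1 : `|\sum_j (\sum_k (ut z 0 j * ut z 0 k - ux z 0 j * ux z 0 k) * Gamma j k (u z) 0 i -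
    \sum_k (vt z 0 j * vt z 0 k - vx z 0 j * vx z 0 k) * Gamma j k (v z) 0 i)| <=
    \sum_j \sum_k (2^-1 * (C * w) * (p1 j * q1 k + q1 j * p1 k) +
    2^-1 * C * ((dp j * q1 k + p2 j * dq k) + (q1 j * dp k + dq j * p2 k))).
  apply: le_trans (ler_norm_sum _ _ _) _; apply: ler_sum => j _.
  by rewrite -sumrB; apply: le_trans (ler_norm_sum _ _ _) _; apply: ler_sum.
have S2 : `|\sum_j (f z 0 j * P (u z) j i - f z 0 j * P (v z) j i)| <=
    \sum_j C * w * `|f z 0 j|.
  by apply: le_trans (ler_norm_sum _ _ _) _; apply: ler_sum.
apply: le_trans (lerD S1 S2) _.
have E1 : \sum_j \sum_k (2^-1 * (C * w) * (p1 j * q1 k + q1 j * p1 k) +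
    2^-1 * C * ((dp j * q1 k + p2 j * dq k) + (q1 j * dp k + dq j * p2 k))) =
    2^-1 * (C * w) * (\sum_j \sum_k p1 j * q1 k + \sum_j \sum_k q1 j * p1 k) +
    2^-1 * C * (((\sum_j \sum_k dp j * q1 k) + \sum_j \sum_k p2 j * dq k) +
     ((\sum_j \sum_k q1 j * dp k) + \sum_j \sum_k dq j * p2 k)).
  rewrite -!big_split/= !mulr_sumr -big_split/=; apply: eq_bigr => j _.
  by rewrite -!big_split/= !mulr_sumr -big_split/=.
rewrite E1 !sum_tensor -mulr_sumr -/(ell1 (f z)).
rewrite -[\sum_j p1 j]/(ell1 _) -[\sum_j q1 j]/(ell1 _) -[\sum_j p2 j]/(ell1 _).
rewrite -[\sum_j dp j]/(ell1 _) -[\sum_j dq j]/(ell1 _) -/w.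
by rewrite le_eqVlt; apply/orP; left; apply/eqP; field.
Qed.

End coefficients.

(** * Uniqueness for systems of waves *)

Section sums_of_integrals.
Context d (T : measurableType d) (R : realType) (mu : {measure set T -> \bar R}).
Variables (n : nat) (D : set T) (f : 'I_n -> T -> R).
Hypotheses (mD : measurable D)
  (fi : forall i, mu.-integrable D (EFin \o f i)).

Lemma integrable_EFin_norm (h : T -> R) : mu.-integrable D (EFin \o h) ->
  mu.-integrable D (EFin \o (fun x => `|h x|)).
Proof. by move=> hi; exact: (integrable_norm hi). Qed.

Lemma integrable_EFin_sum : mu.-integrable D (EFin \o (fun x => \sum_i f i x)).
Proof.
have := @integrable_sum _ _ _ mu _ mD _ (index_enum _) xpredT (fun i => EFin \o f i) (fun i _ => fi i).
by congr (_.-integrable _ _); apply/funext => x /=; rewrite sumEFin.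
Qed.

End sums_of_integrals.

Lemma Rintegral_sum d (T : measurableType d) (R : realType)
    (mu : {measure set T -> \bar R}) (n : nat) (D : set T) (f : 'I_n -> T -> R) :
  measurable D -> (forall i, mu.-integrable D (EFin \o f i)) ->
  \int[mu]_(x in D) (\sum_i f i x) = \sum_i \int[mu]_(x in D) f i x.
Proof.
move=> mD; elim: n f => [|n IH] f fi.
  by rewrite big_ord0; apply: Rintegral0_eq => x _; rewrite big_ord0.
rewrite (@eq_Rintegral _ _ R mu _ (fun x => f ord0 x + \sum_i f (lift ord0 i) x)); last first.
  by move=> x _; rewrite big_ord_recl.
by rewrite RintegralD// ?IH ?big_ord_recl//; exact: integrable_EFin_sum.
Qed.

Lemma sum_normr_Rintegral_le d (T : measurableType d) (R : realType)
    (mu : {measure set T -> \bar R}) (n : nat) (D : set T) (f : 'I_n -> T -> R) :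
  measurable D -> (forall i, mu.-integrable D (EFin \o f i)) ->
  \sum_i `|\int[mu]_(x in D) f i x| <= \int[mu]_(x in D) \sum_i `|f i x|.
Proof.
move=> mD fi; rewrite Rintegral_sum//; last by move=> i; exact: integrable_EFin_norm.
by apply: ler_sum => i _; exact: le_normr_Rintegral.
Qed.

Section null_lines.
Context {R : realType}.
Local Notation mR := (measurableTypeR R).

(** The equations hold in the open triangle; its base is negligible. *)
Lemma antidiagonal_null : {ae leb2 R, forall z, z.1 + z.2 <> 0}.
Proof.
pose D : set (mR * mR) := [set z | z.1 + z.2 <= 0] `&` [set z | 0 <= z.1 + z.2].
have ms : measurable_fun setT (fun z : mR * mR => z.1 + z.2 : mR).
  exact: (measurable_funD (@measurable_fst _ _ mR mR) (@measurable_snd _ _ mR mR)).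
exists D; split.
- by apply: measurableI; apply: measurable_set_le => //; exact: measurable_cst.
- rewrite /product_measure1/= integral0_eq// => x _ /=.
  rewrite (_ : xsection _ _ = [set - x]) ?lebesgue_measure_set1//.
  apply/seteqP; split => y; rewrite /xsection/= inE /D/=.
    by move=> [h1 h2]; lra.
  by move=> ->; split; lra.
- move=> z /= /contrapT zE; by split; rewrite /= zE.
Qed.

Lemma ae_integrable_column (f : R * R -> R) : (leb2 R).-integrable setT (EFin \o f) ->
  {ae leb2 R, forall z, (leb1 R).-integrable setT (EFin \o (fun y => f (z.1, y)))}.
Proof. by move=> fi; exact: ae_fst (ae_integrable1 fi). Qed.

Lemma ae_integrable_row (f : R * R -> R) : (leb2 R).-integrable setT (EFin \o f) ->
  {ae leb2 R, forall z, (leb1 R).-integrable setT (EFin \o (fun x => f (x, z.2)))}.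
Proof. by move=> /integrable_swap/ae_integrable_column/ae_swap. Qed.

End null_lines.

Section amplitude.
Context {R : realType}.
Local Notation mR := (measurableTypeR R).

(** The integral of [|F|] over the whole vertical line bounds the column integral
    and depends on [z.1] only. *)
Lemma null_wave_amplitude (A B : R) F U p q phi psi (e : R) :
  null_wave A B F U p q phi psi -> 0 < e ->
  exists a : R -> R, [/\ forall x, 0 <= a x, (leb1 R).-integrable setT (EFin \o a) &
    {ae leb2 R, forall z, z.1 < A - e -> z.2 < B - e -> 0 < z.1 + z.2 ->
       `|p z| <= a z.1}].
Proof.
move=> w e0; have Fi := null_source w.
have [rho rhoi Hp] := transport_with_data (null_wave_transport w) e0.
pose N x := \int[leb1 R]_y `|F (x, y)|.
have Ni : (leb1 R).-integrable setT (EFin \o N).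
  have Fn := integrable_EFin_norm Fi.
  exact: (@integrable_Rfubini1 _ _ mR mR R (leb1 R) (leb1 R) (fun z => `|F z|) Fn).
have N0 x : 0 <= N x by apply: Rintegral_ge0.
exists (fun x => N x + `|rho x|); split.
- by move=> x; rewrite addr_ge0.
- exact: (integrableD measurableT Ni (integrable_EFin_norm rhoi)).
apply: (ae_imply _ (ae_and Hp (ae_integrable_column Fi))) => z [{}Hp Hz] z1 z2 z12.
rewrite Hp//; apply: le_trans (ler_normD _ _) _; rewrite lerD2r.
have colN : `|column_integral F z| <= N z.1.
  have Hi : (leb1 R).-integrable `]-oo, z.2] (EFin \o (fun y => F (z.1, y))).
    exact: integrableS Hz.
  apply: le_trans (le_normr_Rintegral _ Hi) _ => //.
  rewrite /N Rintegral_mkcond; apply: ae_le_Rintegral => //.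
  - by move=> y _; rewrite patchE; case: ifP.
  - exact: (proj1 (integrable_EFin_restrict (leb1 R) (fun y => `|F (z.1, y)|)
      (measurable_itv `]-oo, z.2])) (integrable_EFin_norm Hi)).
  - exact: integrable_EFin_norm.
  - apply: aeW => y _; rewrite patchE; case: ifP => _ //; exact: normr_ge0.
by rewrite normrM ger0_norm ?invr_ge0//; have := N0 z.1; have := normr_ge0 (column_integral F z); lra.
Qed.

Lemma null_wave_amplitudes (n : nat) (A B : R) (F U p q : 'I_n -> R * R -> R)
    (phi psi : 'I_n -> R -> R) (e : R) :
  (forall i, null_wave A B (F i) (U i) (p i) (q i) (phi i) (psi i)) -> 0 < e ->
  exists a : R -> R, [/\ forall x, 0 <= a x, (leb1 R).-integrable setT (EFin \o a) &
    {ae leb2 R, forall z, z.1 < A - e -> z.2 < B - e -> 0 < z.1 + z.2 ->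
       \sum_i `|p i z| <= a z.1}].
Proof.
move=> w e0; have [a Ha] := choice (fun i => null_wave_amplitude (w i) e0).
exists (fun x => \sum_i a i x); split.
- by move=> x; apply: sumr_ge0 => i _; case: (Ha i).
- by apply: integrable_EFin_sum => // i; case: (Ha i).
have H : {ae leb2 R, forall z, forall i : 'I_n, z.1 < A - e -> z.2 < B - e ->
    0 < z.1 + z.2 -> `|p i z| <= a i z.1}.
  by apply: filter_forall => i; case: (Ha i).
by apply: (ae_imply _ H) => z Hz z1 z2 z12; apply: ler_sum => i _; exact: Hz.
Qed.

End amplitude.

Section system.
Context {R : realType}.
Local Notation mR := (measurableTypeR R).
Variables (n : nat) (A B C : R) (h : R * R -> R).
Variables (F1 U1 p1 q1 F2 U2 p2 q2 : 'I_n -> R * R -> R) (phi psi : 'I_n -> R -> R).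
Hypothesis w1 : forall i, null_wave A B (F1 i) (U1 i) (p1 i) (q1 i) (phi i) (psi i).
Hypothesis w2 : forall i, null_wave A B (F2 i) (U2 i) (p2 i) (q2 i) (phi i) (psi i).
Hypothesis F1_past : forall i z, z.1 + z.2 < 0 -> F1 i z = 0.
Hypothesis F2_past : forall i z, z.1 + z.2 < 0 -> F2 i z = 0.
Hypotheses (C0 : 0 <= C) (h0 : forall z, 0 <= h z)
  (hi : (leb2 R).-integrable setT (EFin \o h)).
Hypothesis F_le : forall i z, z.1 < A -> z.2 < B -> 0 < z.1 + z.2 ->
  `|F1 i z - F2 i z| <=
  C * ((\sum_j `|U1 j z - U2 j z|) *
         ((\sum_j `|p1 j z|) * (\sum_j `|q1 j z|) + h z) +
       (\sum_j `|p1 j z - p2 j z|) * (\sum_j `|q1 j z|) +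
       (\sum_j `|p2 j z|) * (\sum_j `|q1 j z - q2 j z|)).

Let D i z := F1 i z - F2 i z.

Let D_past i z : z.1 + z.2 < 0 -> D i z = 0.
Proof. by move=> z0; rewrite /D F1_past// F2_past// subrr. Qed.

Let w12 i := null_wave_sub (w1 i) (w2 i).

Let Dp : {ae leb2 R, forall z, forall i : 'I_n, z.1 < A -> z.2 < B -> 0 < z.1 + z.2 ->
  p1 i z - p2 i z = 2^-1 * column_integral (D i) z}.
Proof.
apply: filter_forall => i.
exact: (transport_without_data (null_wave_transport (w12 i)) (fun=> erefl)).
Qed.

Let Dq : {ae leb2 R, forall z, forall i : 'I_n, z.1 < A -> z.2 < B -> 0 < z.1 + z.2 ->
  q1 i z - q2 i z = 2^-1 * row_integral (D i) z}.
Proof.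
apply: filter_forall => i.
have := transport_without_data (null_wave_transport (null_wave_swap (w12 i))) (fun=> erefl).
move=> /ae_swap; apply: ae_imply => -[x y] /= H xA yB xy.
by apply: H => //; rewrite addrC.
Qed.

Section before_apex.
Variable e : R.
Hypothesis e0 : 0 < e.

Let S : set (mR * mR) := [set z | [/\ z.1 < A - e, z.2 < B - e & 0 <= z.1 + z.2]].

Let mS : measurable S.
Proof.
have m1 := @measurable_fst _ _ mR mR; have m2 := @measurable_snd _ _ mR mR.
have -> : S = ~` [set z : mR * mR | A - e <= z.1] `&` ~` [set z | B - e <= z.2] `&`
    [set z | 0 <= z.1 + z.2].
  apply/seteqP; split => z /=.
    by move=> [z1 z2 z12]; split => //; split; apply/negP; rewrite -ltNge.
  by move=> [[/negP z1 /negP z2] z12]; split => //; rewrite ltNge.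
by repeat apply: measurableI; rewrite ?(measurableC) //; try apply: measurableC;
  apply: measurable_set_le => //; first [exact: measurable_cst|exact: measurable_funD].
Qed.

Let G i := D i \_ S.

Let Gi i : (leb2 R).-integrable setT (EFin \o G i).
Proof.
apply: (proj1 (integrable_EFin_restrict _ _ mS)).
exact: (integrableS measurableT mS (@subsetT _ _) (null_source (w12 i))).
Qed.

Let DG i (z w : R * R) : S z -> w.1 <= z.1 -> w.2 <= z.2 -> D i w = G i w.
Proof.
move=> [z1 z2 _] wz1 wz2; rewrite /G patchE; case: ifPn => // /negP wS.
apply: D_past; rewrite ltNge; apply/negP => w0; apply: wS; rewrite inE; split => //.
  exact: le_lt_trans z1.
exact: le_lt_trans z2.
Qed.

Let quadrantG i z : S z -> quadrant_integral (D i) z = quadrant_integral (G i) z.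
Proof.
move=> Sz; apply: eq_Rintegral => w /set_mem[/=]; rewrite !in_itv/= => w1' w2'.
exact: DG Sz _ _.
Qed.

Let columnG i z : S z -> column_integral (D i) z = column_integral (G i) z.
Proof.
by move=> Sz; apply: eq_Rintegral => y; rewrite inE/= in_itv/= => yz; exact: DG Sz _ _.
Qed.

Let rowG i z : S z -> row_integral (D i) z = row_integral (G i) z.
Proof.
by move=> Sz; apply: eq_Rintegral => y; rewrite inE/= in_itv/= => yz; exact: DG Sz _ _.
Qed.

Let g z := \sum_i `|G i z|.

Let g_ge0 z : 0 <= g z. Proof. exact: sumr_ge0. Qed.

Let gi : (leb2 R).-integrable setT (EFin \o g).
Proof. by apply: integrable_EFin_sum => // i; exact: integrable_EFin_norm. Qed.

Let g_out z : ~ S z -> g z = 0.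
Proof. by move=> Sz; rewrite /g big1// => i _; rewrite /G patchE memNset// normr0. Qed.

Let box_bound (x y : R) : x < A - e -> y < B - e -> 0 <= x + y ->
  - (`|A| + `|B| + 1) <= x <= `|A| + `|B| + 1.
Proof.
move=> xA yB xy; have := ler_norm A; have := ler_norm B.
by have := normr_ge0 A; have := normr_ge0 B; have := e0; lra.
Qed.

(** Truncating [D i] to [S] leaves its integrals over the past of a point of [S]
    unchanged, since [D i] vanishes below the base. So the representations of
    [U1 - U2], [p1 - p2] and [q1 - q2] bound them by integrals of [g], and
    [F_le] together with the amplitudes becomes a Goursat inequality. *)
Lemma source_difference_ae0 : {ae leb2 R, forall z, g z = 0}.
Proof.
have [a1 [a10 a1i Ha1]] := null_wave_amplitudes w1 e0.
have [a2 [a20 a2i Ha2]] := null_wave_amplitudes w2 e0.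
have [b1 [b10 b1i Hb1']] := null_wave_amplitudes (fun i => null_wave_swap (w1 i)) e0.
have Hb1 : {ae leb2 R, forall z, z.1 < A - e -> z.2 < B - e -> 0 < z.1 + z.2 ->
    \sum_i `|q1 i z| <= b1 z.2}.
  by move: Hb1' => /ae_swap; apply: ae_imply => -[x y] /= H xA yB xy; apply: H => //; rewrite addrC.
pose N := n%:R * C.
have N0 : 0 <= N by rewrite mulr_ge0.
have Hcol : {ae leb2 R, forall z, forall i : 'I_n,
    (leb1 R).-integrable setT (EFin \o (fun y => G i (z.1, y)))}.
  by apply: filter_forall => i; exact: ae_integrable_column.
have Hrow : {ae leb2 R, forall z, forall i : 'I_n,
    (leb1 R).-integrable setT (EFin \o (fun x => G i (x, z.2)))}.
  by apply: filter_forall => i; exact: ae_integrable_row.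
apply: (@goursat_uniqueness R g (fun z => N * (a1 z.1 * b1 z.2 + h z))
  (fun x => N * a2 x) (fun y => N * b1 y) (`|A| + `|B| + 1)) => //.
- by move=> z; rewrite mulr_ge0// addr_ge0// mulr_ge0.
- by move=> x; rewrite mulr_ge0.
- by move=> y; rewrite mulr_ge0.
- apply: integrable_EFinZl => //.
  exact: (integrableD measurableT (integrable_tensor a1i b1i) hi).
- exact: integrable_EFinZl.
- exact: integrable_EFinZl.
- by move=> [z1 z2] zr; apply: g_out => -[zA zB z12]; move/negP: zr; apply; exact: (box_bound zA zB z12).
- by move=> z z0; apply: g_out => -[_ _]; rewrite leNgt z0.
apply: (ae_imply _ (ae_and antidiagonal_null (ae_and (ae_and Ha1 (ae_and Ha2 Hb1))
  (ae_and (ae_and Dp Dq) (ae_and Hcol Hrow))))).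
move=> z [zN [[za1 [za2 zb1]] [[zp zq] [zcol zrow]]]].
have Q0 : 0 <= quadrant_integral g z by apply: Rintegral_ge0.
have col0 : 0 <= column_integral g z by apply: Rintegral_ge0.
have row0 : 0 <= row_integral g z by apply: Rintegral_ge0.
have [Sz|/g_out ->] := pselect (S z); last first.
  by rewrite !addr_ge0// mulr_ge0// mulr_ge0// addr_ge0// mulr_ge0.
have [z1 z2 z12] := Sz.
have z12' : 0 < z.1 + z.2 by rewrite lt_neqAle z12 eq_sym andbT; apply/eqP.
have z1A : z.1 < A by have := e0; lra.
have z2B : z.2 < B by have := e0; lra.
have UQ : \sum_j `|U1 j z - U2 j z| <= quadrant_integral g z.
  apply: (@le_trans _ _ (\sum_j `|quadrant_integral (G j) z|)).
    apply: ler_sum => j _.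
    have -> : U1 j z - U2 j z = 4^-1 * quadrant_integral (G j) z.
      rewrite -quadrantG//.
      by have := @null_solution _ _ _ _ _ _ _ _ _ (w12 j) z.1 z.2 z1A z2B z12';
        rewrite -surjective_pairing /= !add0r.
    rewrite normrM ger0_norm ?invr_ge0//.
    by have := normr_ge0 (quadrant_integral (G j) z); lra.
  have mq : measurable (quadrant z) by exact: measurableX.
  by apply: sum_normr_Rintegral_le => // j; exact: integrableS (Gi j).
have PC : \sum_j `|p1 j z - p2 j z| <= column_integral g z.
  apply: (@le_trans _ _ (\sum_j `|column_integral (G j) z|)).
    apply: ler_sum => j _.
    rewrite zp// columnG// normrM ger0_norm ?invr_ge0//.
    by have := normr_ge0 (column_integral (G j) z); lra.
  by apply: sum_normr_Rintegral_le => // j; exact: integrableS (zcol j).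
have QR : \sum_j `|q1 j z - q2 j z| <= row_integral g z.
  apply: (@le_trans _ _ (\sum_j `|row_integral (G j) z|)).
    apply: ler_sum => j _.
    rewrite zq// rowG// normrM ger0_norm ?invr_ge0//.
    by have := normr_ge0 (row_integral (G j) z); lra.
  by apply: sum_normr_Rintegral_le => // j; exact: integrableS (zrow j).
have gE : g z = \sum_i `|F1 i z - F2 i z|.
  by apply: eq_bigr => i _; rewrite -(DG i Sz).
have sum0 (f : 'I_n -> R) : 0 <= \sum_j `|f j| by apply: sumr_ge0.
pose bound := quadrant_integral g z * (a1 z.1 * b1 z.2 + h z) +
  column_integral g z * b1 z.2 + a2 z.1 * row_integral g z.
apply: (@le_trans _ _ (\sum_(i < n) C * bound)); last first.
  by rewrite sumr_const card_ord -mulr_natl /bound /N le_eqVlt; apply/orP; left; apply/eqP; ring.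
rewrite gE; apply: ler_sum => i _; apply: le_trans (F_le i z1A z2B z12') _.
rewrite ler_wpM2l// /bound; apply: lerD; first apply: lerD.
- apply: ler_pM => //; first by rewrite addr_ge0// mulr_ge0.
  by rewrite lerD2r ler_pM// ?za1 ?zb1.
- by apply: ler_pM => //; exact: zb1.
- by apply: ler_pM => //; exact: za2.
Qed.

Lemma solutions_agree_before (x y : R) : x < A - e -> y < B - e -> 0 < x + y ->
  forall i, U1 i (x, y) = U2 i (x, y).
Proof.
move=> xA yB xy i; apply/eqP; rewrite -subr_eq0; apply/eqP.
have xA' : x < A by have := e0; lra.
have yB' : y < B by have := e0; lra.
have := null_solution (w12 i) xA' yB' xy; rewrite /= !add0r => ->.
have mq : measurable (quadrant (x, y)) by exact: measurableX.
rewrite [X in _ * X](_ : _ = 0) ?mulr0//.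
rewrite -[LHS]/(quadrant_integral (D i) (x, y)) quadrantG; last by split => //=; exact: ltW.
rewrite /quadrant_integral Rintegral_mkcond (_ : 0 = \int[leb2 R]_z cst 0 z); last first.
  by rewrite Rintegral0_eq.
apply: ae_eq_Rintegral.
- apply: (proj1 (integrable_EFin_restrict _ _ mq)); exact: integrableS (Gi i).
- exact: integrable0.
apply: (ae_imply _ source_difference_ae0) => z gz; rewrite patchE; case: ifP => // _.
apply/eqP; rewrite -normr_le0 -gz /g (bigD1 i)//= lerDl; exact: sumr_ge0.
Qed.

End before_apex.

Lemma null_waves_unique (x y : R) : x < A -> y < B -> 0 < x + y ->
  forall i, U1 i (x, y) = U2 i (x, y).
Proof.
move=> xA yB; pose e := Num.min (A - x) (B - y) / 2.
have m0 : 0 < Num.min (A - x) (B - y) by rewrite lt_min !subr_gt0 xA yB.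
have e0 : 0 < e by rewrite divr_gt0.
have e1 : 2 * e <= A - x by rewrite /e mulrC divfK// ge_min lexx.
have e2 : 2 * e <= B - y by rewrite /e mulrC divfK// ge_min lexx orbT.
by apply: (solutions_agree_before e0); lra.
Qed.

End system.

(** * Uniqueness of mild solutions *)

Section uniqueness_below_a_point.
Context {R : realType}.
Local Notation mR := (measurableTypeR R).
Variables (n : nat) (M : set 'rV[R]_n).
Variables (Gamma : 'I_n -> 'I_n -> 'rV[R]_n -> 'rV[R]_n) (P : 'rV[R]_n -> 'M[R]_n).
Hypothesis coefficients : wave_map_coefficients M Gamma P.
Variables (x0 L T0 : R).
Hypothesis T0_ge0 : 0 <= T0.
Let K := trapezoid x0 L T0.
Variables (u0 v0 : R -> 'rV[R]_n) (f : R * R -> 'rV[R]_n).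
Hypothesis v0_L1 : L1 (leb1 R) (xsection K 0) v0.
Hypothesis f_L1 : L1 (leb2 R) K f.
Variables (u1 u1t u1x u2 u2t u2x : R * R -> 'rV[R]_n).
Hypothesis u1_mild : mild_solution K M Gamma P u0 v0 f u1 u1t u1x.
Hypothesis u2_mild : mild_solution K M Gamma P u0 v0 f u2 u2t u2x.

Let source (t x : R) (z : R * R) : R :=
  ((fun w => ell1 (f (of_null w))) \_ (null_triangle (t + x) (t - x))) z.

Let integrable_source t x : K (t, x) ->
  (leb2 R).-integrable setT (EFin \o source t x).
Proof.
move=> Ktx; have mb := measurable_backward_triangle t x.
have bK : backward_triangle t x `<=` K.
  move=> z [/andP[h1 h2] /andP[h3 h4]]; apply: (trapezoid_past Ktx) => //; lra.
have fi : (leb2 R).-integrable (backward_triangle t x) (EFin \o (fun z => ell1 (f z))).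
  apply: integrable_EFin_sum => // i; apply: integrable_EFin_norm.
  apply: (integrableS _ mb bK (f_L1 i)).
  have KE : K = backward_triangle L x0 `&` ([set z : mR * mR | 0 <= z.1] `&` [set z | z.1 <= T0]).
    apply/seteqP; split => z; rewrite /K /trapezoid /backward_triangle/=.
      move=> [/andP[h1 h2] /andP[h3 h4]]; split => //; split; last by apply/andP.
      by apply/andP; split => //; lra.
    by move=> [[_ ->] [-> ->]].
  rewrite KE; apply: measurableI; first exact: measurable_backward_triangle.
  have m1 := @measurable_fst _ _ mR mR.
  by apply: measurableI; apply: measurable_set_le => //; exact: measurable_cst.
have := integrable_of_null mb fi; rewrite backward_triangleE => H.
apply: (proj1 (integrable_EFin_restrict _ _ _)); last exact: H.
by rewrite -backward_triangleE; exact: measurable_of_null_preimage.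
Qed.

(** Each component is a wave in null coordinates whose source is cut off outside
    the backward triangle of [(t, x)], which contains those of all points
    considered. *)
Lemma agree_below t x (y z : R) : K (t, x) -> y < t + x -> z < t - x -> 0 < y + z ->
  u1 (of_null (y, z)) = u2 (of_null (y, z)).
Proof.
move=> Ktx yA zB yz.
have [C C0 [CG LG LP]] := coefficient_bound coefficients.
have [_ [u1t_weak u1x_weak] _ u1_formula] := u1_mild.
have [_ [u2t_weak u2x_weak] _ u2_formula] := u2_mild.
have W1 i := mild_null_wave T0_ge0 Ktx i v0_L1 u1t_weak u1x_weak u1_formula.
have W2 i := mild_null_wave T0_ge0 Ktx i v0_L1 u2t_weak u2x_weak u2_formula.
have past F i (w : R * R) : w.1 + w.2 < 0 -> null_forcing t x F i w = 0.
  by move=> w0; rewrite /null_forcing patchE memNset// => -[_ _]; rewrite leNgt w0.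
have s0 w : 0 <= source t x w.
  by rewrite /source patchE; case: ifP => // _; exact: ell1_ge0.
have F_le i (w : R * R) : w.1 < t + x -> w.2 < t - x -> 0 < w.1 + w.2 ->
    `|null_forcing t x (wave_map_rhs Gamma P f u1 u1t u1x) i w -
      null_forcing t x (wave_map_rhs Gamma P f u2 u2t u2x) i w| <=
    C * ((\sum_j `|null_component j u1 w - null_component j u2 w|) *
         ((\sum_j `|null_component j (u1t + u1x) w|) *
          (\sum_j `|null_component j (u1t - u1x) w|) + source t x w) +
       (\sum_j `|null_component j (u1t + u1x) w - null_component j (u2t + u2x) w|) *
         (\sum_j `|null_component j (u1t - u1x) w|) +
       (\sum_j `|null_component j (u2t + u2x) w|) *
         (\sum_j `|null_component j (u1t - u1x) w - null_component j (u2t - u2x) w|)).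
  move=> w1 w2 w12.
  have wT : w \in null_triangle (t + x) (t - x) by rewrite inE; split; exact: ltW.
  rewrite /null_forcing /source !patchE wT /null_component.
  have ell1B (a b : 'rV[R]_n) : ell1 (a - b) = \sum_k `|a 0 k - b 0 k|.
    by apply: eq_bigr => k _; rewrite !mxE.
  have := @wave_map_rhs_lipschitz R n Gamma P C f u1 u1t u1x u2 u2t u2x (of_null w) i CG LG LP.
  by rewrite (ell1B (u1 _)) (ell1B ((u1t + u1x) _)) (ell1B ((u1t - u1x) _)).
have H := @null_waves_unique R n (t + x) (t - x) C (source t x)
  (null_forcing t x (wave_map_rhs Gamma P f u1 u1t u1x))
  (fun j => null_component j u1) (fun j => null_component j (u1t + u1x))
  (fun j => null_component j (u1t - u1x))
  (null_forcing t x (wave_map_rhs Gamma P f u2 u2t u2x))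
  (fun j => null_component j u2) (fun j => null_component j (u2t + u2x))
  (fun j => null_component j (u2t - u2x))
  (right_data t x u0 v0) (left_data t x u0 v0) W1 W2 (past _ _) (past _ _) C0 s0
  (integrable_source Ktx) F_le y z yA zB yz.
by apply/rowP => i; exact: H.
Qed.

End uniqueness_below_a_point.

Theorem theorem6p8 (R : realType) (n d : nat)
  (M : set 'rV[R]_n) (M_compact : compact M) (M_submanifold : submanifold d M)
  (Gamma : 'I_n -> 'I_n -> 'rV[R]_n -> 'rV[R]_n) (P : 'rV[R]_n -> 'M[R]_n)
  (coefficients : wave_map_coefficients M Gamma P)
  (x0 L T0 : R) (L_gt0 : 0 < L) (T0_gt0 : 0 < T0) (T0_leL : T0 <= L)
  (K := trapezoid x0 L T0)
  (u0 v0 : R -> 'rV[R]_n) (data : in_L11 (xsection K 0) M u0 v0)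
  (compatible : {ae leb1 R, forall x, xsection K 0 x -> tangent M (u0 x) (v0 x)})
  (f : R * R -> 'rV[R]_n) (f_L1 : L1 (leb2 R) K f)
  (u1 u1t u1x u2 u2t u2x : R * R -> 'rV[R]_n)
  (u1_H : in_H K T0 u1 u1t u1x) (u2_H : in_H K T0 u2 u2t u2x)
  (u1_mild : mild_solution K M Gamma P u0 v0 f u1 u1t u1x)
  (u2_mild : mild_solution K M Gamma P u0 v0 f u2 u2t u2x) :
  forall z, K z -> u1 z = u2 z.
Proof.
move=> [t x] Ktx; have [_ _ _ v0_L1] := data.
have [t0 _] : 0 <= t /\ t <= T0 by case: Ktx => /= /andP[].
(* At [t = 0] the triangle is a point, and the mild formula contains the data
   only. *)
have [t_gt0|t_le0] := ltP 0 t; last first.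
  have tE : t = 0 by apply/eqP; rewrite eq_le t_le0.
  have [_ _ _ h1] := u1_mild; have [_ _ _ h2] := u2_mild.
  have z0 (g : R -> 'rV[R]_n) : vint (leb1 R) `[0, t] g = 0.
    by apply/rowP => i; rewrite !mxE tE set_itv1 Rintegral_set1.
  by have [_ ->] := h1 _ _ Ktx; have [_ ->] := h2 _ _ Ktx; rewrite !z0.
(* the points just below [(t, x)] lie in the open triangle *)
have below (e : R) : 0 < e -> e < t -> K (t - e, x) /\ u1 (t - e, x) = u2 (t - e, x).
  move=> e0 et; split.
    by apply: (trapezoid_past Ktx) => /=; lra.
  have := @agree_below R n M Gamma P coefficients x0 L T0 (ltW T0_gt0) u0 v0 f v0_L1 f_L1
    u1 u1t u1x u2 u2t u2x u1_mild u2_mild t x (t - e + x) (t - e - x) Ktx.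
  rewrite /of_null/=.
  have -> : (t - e + x + (t - e - x)) / 2 = t - e by field.
  have -> : (t - e + x - (t - e - x)) / 2 = x by field.
  by apply; lra.
have [[u1c _] _ _ _] := u1_mild; have [[u2c _] _ _ _] := u2_mild.
have lim (u : R * R -> 'rV[R]_n) : {within K, continuous u} ->
    u (t - e, x) @[e --> 0^'+] --> u (t, x).
  move=> /subspace_continuousP /(_ _ Ktx) uc.
  apply: (cvg_trans _ uc) => V /=; rewrite /within/= => HV.
  have cv1 : (t - e : R) @[e --> (0 : R)^'+] --> t.
    rewrite -[X in _ --> X]subr0; apply: cvgB; first exact: cvg_cst.
    exact: cvg_at_right_filter cvg_id.
  have cv2 : (fun _ : R => x) @ (0 : R)^'+ --> x by exact: cvg_cst.
  have cv : (fun e : R => (t - e, x)) @ (0 : R)^'+ --> (nbhs t, nbhs x).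
    exact: cvg_pair cv1 cv2.
  have small : \forall e \near (0 : R)^'+, 0 < e < t.
    near=> e; apply/andP; split; near: e; [exact: nbhs_right_gt|exact: nbhs_right_lt].
  have H : \forall e \near (0 : R)^'+, K (t - e, x) -> V (u (t - e, x)) by exact: cv HV.
  apply: (@filterS2 _ (0 : R)^'+ _ _ _ _ _ H small) => e /= eV /andP[e0 et].
  exact: eV (below e e0 et).1.
have l1 := lim _ u1c; have l2 := lim _ u2c.
have : u1 (t - e, x) @[e --> (0 : R)^'+] --> u2 (t, x).
  apply: cvg_trans l2; apply: near_eq_cvg; near=> e.
  by apply/esym/(below e _ _).2; near: e; [exact: nbhs_right_gt|exact: nbhs_right_lt].
exact: cvg_unique l1.
Unshelve. all: by end_near. Qed.
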